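(* Consider the combinatorial causal bandit problem with budget $K$ and horizon $T$ on a linear model with continuous $[0,1]$-valued variables $G=(\boldsymbol U\cup\boldsymbol X\cup\{Y\},E)$ with hidden variables of the admissible form described in the context, and let $G'$ be the transformed Markovian linear model, with $n$ nodes and maximum in-degree $D=\max_{X\in\boldsymbol X\cup\{Y\}}|\mathrm{Pa}'(X)|$. Then the regret (with respect to $G$) of the algorithm BLM-LR run on $G'$ satisfies $$R(T)=O\left(n^2\sqrt{DT}\,\log T\right).$$
   Context: **Linear model with hidden variables.** $G=(\boldsymbol U\cup\boldsymbol X\cup\{Y\},E)$ is a finite DAG with $[0,1]$-valued variables; $\boldsymbol U=\{U_0,U_1,\dots\}$ are hidden, $\boldsymbol X\cup\{Y\}$ observed; $Y$ has no outgoing edges; $U_0\equiv1$ has only outgoing edges. For every node $X\neq U_0$ with parents $\mathrm{Pa}(X)$: $X=\boldsymbol\theta^*_X\cdot \mathrm{Pa}(X)+\varepsilon_X$, with unknown $\boldsymbol\theta^*_X\in[0,1]^{|\mathrm{Pa}(X)|}$ and $\varepsilon_X$ a zero-mean sub-Gaussian noise ensuring $X\in[0,1]$. $\theta^*_{Z,X}$ is the weight of edge $(Z,X)$. Arbitrary edges involving hidden nodes are allowed, except that the following is excluded: a hidden node $U_s$ with $s>0$ has a directed path to an observed $X_i$ and a directed path to an observed descendant $X_j$ of $X_i$, with all nodes of both paths hidden except the end points $X_i$, $X_j$. $do(\boldsymbol S=\boldsymbol s)$ forces $\boldsymbol S$ to values $\boldsymbol s$; $do(\boldsymbol S)$ means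 $do(\boldsymbol S=\boldsymbol 1)$. **Transformed model $G'$.** $G'=(\{X_1\}\cup\boldsymbol X\cup\{Y\},E')$, with $X_1\notin\boldsymbol X\cup\{Y\}$ a new node constantly equal to $1$. A hidden path from observed $X_i$ to observed $X_j$ in $G$ is a directed path all of whose intermediate nodes (if any) are hidden; $\theta^*_P$ is the product of the weights on $P$. If the set $\mathcal P^u_{X_i,X_j}$ of hidden paths is nonempty, $E'$ contains $(X_i,X_j)$ with weight $\theta^{*\prime}_{X_i,X_j}=\sum_{P\in\mathcal P^u_{X_i,X_j}}\theta^*_P$. For each $X_i\in\boldsymbol X\cup\{Y\}$, $E'$ contains $(X_1,X_i)$ with weight $\theta^{*\prime}_{X_1,X_i}=\mathbb E[X_i\mid do(\boldsymbol X\cup\{Y\}\setminus\{X_i\}=\boldsymbol0)]$ (expectation in $G$). $\mathrm{Pa}'(X)$ denotes parents in $G'$. $\sigma'(\boldsymbol S,\boldsymbol\theta)$ is the expectation of $Y$ under $do(\boldsymbol S)$ in $G'$ with parameters $\boldsymbol\theta$; it is taken to be the expectation of $Y$ in the binary linear model with the same graph and parameters (in which, in topological order, a non-intervened $X$ equals $1$ iff $\boldsymbol\theta_X\cdot \mathrm{Pa}'(X)+\varepsilon_X\ge\gamma_X$, $\gamma_X$ i.i.d. uniform on $[0,1]$, and equals $0$ otherwise). **Problem.** In each round $t=1,\dots,T$ (independent noise across rounds) the agent chooses $\boldsymbol S_t\subseteq\boldsymbol X$, $|\boldsymbol S_t|\le K$, plays $do(\boldsymbol S_t)$ in $G$, and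 observes all values of $\boldsymbol X\cup\{Y\}$. The observed graph structure is known; the parameters are not. $R(T)=\mathbb E[\sum_{t=1}^T(\mathbb E[Y\mid do(\boldsymbol S^* )]-\mathbb E[Y\mid do(\boldsymbol S_t)])]$, where $\boldsymbol S^*$ maximizes $\mathbb E[Y\mid do(\boldsymbol S)]$ over $\boldsymbol S\subseteq\boldsymbol X$, $|\boldsymbol S|=K$. **Algorithm BLM-LR on $G'$.** $\|\boldsymbol x\|_M=\sqrt{\boldsymbol x^\top M\boldsymbol x}$. For each $X\in\boldsymbol X\cup\{Y\}$ put $M_{0,X}=\mathbf I$, $\boldsymbol b_{0,X}=\boldsymbol0$, $\hat{\boldsymbol\theta}_{0,X}=\boldsymbol0$ (dimension $|\mathrm{Pa}'(X)|$); $\delta=\frac1{n\sqrt T}$; $\rho_t=\sqrt{n\log(1+tn)+2\log\frac1\delta}+\sqrt n$. In round $t=1,\dots,T$: let $\mathcal C_{t,X}=\{\boldsymbol\theta'_X\in[0,1]^{|\mathrm{Pa}'(X)|}:\|\boldsymbol\theta'_X-\hat{\boldsymbol\theta}_{t-1,X}\|_{M_{t-1,X}}\le\rho_{t-1}\}$; choose $(\boldsymbol S_t,\tilde{\boldsymbol\theta}_t)$ maximizing $\sigma'(\boldsymbol S,\boldsymbol\theta')$ over $\boldsymbol S\subseteq\boldsymbol X$, $|\boldsymbol S|\le K$, $\boldsymbol\theta'_X\in\mathcal C_{t,X}$ for all $X$; play $do(\boldsymbol S_t)$; for each $X\notin\boldsymbol S_t$, with $\boldsymbol V_{t,X}$ the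 observed values of $\mathrm{Pa}'(X)$ and $X^t$ the observed value of $X$, set $M_{t,X}=M_{t-1,X}+\boldsymbol V_{t,X}\boldsymbol V_{t,X}^\top$, $\boldsymbol b_{t,X}=\boldsymbol b_{t-1,X}+X^t\boldsymbol V_{t,X}$, $\hat{\boldsymbol\theta}_{t,X}=M_{t,X}^{-1}\boldsymbol b_{t,X}$ (no update for $X\in\boldsymbol S_t$). *)

(* Defs.v *)
From HB Require Import structures.
From mathcomp Require Import all_boot all_order all_algebra.
From mathcomp Require Import all_classical all_reals all_analysis.

Set Implicit Arguments.
Unset Strict Implicit.
Unset Printing Implicit Defensive.
Import Order.TTheory GRing.Theory Num.Theory.
Import numFieldNormedType.Exports.

Local Open Scope classical_set_scope.
Local Open Scope ring_scope.

Definition acyclic (V : finType) (e : rel V) : Prop :=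
  forall c : seq V, cycle e c -> c = [::].

(** On a DAG a directed path has fewer edges than there are nodes, so iterating
    the simultaneous update [F] that many times evaluates all nodes in
    topological order ([solveE], [solve_unique]); the start [x0] is
    irrelevant. *)
Definition solve (V : finType) (A : Type) (F : (V -> A) -> V -> A)
    (x0 : V -> A) : V -> A :=
  iter #|V| F x0.

Section solve_theory.
Variables (V : finType) (A : Type) (e : rel V) (F : (V -> A) -> V -> A).
Hypothesis e_acyclic : acyclic e.
Hypothesis F_local : forall x y v,
  (forall z, e z v -> x z = y z) -> F x v = F y v.

Let path_uniq u p : path e u p -> uniq (u :: p).
Proof.
elim: p u => [//|w p IHp] u /= /andP[euw ewp].
have /= -> := IHp _ ewp; rewrite andbT.
apply/negP => uwp.
have : path e u (w :: p) by rewrite /= euw.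
case/path.splitP: uwp => p1 p2; rewrite cat_path => /andP[+ _].
by move=> /(e_acyclic (c := u :: p1)).
Qed.

Let iter_indep m x y v :
  (forall u p, path e u p -> last u p = v -> (size p < m)%N) ->
  iter m F x v = iter m F y v.
Proof.
elim: m v => [v /(_ v [::] isT erefl)//|m IHm v short].
rewrite !iterS; apply: F_local => z ezv; apply: IHm => u p eup lastp.
have := short u (rcons p v); rewrite rcons_path eup lastp ezv last_rcons.
by rewrite size_rcons ltnS; apply.
Qed.

Let path_short u p : path e u p -> (size p < #|V|)%N.
Proof. by move=> /path_uniq/card_uniqP /= <-; exact: max_card. Qed.

Lemma solveE x0 v : solve F x0 v = F (solve F x0) v.
Proof.
by rewrite /solve -iterS iterSr; apply: iter_indep => u p /path_short.
Qed.

Lemma solve_unique x0 x : (forall v, x v = F x v) -> x = solve F x0.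
Proof.
move=> xF; have Fx : F x = x by apply/funext => v; rewrite -xF.
have iterx k : iter k F x = x by elim: k => // k IHk; rewrite iterS IHk.
apply/funext => v; rewrite -[in LHS](iterx #|V|).
by apply: iter_indep => u p /path_short.
Qed.

End solve_theory.

Definition mutually_independent d d' (T : measurableType d)
    (T' : measurableType d') (R : realType) (P : probability T R)
    (I : eqType) (X : I -> T -> T') : Prop :=
  forall (s : seq I) (B : I -> set T'), uniq s ->
    (forall i, measurable (B i)) ->
    P (\bigcap_(i in [set` s]) (X i @^-1` B i)) =
    (\prod_(i <- s) P (X i @^-1` B i))%E.

Definition sub_gaussian d (T : measurableType d) (R : realType)
    (P : probability T R) (X : {RV P >-> R}) : Prop :=
  exists c : R, forall r : R, ('M_P X r <= (expR (c ^+ 2 * r ^+ 2 / 2))%:E)%E.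

Definition zero_mean d (T : measurableType d) (R : realType)
    (P : probability T R) (X : {RV P >-> R}) : Prop :=
  P.-integrable setT (EFin \o X) /\ 'E_P[X]%E = 0%E.

(** [U] is the set of hidden nodes and [X] the set of observed nodes other than
    the reward node Y.  The observed nodes are [option X], with [None] for Y. *)
Definition node (U X : finType) : finType := (U + option X)%type.

Record linear_model (R : realType) (U X : finType) := LinearModel {
  u0 : U;
  edge : rel (node U X);
  weight : node U X -> node U X -> R }.

Section linear_model.
Variables (R : realType) (U X : finType) (G : linear_model R U X).

Definition is_path_via_hidden (z : node U X) (p : seq U) (x : option X) :=
  path (edge G) z (rcons (map inl p) (inr x)).

Definition confounding : Prop :=
  exists (u : U) (i j : option X) (p q : seq U),
    [/\ u != u0 G, is_path_via_hidden (inl u) p i,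
        is_path_via_hidden (inl u) q j,
        i != j & connect (edge G) (inr i) (inr j)].

Record admissible : Prop := Admissible {
  _ : acyclic (edge G);
  _ : forall v, ~~ edge G (inr None) v;
  _ : forall v, ~~ edge G v (inl (u0 G));
  _ : forall z v, edge G z v -> 0 <= weight G z v <= 1;
  _ : ~ confounding }.

(** An intervention [s] forces the observed [x] to [r] when [s x = Some r] and
    leaves [x] alone when [s x = None]. *)
Definition intervention := option X -> option R.

Definition do1 (S : {set X}) : intervention :=
  fun x => if x is Some x' then (if x' \in S then Some 1 else None) else None.

Definition do0_except (x : option X) : intervention :=
  fun z => if z == x then None else Some 0.

Definition structural (s : intervention) (eps : node U X -> R)
    (x : node U X -> R) (v : node U X) : R :=
  let natural := \sum_(z | edge G z v) weight G z v * x z + eps v in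
  match v with
  | inl u => if u == u0 G then 1 else natural
  | inr o => odflt natural (s o)
  end.

Definition value (s : intervention) (eps : node U X -> R) : node U X -> R :=
  solve (structural s eps) (fun=> 0).

Lemma valueE s eps v : admissible ->
  value s eps v = structural s eps (value s eps) v.
Proof.
case=> acyc _ _ _ _; apply: (solveE acyc) => x y {}v xy.
have E : \sum_(z | edge G z v) weight G z v * x z =
         \sum_(z | edge G z v) weight G z v * y z.
  by apply: eq_bigr => z /xy ->.
by rewrite /structural; case: v xy E => ? _ ->.
Qed.

Section noise.
Context d (W : measurableType d) (P : probability W R).
Variable eps : node U X -> {RV P >-> R}.

Definition value_at (s : intervention) (v : node U X) (w : W) : R :=
  value s (fun z => eps z w) v.

Definition mean_do (s : intervention) (x : option X) : R :=
  fine ('E_P[value_at s (inr x)])%E.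

(** The noise at [u0 G] is never used. *)
Record admissible_noise : Prop := AdmissibleNoise {
  _ : mutually_independent P (fun v => eps v : W -> R);
  _ : forall v, v != inl (u0 G) -> zero_mean (eps v) /\ sub_gaussian (eps v);
  _ : forall s : intervention,
      (forall x r, s x = Some r -> 0 <= r <= 1) ->
      forall v, {ae P, forall w, 0 <= value_at s v w <= 1} }.

End noise.
End linear_model.

(** The nodes of the transformed model: [None] is the constant node X_1,
    [Some x] is the observed node [x]. *)
Definition mnode (X : finType) : finType := option (option X).

Record markov_model (R : realType) (X : finType) := MarkovModel {
  medge : rel (mnode X);
  mweight : mnode X -> mnode X -> R }.

Section transformed.
Variables (R : realType) (U X : finType) (G : linear_model R U X).

(** The sequences of intermediate nodes of the hidden paths from [i] to [j]; on
    a DAG they are duplicate-free, hence no longer than [#|U|]. *)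
Definition hidden_paths (i j : option X) : seq (seq U) :=
  [seq p <- [seq tval q | k <- iota 0 #|U|.+1, q <- enum {: k.-tuple U}]
  | is_path_via_hidden G (inr i) p j].

Fixpoint path_weight (z : node U X) (p : seq (node U X)) : R :=
  if p is v :: p' then weight G z v * path_weight v p' else 1.

Definition transformed_edge : rel (mnode X) := fun z x =>
  match z, x with
  | _, None => false
  | None, Some _ => true
  | Some i, Some j => hidden_paths i j != [::]
  end.

Definition transformed_weight d (W : measurableType d) (P : probability W R)
    (eps : node U X -> {RV P >-> R}) (z x : mnode X) : R :=
  match z, x with
  | _, None => 0
  | None, Some i => mean_do G eps (do0_except R i) i
  | Some i, Some j =>
    \sum_(p <- hidden_paths i j)
      path_weight (inr i) (rcons (map inl p) (inr j))
  end.

Definition transformed d (W : measurableType d) (P : probability W R)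
    (eps : node U X -> {RV P >-> R}) : markov_model R X :=
  MarkovModel transformed_edge (transformed_weight eps).

End transformed.

Section markov_model.
Variables (R : realType) (X : finType) (G' : markov_model R X).

Definition Pa (x : option X) : {set mnode X} :=
  [set z | medge G' z (Some x)]%SET.

Definition nnodes : nat := #|mnode X|.

Definition max_indegree : nat := \max_(x : option X) #|Pa x|.

Definition params := forall x : option X, 'cV[R]_#|Pa x|.

Definition in_cube k (theta : 'cV[R]_k) : Prop :=
  forall i, 0 <= theta i 0 <= 1.

Definition parent_values (y : mnode X -> R) (x : option X) : 'cV[R]_#|Pa x| :=
  \col_i y (enum_val i).

Definition dot k (a b : 'cV[R]_k) : R := (a^T *m b) 0 0.

Definition binary_step (S : {set X}) (theta : params)
    (eps gam : option X -> R) (y : mnode X -> R) (v : mnode X) : R :=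
  if v is Some x then
    if (if x is Some x' then x' \in S else false) then 1
    else if gam x <= dot (theta x) (parent_values y x) + eps x then 1 else 0
  else 1.

Definition binary_value (S : {set X}) (theta : params)
    (eps gam : option X -> R) : mnode X -> R :=
  solve (binary_step S theta eps gam) (fun=> 0).

Section binary_noise.
Context d (W : measurableType d) (P : probability W R).
Variables (eps : params -> option X -> {RV P >-> R})
          (gam : option X -> {RV P >-> R}).

Definition sigma (S : {set X}) (theta : params) : R :=
  fine 'E_P[fun w => binary_value S theta (fun x => eps theta x w)
                                  (fun x => gam x w) (Some None)]%E.

(** The noise of a binary linear model has to keep the activation probability
    in [0,1], a requirement that involves the parameters: the noise may thus
    depend on them.  For some parameters in the cube and some 0/1 values of the
    parents the noiseless probability already exceeds 1, no zero-mean noise can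
    bring it back, and nothing is required there. *)
Record admissible_binary_noise : Prop := AdmissibleBinaryNoise {
  _ : forall x (B : set R), measurable B ->
      P (gam x @^-1` B) = uniform_prob (@ltr01 R) B;
  _ : forall theta : params, (forall x, in_cube (theta x)) ->
      mutually_independent P (fun i : option X + option X =>
        match i with inl x => eps theta x : W -> R | inr x => gam x end);
  _ : forall theta : params, (forall x, in_cube (theta x)) ->
      forall x, zero_mean (eps theta x) /\ sub_gaussian (eps theta x);
  _ : forall theta : params, (forall x, in_cube (theta x)) ->
      forall (x : option X) (A : {set mnode X}), None \in A ->
      let m := dot (theta x) (parent_values (fun z => (z \in A)%:R) x) in
      m <= 1 -> {ae P, forall w, 0 <= m + eps theta x w <= 1} }.

End binary_noise.
End markov_model.

(** Rounds are numbered from 0: [S t], [draw t] and [obs t] belong to the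
    (t+1)-st round, whereas [gram t], [moment t], [estimate t] and [radius t]
    are the quantities available after [t] rounds. *)
Section BLM_LR.
Variables (R : realType) (U X : finType) (G : linear_model R U X).
Context d (W : measurableType d) (P : probability W R).
Variable eps : node U X -> {RV P >-> R}.

Context d' (Om : measurableType d').
Variables (draw : nat -> {mfun Om >-> W}) (S : nat -> Om -> {set X}).

Definition obs (t : nat) (x : option X) (om : Om) : R :=
  value_at G eps (do1 R (S t om)) (inr x) (draw t om).

Definition history (t : nat) : set (set Om) :=
  <<s [set A | exists s x B, [/\ (s < t)%N, measurable B
                                 & A = obs s x @^-1` B]] >>.

Variables (K T : nat) (G' : markov_model R X).

Definition regressor (t : nat) (om : Om) (x : option X) : 'cV[R]_#|Pa G' x| :=
  parent_values G' (fun z => if z is Some i then obs t i om else 1) x.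

Definition intervened (t : nat) (om : Om) (x : option X) : bool :=
  if x is Some x' then x' \in S t om else false.

Fixpoint gram (t : nat) (om : Om) (x : option X) : 'M[R]_#|Pa G' x| :=
  if t is t'.+1 then
    if intervened t' om x then gram t' om x
    else gram t' om x + regressor t' om x *m (regressor t' om x)^T
  else 1%:M.

Fixpoint moment (t : nat) (om : Om) (x : option X) : 'cV[R]_#|Pa G' x| :=
  if t is t'.+1 then
    if intervened t' om x then moment t' om x
    else moment t' om x + obs t' x om *: regressor t' om x
  else 0.

Definition estimate (t : nat) (om : Om) (x : option X) : 'cV[R]_#|Pa G' x| :=
  invmx (gram t om x) *m moment t om x.

Definition mnorm k (M : 'M[R]_k) (v : 'cV[R]_k) : R :=
  Num.sqrt (dot v (M *m v)).

Definition delta : R := 1 / ((nnodes X)%:R * Num.sqrt T%:R).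

Definition radius (t : nat) : R :=
  Num.sqrt ((nnodes X)%:R * ln (1 + (t * nnodes X)%:R) + 2 * ln (1 / delta))
  + Num.sqrt (nnodes X)%:R.

Definition confident (t : nat) (om : Om) (theta : params G') : Prop :=
  forall x, in_cube (theta x) /\
    mnorm (gram t om x) (theta x - estimate t om x) <= radius t.

Context db (Wb : measurableType db) (Pb : probability Wb R).
Variables (beps : params G' -> option X -> {RV Pb >-> R})
          (gam : option X -> {RV Pb >-> R}).

(** The confidence region may be empty on an event of small probability; then
    there is nothing to maximize and any set within the budget may be played.
    Ties are broken measurably from the past observations. *)
Record is_BLM_LR_run (theta : nat -> Om -> params G') : Prop := IsBLMLRRun {
  _ : forall t, (t < T)%N -> forall A : {set X},
      history t [set om | S t om = A];
  _ : forall t om, (t < T)%N -> (#|S t om| <= K)%N;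
  _ : forall t om, (t < T)%N -> (exists th, confident t om th) ->
      confident t om (theta t om) /\
      forall (A : {set X}) (th : params G'), (#|A| <= K)%N ->
        confident t om th ->
        sigma beps gam A th <= sigma beps gam (S t om) (theta t om) }.

End BLM_LR.

Section regret.
Variables (R : realType) (U X : finType) (G : linear_model R U X).
Context d (W : measurableType d) (P : probability W R).
Variable eps : node U X -> {RV P >-> R}.

Definition reward (S : {set X}) : R := mean_do G eps (do1 R S) None.

Definition is_optimal (K : nat) (S : {set X}) : Prop :=
  #|S| = K /\ forall A : {set X}, #|A| = K -> reward A <= reward S.

Context d' (Om : measurableType d') (Q : probability Om R).

Record independent_rounds (T : nat) (draw : nat -> {mfun Om >-> W}) : Prop :=
  IndependentRounds {
  _ : forall t (B : set W), (t < T)%N -> measurable B ->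
      Q (draw t @^-1` B) = P B;
  _ : mutually_independent Q (fun t : 'I_T => draw t : Om -> W) }.

Definition regret (T : nat) (Sopt : {set X}) (S : nat -> Om -> {set X}) :
    \bar R :=
  'E_Q[fun om => (\sum_(t < T) (reward Sopt - reward (S t om)))%R]%E.

End regret.

(* Main.v *)
(** Let [theta0] be the true parameters of the transformed model.  By optimism
    the regret of round [t] is at most [sigma S_t theta_t - reward S_t] as soon
    as [theta0] lies in the confidence region.  This difference is at most the
    sum, over the nodes [x] left alone, of the positive part of
    [<theta_t - theta0, E V_x>], with [V_x] the parents of [x]: in the binary
    model, lower the activation threshold of each overestimated node until its
    mean drops to the true one; the two coupled models first differ at a node
    whose own threshold was lowered, an event whose probability is at most the
    overestimate at that node.  By Cauchy-Schwarz the overestimate is at most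
    [2 rho_t E ||V_x||] in the norm of [M_t^-1], and the elliptical potential
    lemma bounds the sum of these norms over the rounds.

    The observed nodes satisfy a linear regression with parameters [theta0]
    because no hidden node confounds an observed node with one of its
    descendants: the noise of [x] in the transformed model is then independent
    of the parents of [x].  Given these parents it is centered in an interval of
    length 1, so by Hoeffding's lemma the Gaussian mixture
    [det(M_t)^(-1/2) exp (||noise_sum||^2 / 2)], in the norm of [M_t^-1], is a
    supermartingale, and Markov's inequality gives the confidence region. *)

Require Import Defs.
From HB Require Import structures.
From mathcomp Require Import all_boot all_order all_algebra.
From mathcomp Require Import all_classical all_reals all_analysis.
From mathcomp Require Import measurable_realfun ring lra.
Import Order.TTheory GRing.Theory Num.Theory.
Import numFieldNormedType.Exports.
Local Open Scope classical_set_scope.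
Local Open Scope ring_scope.

Set Implicit Arguments.
Unset Strict Implicit.
Unset Printing Implicit Defensive.

(** No conditional expectation is formed: the past is a sub-sigma-algebra generated by a block of
    independent variables, which [independent_fubini] freezes while the fresh variable is
    integrated. The same exchange reconciles the widths, expected over a fresh draw, with the
    elliptical potential, a pathwise bound on the observed regressors.

    Hoeffding's lemma enters as a comparison with the chord of a convex function. The chord is
    affine in the residual, which thus only has to be uncorrelated with bounded functions of the
    parents.

    Optimistic parameters may push an activation score above 1, where the binary noise is
    unconstrained. Clipping the activation level to [0,1] leaves the model unchanged almost surely
    and makes its mean at most the mean score; equality is needed only at the true parameters, whose
    scores never exceed 1.

    No union bound is taken: a round in which some mixture reaches [1 / delta] loses at most 1,
    hence at most [delta] times that mixture, whose mean is at most 1; this costs at most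
    [T * n * delta = sqrt T] in all. *)

(** * Exponential moments of centered variables on an interval of length 1 *)

Section exponential_inequalities.
Variable R : realType.
Implicit Types x y w u p a c l : R.

Lemma le_at0_of_derive_le0 (f df : R -> R) :
  (forall x, is_derive x 1 f (df x)) -> (forall x, 0 <= x -> df x <= 0) ->
  forall x, 0 <= x -> f x <= f 0.
Proof.
move=> fdf df0 x x0; rewrite -subr_le0.
have cf : {within `[0, x], continuous f}.
  by apply: derivable_within_continuous => y _; have [] := fdf y.
have [y + ->] := MVT_segment x0 (fun y _ => fdf y) cf.
rewrite in_itv/= => /andP[y0 _].
by rewrite subr0 mulr_le0_ge0 // df0.
Qed.

(** Gives the sign of the derivative of [cosh x * exp (- x^2 / 2)] in the next lemma; the left side
    minus the right side has derivative [- 2 x sinh x]. *)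
Lemma sinh_le_mul_cosh x : 0 <= x ->
  expR x - expR (- x) <= x * (expR x + expR (- x)).
Proof.
move=> x0.
pose f y : R := (expR y - expR (- y)) - y * (expR y + expR (- y)).
pose df y : R := - (y * (expR y - expR (- y))).
have fdf y : is_derive y 1 f (df y).
  by apply: is_derive_eq; rewrite /df /GRing.scale /=; ring.
have := le_at0_of_derive_le0 fdf _ x0; rewrite /f !mul0r oppr0 !subrr => fle.
rewrite -subr_le0 (le_trans (fle _)) ?addr0 // => y y0.
by rewrite oppr_le0 mulr_ge0 // subr_ge0 ler_expR ge0_cp.
Qed.

(** By evenness it suffices to treat [0 <= x], where [cosh x * exp (- x^2 / 2)] decreases from 1. *)
Lemma cosh_le_expR_sqr x : (expR x + expR (- x)) / 2 <= expR (x ^+ 2 / 2).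
Proof.
wlog x0 : x / 0 <= x.
  move=> ge0; have [|x0] := leP 0 x; first exact: ge0.
  by have := ge0 (- x); rewrite sqrrN opprK addrC oppr_ge0 ltW // => ->.
pose f y : R := (expR y + expR (- y)) * expR (- (y ^+ 2 / 2)).
pose df y : R := ((expR y - expR (- y)) - y * (expR y + expR (- y)))
                 * expR (- (y ^+ 2 / 2)).
have fdf y : is_derive y 1 f (df y).
  by apply: is_derive_eq; rewrite /df /GRing.scale /=; field.
have := le_at0_of_derive_le0 fdf _ x0.
rewrite /f oppr0 expr0n /= mul0r oppr0 !expR0 mulr1 => fle.
have {fle} : (expR x + expR (- x)) * expR (- (x ^+ 2 / 2)) <= 1 + 1.
  apply: fle => y y0; rewrite mulr_le0_ge0 ?expR_ge0 // subr_le0.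
  exact: sinh_le_mul_cosh.
move=> h; rewrite ler_pdivrMr // mulrC -ler_pdivrMr ?expR_gt0 // -expRN.
by apply: le_trans h _; lra.
Qed.

(** The tangent of [expR] at the weighted mean lies below the graph; it is averaged over the two
    points. *)
Lemma expR_convex_comb x y p : 0 <= p <= 1 ->
  expR ((1 - p) * x + p * y) <= (1 - p) * expR x + p * expR y.
Proof.
move=> /andP[p0 p1]; set m := (1 - p) * x + p * y.
have tangent z : expR m * (1 + (z - m)) <= expR z.
  by rewrite -{2}(subrKC m z) (expRD m) ler_wpM2l ?expR_ge0 // expR_ge1Dx.
have q0 : 0 <= 1 - p by lra.
have := lerD (ler_wpM2l q0 (tangent x)) (ler_wpM2l p0 (tangent y)).
rewrite (_ : _ + _ = expR m) // /m; ring.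
Qed.

(** Symmetrization: the left side [A] is the exponential moment of a centered two-point variable and
    [B >= 1] that of its opposite, so [A <= A * B]. This product is the moment of the difference of
    two independent copies and is at most [cosh (l / 2) ^ 2]. The price is 1/4 in place of
    Hoeffding's 1/8, which [tilt_two_point] can afford. *)
Lemma two_point_mgf_le l p : 0 <= p <= 1 ->
  (1 - p) * expR (- (l * p)) + p * expR (l * (1 - p)) <= expR (l ^+ 2 / 4).
Proof.
move=> p01; have /andP[p0 p1] := p01; set A := (X in X <= _).
pose B := (1 - p) * expR (l * p) + p * expR (- (l * (1 - p))).
have B1 : 1 <= B.
  have := expR_convex_comb (l * p) (- (l * (1 - p))) p01.
  by rewrite (_ : _ + _ = 0) ?expR0 //; ring.
have A0 : 0 <= A by rewrite addr_ge0 // mulr_ge0 ?expR_ge0 // subr_ge0.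
have AB : A * B = 1 + p * (1 - p) * (expR l + expR (- l) - 2).
  have E1 : expR l = expR (l * p) * expR (l * (1 - p)).
    by rewrite -expRD; congr expR; ring.
  have E2 : expR (- l) = (expR (l * p) * expR (l * (1 - p)))^-1.
    by rewrite expRN E1.
  rewrite E2 E1 /A /B !expRN; field.
  by rewrite !expR_eq0.
have h2 : expR l + expR (- l) = (expR (l / 2) + expR (- (l / 2))) ^+ 2 - 2.
  have -> : expR l = expR (l / 2) ^+ 2.
    by rewrite -expRM_natl; congr expR; field.
  rewrite !expRN; have -> : expR l = expR (l / 2) ^+ 2.
    by rewrite -expRM_natl; congr expR; field.
  by field; rewrite expR_eq0.
have ch := cosh_le_expR_sqr (l / 2).
have ch0 : 0 <= (expR (l / 2) + expR (- (l / 2))) / 2.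
  by rewrite divr_ge0 // addr_ge0 // expR_ge0.
have sq : ((expR (l / 2) + expR (- (l / 2))) / 2) ^+ 2 <= expR (l ^+ 2 / 4).
  have -> : expR (l ^+ 2 / 4) = expR ((l / 2) ^+ 2 / 2) ^+ 2.
    by rewrite -expRM_natl; congr expR; field.
  by rewrite lerXn2r ?nnegrE ?expR_ge0.
apply: le_trans (_ : A * B <= _); first by rewrite ler_peMr.
have hh : 2 <= expR l + expR (- l).
  have := expR_ge1Dx l; have := expR_ge1Dx (- l); lra.
have pq : p * (1 - p) <= 1 / 4 by have := sqr_ge0 (p - 1 / 2); nra.
have : A * B <= 1 + 1 / 4 * (expR l + expR (- l) - 2).
  by rewrite AB lerD2l ler_wpM2r // subr_ge0.
move: sq; rewrite h2; nra.
Qed.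

(** Follows from [cosh x - 1 = 2 sinh (x / 2) ^ 2] and [y <= sinh y] for [0 <= y]. *)
Lemma cosh_ge_1Dsqr x : 1 + x ^+ 2 / 2 <= (expR x + expR (- x)) / 2.
Proof.
have sinh_ge y : 0 <= y -> 2 * y <= expR y - expR (- y).
  move=> y0; pose f z : R := 2 * z - (expR z - expR (- z)).
  pose df z : R := 2 - (expR z + expR (- z)).
  have fdf (z : R) : is_derive z 1 f (df z).
    by apply: is_derive_eq; rewrite /df /GRing.scale /=; ring.
  have := le_at0_of_derive_le0 fdf _ y0.
  rewrite /f mulr0 oppr0 !subrr => fle.
  rewrite -subr_le0 fle // => z z0.
  by rewrite /df; have := expR_ge1Dx z; have := expR_ge1Dx (- z); lra.
wlog x0 : x / 0 <= x.
  move=> ge0; have [|x0] := leP 0 x; first exact: ge0.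
  by have := ge0 (- x); rewrite sqrrN opprK [_ + expR x]addrC oppr_ge0 ltW // => ->.
have h0 : 0 <= x / 2 by rewrite divr_ge0.
have := sinh_ge _ h0.
have -> : expR x = expR (x / 2) ^+ 2 by rewrite -expRM_natl; congr expR; field.
have -> : expR (- x) = expR (- (x / 2)) ^+ 2.
  by rewrite -expRM_natl; congr expR; field.
have : expR (x / 2) * expR (- (x / 2)) = 1 by rewrite expRxMexpNx_1.
move: (expR (x / 2)) (expR (- (x / 2))) => A B AB xle.
have : x ^+ 2 <= (A - B) ^+ 2 by rewrite lerXn2r ?nnegrE //; lra.
by nra.
Qed.

Lemma expR_le_1D2x y : 0 <= y <= 1 / 2 -> expR y <= 1 + 2 * y.
Proof.
move=> /andP[y0 y1]; have := expR_ge1Dx (- y); rewrite expRN => h.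
have e0 := expR_gt0 y.
have : (1 - y) * expR y <= 1 by rewrite -ler_pdivlMr // mul1r.
by nra.
Qed.

(** Trades a quadratic exponent for two linear ones, the form that [two_point_mgf_le] handles. The
    bound [exp z <= 1 + 2 z] on [0, 1/2] doubles [c], which leads to the frequency [2 sqrt c]. *)
Lemma expR_sqr_le_cosh c y : 0 <= c <= 1 / 2 -> y ^+ 2 <= 1 ->
  expR (c * y ^+ 2) <= (expR (2 * Num.sqrt c * y) + expR (- (2 * Num.sqrt c * y))) / 2.
Proof.
move=> /andP[c0 c1] y1; apply: le_trans (cosh_ge_1Dsqr _).
have y0 := sqr_ge0 y.
apply: le_trans (expR_le_1D2x _) _; first by apply/andP; split; nra.
by rewrite !exprMn sqr_sqrtr // lerD2l; nra.
Qed.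

(** After squaring, this is [w / (1 + w) <= ln (1 + w)] in exponential form. *)
Lemma expR_half_frac_le_sqrt w : 0 <= w ->
  expR (w / (2 * (1 + w))) <= Num.sqrt (1 + w).
Proof.
move=> w0; rewrite -[leLHS]ger0_norm ?expR_ge0 // -sqrtr_sqr ler_wsqrtr //.
have w1 : 0 < 1 + w by lra.
rewrite -expRM_natl (_ : _ * _ = w / (1 + w)); last by field; lra.
have := expR_ge1Dx (- (w / (1 + w))).
rewrite (_ : 1 + _ = (1 + w)^-1); last by field; lra.
by rewrite expRN lef_pV2 // posrE expR_gt0.
Qed.

(* The exponential factor gained by [mixture M z] when [v *m v^T] is added to
   [M] and [y *: v] to [z], for [u = v^T M^-1 z] and [w = v^T M^-1 v]. *)
Definition tilt u w y : R := expR ((2 * y * u + y ^+ 2 * w - u ^+ 2) / (2 * (1 + w))).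

(** The Hoeffding step for the extreme centered law on [-p, 1-p]. The quadratic part of the exponent
    is traded for the two frequencies [a + s] and [a - s], and the two-point moment bound applies to
    each. *)
Lemma tilt_two_point u w p : 0 <= w -> 0 <= p <= 1 ->
  (1 - p) * tilt u w (- p) + p * tilt u w (1 - p) <= Num.sqrt (1 + w).
Proof.
move=> w0 p01; have /andP[p0 p1] := p01.
have w1 : 0 < 1 + w by lra.
pose a := u / (1 + w); pose c := w / (2 * (1 + w)).
pose b := u ^+ 2 / (2 * (1 + w)); pose s := 2 * Num.sqrt c.
have c0 : 0 <= c by rewrite divr_ge0 //; lra.
have c1 : c <= 1 / 2 by rewrite ler_pdivrMr; nra.
have s2 : s ^+ 2 = 4 * c by rewrite exprMn sqr_sqrtr // ; ring.
have tiltE y : tilt u w y = expR (- b) * expR (a * y) * expR (c * y ^+ 2).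
  by rewrite -!expRD; congr expR; rewrite /a /b /c; field; lra.
have tilt_le y : y ^+ 2 <= 1 ->
    tilt u w y <= expR (- b) * ((expR ((a + s) * y) + expR ((a - s) * y)) / 2).
  move=> y1; rewrite tiltE -mulrA ler_wpM2l ?expR_ge0 //.
  have c01 : 0 <= c <= 1 / 2 by apply/andP.
  rewrite (mulrDl a s y) (mulrBl y a s) !(expRD (a * y)) -mulrDr -mulrA.
  rewrite ler_wpM2l ?expR_ge0 //.
  exact: (expR_sqr_le_cosh c01 y1).
have q0 : 0 <= 1 - p by lra.
have r1 : (- p) ^+ 2 <= 1 by nra.
have r2 : (1 - p) ^+ 2 <= 1 by nra.
have t1 := tilt_le _ r1; have t2 := tilt_le _ r2.
apply: le_trans (lerD (ler_wpM2l q0 t1) (ler_wpM2l p0 t2)) _.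
rewrite !mulrN.
have m1 := two_point_mgf_le (a + s) p01.
have m2 := two_point_mgf_le (a - s) p01.
have e0 := expR_ge0 (- b).
have -> : forall x1 x2 x3 x4 e, (1 - p) * (e * ((x1 + x2) / 2)) +
    p * (e * ((x3 + x4) / 2)) =
    e * ((((1 - p) * x1 + p * x3) + ((1 - p) * x2 + p * x4)) / 2).
  by move=> *; field.
apply: le_trans (_ : expR (- b) * ((expR ((a + s) ^+ 2 / 4)
    + expR ((a - s) ^+ 2 / 4)) / 2) <= _).
  by rewrite ler_wpM2l // ler_wpM2r // lerD.
have -> : expR ((a + s) ^+ 2 / 4) = expR ((a ^+ 2 + s ^+ 2) / 4) * expR (a * s / 2).
  by rewrite -expRD; congr expR; field.
have -> : expR ((a - s) ^+ 2 / 4) = expR ((a ^+ 2 + s ^+ 2) / 4) * expR (- (a * s / 2)).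
  by rewrite -expRD; congr expR; field.
have ch := cosh_le_expR_sqr (a * s / 2).
rewrite -mulrDr -mulrA mulrA -expRD.
apply: le_trans (ler_wpM2l (expR_ge0 _) ch) _.
(* The exponents balance: [s^2 / 4] equals [w / (2 (1 + w))] and is absorbed by [sqrt (1 + w)]; as
   [s^2 <= 2], the terms [a^2 / 4 + a^2 s^2 / 8] total at most [a^2 / 2 <= b]. *)
rewrite -expRD; apply: le_trans (expR_half_frac_le_sqrt w0).
rewrite ler_expR.
have a2 : a ^+ 2 <= 2 * b.
  rewrite /a /b exprMn (_ : 2 * _ = u ^+ 2 / (1 + w)); last by field; lra.
  by rewrite ler_wpM2l ?sqr_ge0 // exprVn lef_pV2 ?posrE ?exprn_gt0 //; nra.
have -> : w / (2 * (1 + w)) = s ^+ 2 / 4 by rewrite s2 /c; field; lra.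
have a0 := sqr_ge0 a.
have -> : (a * s / 2) ^+ 2 / 2 = a ^+ 2 * s ^+ 2 / 8 by field.
by rewrite s2; nra.
Qed.

Definition tilt_slope u w p : R := tilt u w (1 - p) - tilt u w (- p).

(* [tilt u w] is convex, so on [- p, 1 - p] it lies below its chord; the value
   of the chord at 0 is the mean of a two-point law with mean 0. *)
Lemma tilt_le_chord u w p y : 0 <= w -> 0 <= p <= 1 -> 0 <= p + y <= 1 ->
  tilt u w y <= Num.sqrt (1 + w) + tilt_slope u w p * y.
Proof.
move=> w0 p01 t01; have w1 : 0 < 1 + w by lra.
have /andP[t0 t1] := t01.
have : tilt u w y <= (1 - (p + y)) * tilt u w (- p) + (p + y) * tilt u w (1 - p).
  apply: le_trans (expR_convex_comb _ _ t01); rewrite ler_expR.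
  have i0 : 0 <= (2 * (1 + w))^-1 by rewrite invr_ge0; lra.
  rewrite !mulrA -mulrDl ler_wpM2r //.
  have : 0 <= (p + y) * (1 - (p + y)) * w by rewrite !mulr_ge0 // subr_ge0.
  nra.
have := tilt_two_point u w0 p01; rewrite /tilt_slope.
by move: (tilt u w y) (tilt u w (- p)) (tilt u w (1 - p)) => T A B; nra.
Qed.

(** Makes the slope a bounded function of the parents wherever [u] is bounded, so that its product
    with the residual has mean 0. *)
Lemma tilt_slope_bound u w p : 0 <= w -> 0 <= p <= 1 ->
  `|tilt_slope u w p| <= 2 * expR (`|u| + 1).
Proof.
move=> w0 /andP[p0 p1]; have w1 : 0 < 1 + w by lra.
have tb y : y ^+ 2 <= 1 -> tilt u w y <= expR (`|u| + 1).
  move=> y1; rewrite ler_expR ler_pdivrMr; last by lra.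
  have : y * u <= `|u|.
    apply: le_trans (ler_norm _) _; rewrite normrM ler_piMl //.
    by rewrite -sqrtr_sqr -sqrtr1 ler_wsqrtr.
  have := normr_ge0 u; have := sqr_ge0 u; nra.
have h1 : tilt u w (1 - p) <= expR (`|u| + 1) by apply: tb; nra.
have h2 : tilt u w (- p) <= expR (`|u| + 1) by apply: tb; nra.
have p1' : 0 <= tilt u w (1 - p) by exact: expR_ge0.
have p2' : 0 <= tilt u w (- p) by exact: expR_ge0.
by rewrite ler_norml /tilt_slope; apply/andP; split; lra.
Qed.

End exponential_inequalities.

(** * Quadratic forms, determinants and the Gaussian mixture *)

Section quadratic_forms.
Variable R : realType.

Lemma dotE k (a b : 'cV[R]_k) : dot a b = \sum_i a i 0 * b i 0.
Proof. by rewrite /dot mxE; apply: eq_bigr => i _; rewrite mxE. Qed.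

Lemma dotC k (a b : 'cV[R]_k) : dot a b = dot b a.
Proof. by rewrite !dotE; apply: eq_bigr => i _; rewrite mulrC. Qed.

Lemma dotDr k (a b c : 'cV[R]_k) : dot a (b + c) = dot a b + dot a c.
Proof. by rewrite /dot mulmxDr mxE. Qed.

Lemma dotDl k (a b c : 'cV[R]_k) : dot (a + b) c = dot a c + dot b c.
Proof. by rewrite dotC dotDr !(dotC c). Qed.

Lemma dotZr k (l : R) (a b : 'cV[R]_k) : dot a (l *: b) = l * dot a b.
Proof. by rewrite /dot -scalemxAr mxE. Qed.

Lemma dotZl k (l : R) (a b : 'cV[R]_k) : dot (l *: a) b = l * dot a b.
Proof. by rewrite dotC dotZr dotC. Qed.

Lemma dotNr k (a b : 'cV[R]_k) : dot a (- b) = - dot a b.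
Proof. by rewrite -scaleN1r dotZr mulN1r. Qed.

Lemma dotNl k (a b : 'cV[R]_k) : dot (- a) b = - dot a b.
Proof. by rewrite dotC dotNr dotC. Qed.

Lemma dotBr k (a b c : 'cV[R]_k) : dot a (b - c) = dot a b - dot a c.
Proof. by rewrite dotDr dotNr. Qed.

Lemma dotBl k (a b c : 'cV[R]_k) : dot (a - b) c = dot a c - dot b c.
Proof. by rewrite dotDl dotNl. Qed.

Lemma dot0r k (a : 'cV[R]_k) : dot a 0 = 0.
Proof. by rewrite /dot mulmx0 mxE. Qed.

Lemma dot0l k (a : 'cV[R]_k) : dot 0 a = 0.
Proof. by rewrite dotC dot0r. Qed.

Lemma dot_ge0 k (a : 'cV[R]_k) : 0 <= dot a a.
Proof. by rewrite dotE sumr_ge0 // => i _; rewrite -expr2 sqr_ge0. Qed.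

Lemma dot_gt0 k (a : 'cV[R]_k) : a != 0 -> 0 < dot a a.
Proof.
move=> a0; rewrite lt_neqAle dot_ge0 andbT eq_sym; apply: contra a0 => /eqP.
rewrite dotE => /psumr_eq0P E; apply/eqP/colP => i; rewrite mxE.
have := E (fun i _ => _) i isT; rewrite -expr2 => H.
by apply/eqP; rewrite -sqrf_eq0; apply/eqP/H => j; rewrite -expr2 sqr_ge0.
Qed.

Lemma dot_mulmx k l (a : 'cV[R]_k) (M : 'M[R]_(k, l)) b :
  dot a (M *m b) = dot (M^T *m a) b.
Proof. by rewrite /dot trmx_mul trmxK mulmxA. Qed.

Lemma outer_mulmx k (v a : 'cV[R]_k) : v *m v^T *m a = dot v a *: v.
Proof.
rewrite -mulmxA; apply/colP => i; rewrite mxE big_ord1 mxE mulrC.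
by rewrite [RHS]mxE /dot mxE.
Qed.

Lemma dot_col_mx k l (a : 'cV[R]_k) (b : 'cV[R]_l) c d :
  dot (col_mx a b) (col_mx c d) = dot a c + dot b d.
Proof. by rewrite /dot tr_col_mx mul_row_col mxE. Qed.

Definition posdef k (M : 'M[R]_k) : Prop :=
  M^T = M /\ forall v, v != 0 -> 0 < dot v (M *m v).

Lemma posdef_ge0 k (M : 'M[R]_k) v : posdef M -> 0 <= dot v (M *m v).
Proof.
move=> [_ pM]; have [->|/pM /ltW //] := eqVneq v 0.
by rewrite mulmx0 dot0r.
Qed.

Lemma posdef_dotC k (M : 'M[R]_k) a b : posdef M ->
  dot a (M *m b) = dot b (M *m a).
Proof. by move=> [sM _]; rewrite dot_mulmx sM dotC. Qed.

Lemma posdef1 k : posdef (1%:M : 'M[R]_k).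
Proof. by split=> [|v v0]; rewrite ?trmx1 // mul1mx dot_gt0. Qed.

Lemma dot_add_outer k (M : 'M[R]_k) (v x : 'cV[R]_k) :
  dot x ((M + v *m v^T) *m x) = dot x (M *m x) + dot v x ^+ 2.
Proof. by rewrite mulmxDl outer_mulmx dotDr dotZr expr2 (dotC x v). Qed.

Lemma posdef_add_outer k (M : 'M[R]_k) (v : 'cV[R]_k) :
  posdef M -> posdef (M + v *m v^T).
Proof.
move=> [sM pM]; split=> [|x x0]; first by rewrite linearD /= trmx_mul trmxK sM.
by rewrite dot_add_outer ltr_pwDl ?pM ?sqr_ge0.
Qed.

(** The upper bound is Hadamard's inequality. Induction on the Schur complement [s] of the lower
    right block: [det M = s * det B] with [0 < s <= a]. *)
Lemma posdef_det k (M : 'M[R]_k) : posdef M ->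
  0 < \det M <= \prod_i M i i.
Proof.
elim: k M => [|k IHk] M [sM pM]; first by rewrite det_mx00 big_ord0 ltr01 lexx.
rewrite -[k.+1]/(1 + k)%N in M sM pM *.
pose a := ulsubmx M; pose r := ursubmx M; pose c := dlsubmx M.
pose B := drsubmx M.
have ME : M = block_mx a r c B by rewrite submxK.
have cE : c = r^T by rewrite /c /r trmx_ursub sM.
have pB : posdef B.
  split=> [|v v0]; first by rewrite /B trmx_drsub sM.
  have := pM (col_mx 0 v); rewrite ME mul_block_col !mulmx0 !add0r dot_col_mx.
  rewrite dot0l add0r; apply; rewrite -(@col_mx0 R 1 k 1).
  by apply: contra v0 => /eqP/eq_col_mx[_ ->].
have /andP[dB dBle] := IHk B pB.
have uB : B \in unitmx by rewrite unitmxE unitfE gt_eqF.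
pose y := invmx B *m c.
have By : B *m y = c by rewrite mulKVmx.
pose s : 'M[R]_1 := a - r *m y.
have detE : \det M = s 0 0 * \det B.
  have : M *m block_mx 1%:M 0 (- y) 1%:M = block_mx s r 0 B.
    rewrite ME mulmx_block !mulmx1 !mulmx0 !add0r !mulmxN By subrr.
    by [].
  move/(congr1 determinant); rewrite det_mulmx det_lblock !det1 !mulr1 => ->.
  by rewrite det_ublock det_mx11.
(* [s] is the value of the quadratic form of [M] at the vector [(1, - y)]. *)
have s0 : 0 < s 0 0.
  have z0 : col_mx 1%:M (- y) != 0.
    rewrite -(@col_mx0 R 1 k 1); apply/eqP => /eq_col_mx[/matrixP/(_ 0 0)].
    by rewrite !mxE /= => /eqP; rewrite oner_eq0.
  have := pM _ z0; rewrite {1}ME mul_block_col !mulmx1 !mulmxN By subrr.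
  by rewrite dot_col_mx dot0r addr0 /dot trmx1 mul1mx.
have sle : s 0 0 <= a 0 0.
  have -> : s 0 0 = a 0 0 - dot y (B *m y).
    by rewrite /s mxE [X in _ + X]mxE By dotC cE /dot trmxK.
  by rewrite lerBlDr lerDl posdef_ge0.
rewrite detE mulr_gt0 //= big_split_ord big_ord1 /=.
have -> : M (lshift k 0) (lshift k 0) = a 0 0 by rewrite ME block_mxEul.
have -> : \prod_(i < k) M (rshift 1 i) (rshift 1 i) = \prod_i B i i.
  by apply: eq_bigr => i _; rewrite ME block_mxEdr.
by rewrite ler_pM // ltW.
Qed.

Lemma posdef_unitmx k (M : 'M[R]_k) : posdef M -> M \in unitmx.
Proof. by move=> /posdef_det/andP[d0 _]; rewrite unitmxE unitfE gt_eqF. Qed.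

Lemma posdef_invmx k (M : 'M[R]_k) : posdef M -> posdef (invmx M).
Proof.
move=> pM; have uM := posdef_unitmx pM; have [sM pM'] := pM.
split=> [|v v0]; first by rewrite trmx_inv sM.
rewrite dotC -{2}[v](mulKVmx uM); apply: pM'.
by apply: contra v0 => /eqP E; rewrite -[v](mulKVmx uM) E mulmx0.
Qed.

(** Matrix determinant lemma: two column eliminations of the bordered matrix [N] compute its
    determinant in two ways. *)
Lemma det_add_outer k (M : 'M[R]_k) (v : 'cV[R]_k) : M \in unitmx ->
  \det (M + v *m v^T) = \det M * (1 + dot v (invmx M *m v)).
Proof.
move=> uM; pose N := block_mx (1%:M : 'M[R]_1) (- v^T) v M.
have : N *m block_mx 1%:M v^T 0 1%:M = block_mx 1%:M 0 v (M + v *m v^T).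
  rewrite mulmx_block !mulmx1 !mulmx0 !addr0 mul1mx addrN.
  by rewrite addrC.
move/(congr1 determinant); rewrite det_mulmx det_ublock det_lblock !det1 !mul1r mulr1 => <-.
have : N *m block_mx 1%:M 0 (- (invmx M *m v)) 1%:M
    = block_mx (1%:M + v^T *m (invmx M *m v)) (- v^T) 0 M.
  rewrite mulmx_block !mulmx1 !mulmx0 !add0r !mulmxN mulKVmx // subrr.
  by rewrite mulNmx opprK.
move/(congr1 determinant); rewrite det_mulmx det_lblock det_ublock !det1 !mulr1 => ->.
by rewrite det_mx11 mxE mxE mulrC.
Qed.

(* The integral of [exp (l^T s - l^T (M - 1) l / 2)] against the standard
   Gaussian law of [l]. *)
Definition mixture k (M : 'M[R]_k) (s : 'cV[R]_k) : R :=
  expR (dot s (invmx M *m s) / 2) / Num.sqrt (\det M).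

Lemma mixture_ge0 k (M : 'M[R]_k) s : 0 <= mixture M s.
Proof. by rewrite divr_ge0 ?expR_ge0 ?sqrtr_ge0. Qed.

(** Reduces the supermartingale property to a scalar inequality: one observation multiplies the
    mixture by a factor that depends on [u], [w] and [y] alone. *)
Lemma mixture_update k (M : 'M[R]_k) (s v : 'cV[R]_k) (y : R) : posdef M ->
  let u := dot v (invmx M *m s) in let w := dot v (invmx M *m v) in
  mixture (M + v *m v^T) (s + y *: v) =
    mixture M s * (tilt u w y / Num.sqrt (1 + w)).
Proof.
move=> pM u w; have uM := posdef_unitmx pM; have pV := posdef_invmx pM.
have w0 : 0 <= w := posdef_ge0 v pV.
have w1 : 1 + w != 0 by rewrite gt_eqF // ltr_pwDl.
have uN := posdef_unitmx (posdef_add_outer v pM).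
(* The Sherman-Morrison formula, checked by multiplying back. *)
have invE : invmx (M + v *m v^T) *m (s + y *: v) =
    invmx M *m s + ((y - u) / (1 + w)) *: (invmx M *m v).
  apply: (canLR (mulKmx uN)).
  rewrite mulmxDr !mulmxDl -!scalemxAr !mulKVmx // !outer_mulmx -/u -/w.
  apply/colP => i; rewrite !mxE; field; exact: w1.
rewrite /mixture invE det_add_outer // -/w.
rewrite sqrtrM; last by rewrite ltW //; have /andP[] := posdef_det pM.
rewrite dotDr dotZr !dotDl !dotZl -/u -/w (posdef_dotC s v pV) -/u.
rewrite invfM mulrACA; congr (_ * _); rewrite -expRD; congr expR.
by field; exact: w1.
Qed.

Lemma posdef_cauchy_schwarz k (M : 'M[R]_k) a b : posdef M ->
  dot a (M *m b) ^+ 2 <= dot a (M *m a) * dot b (M *m b).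
Proof.
move=> pM; have a0 := posdef_ge0 a pM; have b0 := posdef_ge0 b pM.
have [b00|b00] := eqVneq b 0; first by rewrite b00 mulmx0 !dot0r expr0n mulr0.
have {}b0 : 0 < dot b (M *m b) by case: pM => _; apply.
set l := dot a (M *m b) / dot b (M *m b).
have := posdef_ge0 (a - l *: b) pM.
rewrite mulmxBr -scalemxAr !dotBl !dotBr !dotZl !dotZr (posdef_dotC b a pM).
rewrite /l; move: (dot a _) (dot a _) (dot b _) b0 => B A C C0.
have -> : A - B / C * B - (B / C * B - B / C * (B / C * C)) = (A * C - B ^+ 2) / C.
  by field; rewrite gt_eqF.
by rewrite pmulr_lge0 ?invr_gt0 // subr_ge0.
Qed.

Lemma mnorm_cauchy_schwarz k (M : 'M[R]_k) a v : posdef M ->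
  `|dot a v| <= mnorm M a * Num.sqrt (dot v (invmx M *m v)).
Proof.
move=> pM; have uM := posdef_unitmx pM.
have := posdef_cauchy_schwarz a (invmx M *m v) pM; rewrite mulKVmx // => h.
rewrite -sqrtr_sqr /mnorm -sqrtrM ?posdef_ge0 // (dotC v) ler_wsqrtr //.
Qed.

Lemma mnorm_leB k (M : 'M[R]_k) a b : posdef M ->
  mnorm M (a - b) <= mnorm M a + mnorm M b.
Proof.
move=> pM; have a0 := posdef_ge0 a pM; have b0 := posdef_ge0 b pM.
rewrite -[leRHS]ger0_norm ?addr_ge0 ?sqrtr_ge0 // -sqrtr_sqr ler_wsqrtr //.
rewrite mulmxBr !dotBl !dotBr (posdef_dotC b a pM) sqrrD !sqr_sqrtr //.
have : - dot a (M *m b) <= mnorm M a * mnorm M b.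
  apply: le_trans (ler_norm _) _; rewrite normrN -sqrtr_sqr /mnorm -sqrtrM //.
  by rewrite ler_wsqrtr // posdef_cauchy_schwarz.
rewrite /mnorm; lra.
Qed.

(** Controls the bias of ridge regression. With [x = M^-1 a], the hypothesis gives [|x|^2 <= x.a],
    and Cauchy-Schwarz then yields [(x.a)^2 <= |x|^2 |a|^2 <= (x.a) |a|^2]. *)
Lemma mnorm_invmx_le k (M : 'M[R]_k) a : posdef M ->
  (forall x, dot x x <= dot x (M *m x)) ->
  mnorm M (invmx M *m a) <= Num.sqrt (dot a a).
Proof.
move=> pM leM; have uM := posdef_unitmx pM.
rewrite /mnorm ler_wsqrtr // mulKVmx //; set x := invmx M *m a.
have xE : dot x (M *m x) = dot x a by rewrite mulKVmx.
have := posdef_cauchy_schwarz x a (posdef1 k); rewrite !mul1mx.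
have := leM x; rewrite xE.
have := dot_ge0 x; have := dot_ge0 a.
move: (dot x x) (dot a a) (dot x a) => X A B A0 X0 XB BXA.
by have [//|AB] := leP B A; nra.
Qed.

(** * Regularized design matrices, with the rounds marked by [c] skipped *)

Section design_matrices.
Variables (k : nat) (M : nat -> 'M[R]_k) (v : nat -> 'cV[R]_k) (c : nat -> bool).
Hypothesis M0 : M 0 = 1%:M.
Hypothesis MS : forall t, M t.+1 = if c t then M t else M t + v t *m (v t)^T.

Lemma design_posdef t : posdef (M t).
Proof.
elim: t => [|t IHt]; first by rewrite M0; exact: posdef1.
by rewrite MS; case: ifP => // _; exact: posdef_add_outer.
Qed.

Lemma design_ge1 t x : dot x x <= dot x (M t *m x).
Proof.
elim: t => [|t IHt]; first by rewrite M0 mul1mx.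
by rewrite MS; case: ifP => // _; rewrite dot_add_outer ler_wpDr ?sqr_ge0.
Qed.

Lemma design_det_ge1 t : 1 <= \det (M t).
Proof.
elim: t => [|t IHt]; first by rewrite M0 det1.
rewrite MS; case: ifP => // _.
have pM := design_posdef t; rewrite det_add_outer ?posdef_unitmx //.
rewrite mulr_ege1 // lerDl; exact/posdef_ge0/posdef_invmx.
Qed.

Lemma design_inv_le t x : dot x (invmx (M t) *m x) <= dot x x.
Proof.
have := mnorm_invmx_le x (design_posdef t) (@design_ge1 t).
rewrite /mnorm mulKVmx ?posdef_unitmx ?ler_sqrt ?dot_ge0 //; last exact: design_posdef.
by rewrite dotC.
Qed.

(** Hadamard's inequality leaves only the diagonal entries, to which each recorded vector adds at
    most 1. *)
Lemma design_det_le T : (forall t i, (t < T)%N -> ~~ c t -> 0 <= v t i 0 <= 1) ->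
  \det (M T) <= (1 + T%:R) ^+ k.
Proof.
move=> v01; have /andP[_ /le_trans] := posdef_det (design_posdef T); apply.
have diag i : 0 <= M T i i <= 1 + T%:R.
  elim: T v01 => [|T IHT] v01; first by rewrite M0 mxE eqxx ler01 addr0 lexx.
  have /andP[m0 m1] : 0 <= M T i i <= 1 + T%:R.
    by apply: IHT => t j tT; apply: v01; rewrite ltnS ltnW.
  have T1 : T.+1%:R = T%:R + 1 :> R by rewrite -natr1.
  rewrite MS; case: ifPn => cT; first by rewrite m0 T1 /=; lra.
  have /andP[v0 v1] := v01 _ i (ltnSn T) cT.
  rewrite !mxE big_ord1 !mxE T1; apply/andP; split; nra.
apply: le_trans (_ : \prod_(i < k) (1 + T%:R) <= _).
  by apply: ler_prod => i _; exact: diag.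
by rewrite prodr_const card_ord.
Qed.

(** Each summand [w] is at most [k], since the design dominates the identity and the vectors lie in
    the unit cube. Hence [w <= (1 + k) * w / (1 + w) <= (1 + k) * ln (1 + w)], and by the
    determinant lemma these logarithms telescope to [ln (det (M T))]. *)
Lemma elliptical_potential T :
  (forall t i, (t < T)%N -> ~~ c t -> 0 <= v t i 0 <= 1) ->
  \sum_(t < T | ~~ c t) dot (v t) (invmx (M t) *m v t) <=
    (1 + k%:R) * (k%:R * ln (1 + T%:R)).
Proof.
move=> v01.
apply: le_trans (_ : (1 + k%:R) * ln (\det (M T)) <= _); last first.
  rewrite ler_wpM2l ?addr_ge0 //.
  have T1 : 0 < 1 + T%:R :> R by rewrite ltr_pwDl.
  have d0 : 0 < \det (M T) by rewrite (lt_le_trans ltr01) // design_det_ge1.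
  rewrite mulr_natl -lnXn // ler_ln ?posrE ?exprn_gt0 //.
  exact: design_det_le.
elim: T v01 => [|T IHT] v01.
  by rewrite big_ord0 M0 det1 ln1 mulr0.
rewrite big_mkcond big_ord_recr /= -big_mkcond /=.
have {}IHT : \sum_(t < T | ~~ c t) dot (v t) (invmx (M t) *m v t) <=
    (1 + k%:R) * ln (\det (M T)).
  by apply: IHT => t j tT; apply: v01; rewrite ltnS ltnW.
rewrite MS; case: (boolP (c T)) => cT /=; first by rewrite addr0.
have pM := design_posdef T; set w := dot _ _.
have w0 : 0 <= w by exact/posdef_ge0/posdef_invmx.
have w1 : 0 < 1 + w by rewrite ltr_pwDl.
have wk : w <= k%:R.
  apply: le_trans (design_inv_le _ _) _; rewrite dotE.
  apply: le_trans (_ : \sum_(i < k) 1 <= _); last by rewrite sumr_const card_ord.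
  apply: ler_sum => i _; have /andP[? ?] := v01 _ i (ltnSn T) cT.
  by nra.
rewrite det_add_outer ?posdef_unitmx // -/w lnM ?posrE //; last first.
  by rewrite (lt_le_trans ltr01) // design_det_ge1.
rewrite mulrDr lerD //.
have lnw : w / (1 + w) <= ln (1 + w).
  have := @le_ln1Dx R (- (w / (1 + w))).
  rewrite (_ : 1 - w / (1 + w) = (1 + w)^-1); last by field; rewrite gt_eqF.
  rewrite lnV ?posrE // lerN2; apply.
  by rewrite ltrN2 ltr_pdivrMr // mul1r ltrDr.
apply: le_trans (_ : (1 + k%:R) * (w / (1 + w)) <= _); last first.
  by rewrite ler_wpM2l // addr_ge0.
rewrite mulrA ler_pdivlMr // mulrC ler_wpM2r // lerD2l //.
Qed.

End design_matrices.
End quadratic_forms.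

(** * Independence of blocks, and Fubini in place of conditioning *)

Section independence.
Local Open Scope ereal_scope.
Context d d' (T : measurableType d) (T' : measurableType d') (R : realType)
  (P : probability T R).

Definition block_events (I : eqType) (X : I -> T -> T') (J : pred I) :
    set (set T) :=
  [set A | exists i B, [/\ J i, measurable B & A = X i @^-1` B]].

Lemma block_events_measurable (I : eqType) (X : I -> T -> T') (J : pred I) :
  (forall i, measurable_fun setT (X i)) -> block_events X J `<=` measurable.
Proof.
by move=> mX _ [i [B [_ mB ->]]]; rewrite -[_ @^-1` _]setTI; exact: mX.
Qed.

Lemma measurable_block (I : eqType) (X : I -> T -> T') (J : pred I) i : J i ->
  measurable_fun [set: g_sigma_algebraType (block_events X J)] (X i).
Proof.
move=> Ji _ B mB; rewrite setTI; apply: sub_sigma_algebra.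
by exists i, B.
Qed.

(** A pi-lambda argument: the finite cylinders [cyl] are stable under intersection and generate the
    block, and on them both sides, as measures of [A], agree by mutual independence. *)
Lemma independent_block (I : eqType) (X : I -> T -> T') (J : pred I) (j : I) :
  (forall i, measurable_fun setT (X i)) -> mutually_independent P X -> ~~ J j ->
  forall A B, <<s block_events X J >> A -> measurable B ->
    P (A `&` X j @^-1` B) = P A * P (X j @^-1` B).
Proof.
move=> mX indX Jj A B sA mB.
pose cyl := [set A | exists (s : seq I) (F : I -> set T'),
  [/\ uniq s, all J s, forall i, measurable (F i)
    & A = \bigcap_(i in [set` s]) (X i @^-1` F i)]].
have mpre i F : measurable F -> measurable (X i @^-1` F).
  by move=> mF; rewrite -[_ @^-1` _]setTI; exact: mX.
have cylm : cyl `<=` measurable.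
  move=> _ [s [F [_ _ mF ->]]]; apply: fin_bigcap_measurable => //.
  by move=> i _; exact: mpre.
have cylT : cyl setT.
  exists [::], (fun=> setT); split=> //.
  by rewrite set_nil bigcap_set0.
have cylI : setI_closed cyl.
  move=> _ _ [s [F [us Js mF ->]]] [s' [F' [us' Js' mF' ->]]].
  pose G i := (if i \in s then F i else setT) `&` (if i \in s' then F' i else setT).
  exists (undup (s ++ s')), G; split; first exact: undup_uniq.
  - apply/allP => i; rewrite mem_undup mem_cat => /orP[]; exact/allP.
  - by move=> i; apply: measurableI; case: ifP.
  - apply/seteqP; split=> [x [xs xs'] i /= |x xG].
      rewrite mem_undup mem_cat => _; split.
        by case: ifP => // /xs.
      by case: ifP => // /xs'.
    split=> i /= si.
      have /(_ _)[] := xG i; first by rewrite /= mem_undup mem_cat si.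
      by rewrite si.
    have /(_ _)[] := xG i; first by rewrite /= mem_undup mem_cat si orbT.
    by rewrite si.
have sub : block_events X J `<=` cyl.
  move=> _ [i [C [Ji mC ->]]]; exists [:: i], (fun=> C); split=> //=.
    by rewrite Ji.
  by rewrite set_cons1 bigcap_set1.
have mC := mpre j B mB.
have r0 : (0 <= fine (P (X j @^-1` B)))%R by exact: fine_ge0.
have PE : (fine (P (X j @^-1` B)))%:E = P (X j @^-1` B).
  by rewrite fineK // fin_num_measure.
transitivity (mscale (NngNum r0) P A); last by rewrite /mscale /= PE muleC.
rewrite -[LHS]/(mrestr P mC A).
apply: (@g_sigma_algebra_measure_unique _ _ _ cyl cylm (fun=> setT) (fun=> cylT)
  _ (mrestr P mC) (mscale (NngNum r0) P) cylI).
- by rewrite bigcup_const //; exists 0%N.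
- move=> _ [s [F [us Js mF ->]]].
  (* Adds the constraint [B] at [j] to the cylinder; the coordinates in [s] are untouched because
     [j] is outside the block. *)
  pose F' i := if i == j then B else F i.
  have js : j \notin s by apply: contra Jj => /(allP Js).
  have sE i : i \in s -> F' i = F i.
    by rewrite /F'; case: eqP => // -> js'; rewrite js' in js.
  have := indX (j :: s) F'; rewrite big_cons.
  have -> : (\prod_(i <- s) P (X i @^-1` F' i) = \prod_(i <- s) P (X i @^-1` F i))%E.
    by rewrite !big_seq; apply: eq_bigr => i si; rewrite sE.
  have -> : \bigcap_(i in [set` j :: s]) X i @^-1` F' i =
      (\bigcap_(i in [set` s]) X i @^-1` F i) `&` X j @^-1` B.
    apply/seteqP; split=> [x xF|x [xF xB] i /=].
      split=> [i /= si|]; last first.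
        by have := xF j; rewrite /= mem_head /F' eqxx; apply.
      by rewrite -(sE i si); apply: xF; rewrite /= in_cons si orbT.
    rewrite in_cons => /predU1P[->|si]; first by rewrite /F' eqxx.
    by rewrite sE //; exact: xF.
  have -> : F' j = B by rewrite /F' eqxx.
  move=> indjs; transitivity (P (\bigcap_(i in [set` s]) X i @^-1` F i `&` X j @^-1` B)).
    by [].
  rewrite indjs /= ?js // => [|i]; last by rewrite /F'; case: eqP.
  by rewrite /mscale /= PE indX.
- move=> _; rewrite -[X in X < _]/(P (setT `&` X j @^-1` B)) setTI.
  by rewrite (le_lt_trans (probability_le1 P mC)) // ltry.
- by apply: sA; split; [exact: smallest_sigma_algebra | 
    exact: subset_trans sub (@sub_gen_smallest _ _ _)].
Qed.

(** The identity, read as a variable with values in the coarser space [g_sigma_algebraType G],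
    carries all the information of [G]. Its joint law with [X] is a product, because the two
    measures agree on rectangles, and Tonelli's theorem applies. *)
Lemma independent_fubini (Q : probability T' R) (G : set (set T)) (X : T -> T') :
  measurable_fun setT X -> G `<=` measurable ->
  (forall A B, <<s G >> A -> measurable B -> P (A `&` X @^-1` B) = P A * Q B) ->
  forall f : g_sigma_algebraType G * T' -> \bar R,
    measurable_fun [set: (g_sigma_algebraType G * T')%type] f ->
    (forall z, 0 <= f z) ->
    \int[P]_w f (w, X w) = \int[P]_w \int[Q]_x f (w, x).
Proof.
move=> mX Gm indX f mf f0.
have mid : measurable_fun [set: T] (id : T -> g_sigma_algebraType G).
  move=> _ A mA; rewrite setTI preimage_id.
  by apply: mA; split; [exact: sigma_algebra_measurable | exact: Gm].
have mpair : measurable_fun [set: T] (fun w => ((w : g_sigma_algebraType G), X w)).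
  exact: measurable_fun_pair.
pose idf : {mfun T >-> g_sigma_algebraType G} :=
  HB.pack (id : T -> g_sigma_algebraType G) (isMeasurableFun.Build _ _ _ _ _ mid).
pose pairf : {mfun T >-> (g_sigma_algebraType G * T')%type} :=
  HB.pack (fun w => ((w : g_sigma_algebraType G), X w)) (isMeasurableFun.Build _ _ _ _ _ mpair).
have mF : measurable_fun [set: g_sigma_algebraType G] (fun w => \int[Q]_x f (w, x)).
  exact: measurable_fun_fubini_tonelli_F.
have F0 (w : g_sigma_algebraType G) : 0 <= \int[Q]_x f (w, x) by exact: integral_ge0.
transitivity (\int[distribution P pairf]_z f z).
  by rewrite ge0_integral_distribution.
transitivity (\int[distribution P idf \x Q]_z f z).
  apply: eq_measure_integral => A mA _; apply/esym.
  exact: product_measure_unique.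
by rewrite fubini_tonelli1 // ge0_integral_distribution.
Qed.

End independence.

Section independent_products.
Local Open Scope ereal_scope.
Context d (T : measurableType d) (R : realType) (P : probability T R).

Lemma integral_mul_independent (G : set (set T)) (X : T -> R)
    (f : g_sigma_algebraType G -> R) :
  measurable_fun setT X -> G `<=` measurable ->
  (forall A B, <<s G >> A -> measurable B ->
     P (A `&` X @^-1` B) = P A * P (X @^-1` B)) ->
  measurable_fun setT f -> (forall w, 0 <= f w)%R -> (forall w, 0 <= X w)%R ->
  \int[P]_w (f w * X w)%:E = \int[P]_w (f w)%:E * \int[P]_w (X w)%:E.
Proof.
move=> mX Gm indX mf f0 X0.
pose Xf : {mfun T >-> R} := HB.pack X (isMeasurableFun.Build _ _ _ _ _ mX).
(* The maximum makes [F] nonnegative on the whole product, as Tonelli's theorem requires, and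
   changes nothing at the values of [X]. *)
pose F (z : g_sigma_algebraType G * R) := (f z.1 * Num.max z.2 0)%:E.
have mF : measurable_fun setT F.
  apply/measurable_EFinP; apply: measurable_funM.
    exact: measurableT_comp.
  exact: measurable_maxr.
have F0 z : 0 <= F z by rewrite lee_fin mulr_ge0 // le_max lexx orbT.
have := @independent_fubini _ _ _ _ _ P (distribution P Xf) G X mX Gm indX F mF F0.
rewrite /F /=.
under eq_integral => w _ do rewrite (max_idPl (X0 w)).
move=> ->.
have mf' : measurable_fun [set: T] f.
  move=> _ B mB; have := mf measurableT B mB; rewrite !setTI; apply.
  by split; [exact: sigma_algebra_measurable | exact: Gm].
have Xint : \int[distribution P Xf]_x (Num.max x 0)%:E = \int[P]_w (X w)%:E.
  rewrite ge0_integral_distribution //=.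
  - by apply: eq_integral => w _ /=; rewrite (max_idPl (X0 w)).
  - exact/measurable_EFinP/measurable_maxr.
  - by move=> y; rewrite lee_fin le_max lexx orbT.
under eq_integral => w _.
  under eq_integral => x _ do rewrite EFinM.
  rewrite ge0_integralZl_EFin //; last 2 first.
  - by move=> x _; rewrite lee_fin le_max lexx orbT.
  - exact/measurable_EFinP/measurable_maxr.
  rewrite Xint.
  over.
rewrite ge0_integralZr //.
- exact/measurable_EFinP.
- by move=> w _; rewrite lee_fin.
- by apply: integral_ge0 => w _; rewrite lee_fin.
Qed.

(** Adding [c] makes [f] nonnegative, and the positive and negative parts of [X] have equal means;
    the product formula for nonnegative factors applies to each part. *)
Lemma integral_mul_independent_mean0 (G : set (set T)) (X : T -> R)
    (f : g_sigma_algebraType G -> R) (c : R) :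
  G `<=` measurable ->
  (forall A B, <<s G >> A -> measurable B ->
     P (A `&` X @^-1` B) = P A * P (X @^-1` B)) ->
  measurable_fun setT f -> (forall w, `|f w| <= c)%R ->
  P.-integrable setT (EFin \o X) -> \int[P]_w (X w)%:E = 0 ->
  P.-integrable setT (EFin \o (fun w => f w * X w)%R) /\
  \int[P]_w (f w * X w)%:E = 0.
Proof.
move=> Gm indX mf fc iX EX0.
have mX : measurable_fun setT X by have /measurable_int/measurable_EFinP := iX.
have mf' : measurable_fun [set: T] f.
  move=> _ B mB; have := mf measurableT B mB; rewrite !setTI; apply.
  by split; [exact: sigma_algebra_measurable | exact: Gm].
have ifX (g : T -> R) (b : R) : measurable_fun setT g -> (forall w, `|g w| <= b)%R ->
    P.-integrable setT (EFin \o (fun w => g w * X w)%R).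
  move=> mg gb.
  apply: (@le_integrable _ _ _ P setT measurableT _
           (EFin \o (fun w => b * X w)%R)).
  - exact/measurable_EFinP/measurable_funM.
  - move=> w _ /=; rewrite lee_fin !normrM ler_wpM2r //.
    by rewrite (le_trans (gb w)) // ler_norm.
  - have := integrableZl measurableT b iX.
    by apply: eq_integrable => // w _.
split; first exact: ifX mf' fc.
pose g w := (f w + c)%R.
have g0 w : (0 <= g w)%R.
  by rewrite /g -lerBlDr sub0r; have := fc w; rewrite ler_norml => /andP[].
have mg : measurable_fun [set: g_sigma_algebraType G] g by exact: measurable_funD.
have mg' : measurable_fun [set: T] g by exact: measurable_funD.
have gc w : (`|g w| <= `|c| + `|c|)%R.
  rewrite (le_trans (ler_normD _ _)) // lerD2r (le_trans (fc w)) //.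
  exact: ler_norm.
pose Xp w := Num.max (X w) 0%R; pose Xn w := Num.max (- X w)%R 0%R.
have indp (h : R -> R) : measurable_fun setT h ->
    forall A B, <<s G >> A -> measurable B ->
    P (A `&` (h \o X) @^-1` B) = P A * P ((h \o X) @^-1` B).
  move=> mh A B sA mB; rewrite comp_preimage indX //.
  by rewrite -[_ @^-1` _]setTI; exact: mh.
have mpos : measurable_fun [set: R] (fun x : R => Num.max x 0%R) by exact: measurable_maxr.
have mneg : measurable_fun [set: R] (fun x : R => Num.max (- x)%R 0%R).
  by apply: measurable_maxr.
have mXp : measurable_fun setT Xp by exact: measurableT_comp mpos mX.
have mXn : measurable_fun setT Xn by exact: measurableT_comp mneg mX.
have Xp0 w : (0 <= Xp w)%R by rewrite le_max lexx orbT.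
have Xn0 w : (0 <= Xn w)%R by rewrite le_max lexx orbT.
have gXp := @integral_mul_independent G Xp g mXp Gm (indp _ mpos) mg g0 Xp0.
have gXn := @integral_mul_independent G Xn g mXn Gm (indp _ mneg) mg g0 Xn0.
have iXp : P.-integrable setT (EFin \o Xp).
  apply: (le_integrable measurableT _ _ iX); first exact/measurable_EFinP.
  by move=> w _ /=; rewrite lee_fin ger0_norm // /Xp;
    case: (leP (X w) 0%R) => // /ltW h; rewrite ger0_norm.
have iXn : P.-integrable setT (EFin \o Xn).
  apply: (le_integrable measurableT _ _ iX); first exact/measurable_EFinP.
  move=> w _ /=; rewrite lee_fin ger0_norm // /Xn; case: (leP (- X w)%R 0%R) => // /ltW h.
  by rewrite -normrN ger0_norm.
have XE w : X w = (Xp w - Xn w)%R.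
  rewrite /Xp /Xn; case: (leP (X w) 0%R) => h.
    by rewrite (max_idPl _) ?oppr_ge0 // sub0r opprK.
  by rewrite (max_idPr _) ?subr0 // oppr_le0 ltW.
have Epn : \int[P]_w (Xp w)%:E = \int[P]_w (Xn w)%:E.
  have : \int[P]_w (Xp w)%:E - \int[P]_w (Xn w)%:E = 0.
    rewrite -EX0 -integralB //; apply: eq_integral => w _.
    by rewrite -EFinB -XE.
  by move/eqP; rewrite sube_eq ?add0e ?fin_num_adde_defl ?integrable_fin_num // => /eqP.
have EgX : \int[P]_w (g w * X w)%:E = 0.
  transitivity (\int[P]_w ((g w * Xp w)%:E - (g w * Xn w)%:E)).
    by apply: eq_integral => w _; rewrite -EFinB -mulrBr -XE.
  have igp (Y : T -> R) : P.-integrable setT (EFin \o Y) ->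
      P.-integrable setT (EFin \o (fun w => g w * Y w)%R).
    move=> iY; have mY : measurable_fun setT Y by have /measurable_int/measurable_EFinP := iY.
    apply: (@le_integrable _ _ _ P setT measurableT _
           (EFin \o (fun w => (`|c| + `|c|) * Y w)%R)).
    - exact/measurable_EFinP/measurable_funM.
    - move=> w _ /=; rewrite lee_fin !normrM ler_wpM2r //.
      by rewrite (le_trans (gc w)) // ler_norm.
    - have := integrableZl measurableT (`|c| + `|c|)%R iY.
      by apply: eq_integrable => // w _.
  rewrite (integralB measurableT (igp _ iXp) (igp _ iXn)) gXp gXn Epn subee //.
  rewrite -gXn; apply: integrable_fin_num => //; exact: (igp _ iXn).
transitivity (\int[P]_w ((g w * X w)%:E - (c * X w)%:E)).
  by apply: eq_integral => w _; rewrite -EFinB -mulrBl /g addrK.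
rewrite integralB //; last 2 first.
- exact: (ifX g _ mg' gc).
- exact: (ifX (fun=> c) `|c|%R).
rewrite EgX sub0e; under eq_integral => w _ do rewrite EFinM.
by rewrite integralZl // EX0 mule0 oppe0.
Qed.

End independent_products.

(** * Induction along acyclic relations *)

Section acyclic_relations.
Variables (V : finType) (e : rel V).

(** The number of ancestors, the node itself included, grows strictly along the edges of an acyclic
    graph and so serves for induction in topological order. *)
Definition rank (v : V) : nat := #|[pred u | connect e u v]|.

Lemma acyclicN_connect u v : acyclic e -> e u v -> ~~ connect e v u.
Proof.
move=> ac euv; apply/negP => /connectP[p evp lastp].
have : cycle e (v :: p) by rewrite /= rcons_path evp -lastp.
by move/ac.
Qed.

Lemma rank_edge u v : acyclic e -> e u v -> (rank u < rank v)%N.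
Proof.
move=> ac euv; apply/proper_card/properP; split.
  by apply/fintype.subsetP => w; rewrite !inE => /connect_trans; apply; exact: connect1.
by exists v; rewrite !inE ?connect0 // acyclicN_connect.
Qed.

Lemma rank_connect u v : acyclic e -> connect e u v -> (rank u <= rank v)%N.
Proof.
move=> ac /connectP[p]; elim: p u => [|w p IHp] u /= => [_ -> //|].
move=> /andP[euw ewp] lastp; apply: leq_trans (IHp _ ewp lastp).
exact/ltnW/rank_edge.
Qed.

Lemma acyclic_of_rank (r : V -> nat) :
  (forall u v, e u v -> (r u < r v)%N) -> acyclic e.
Proof.
move=> rlt [//|x p] /= xpx; exfalso.
suff : (r x < r (last x (rcons p x)))%N by rewrite last_rcons ltnn.
have le_last y q : path e y q -> (r y <= r (last y q))%N.
  elim: q y => [//|z q IHq] y /= /andP[/rlt/ltnW yz /IHq].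
  exact: leq_trans.
case: p xpx => [|y p] /= /andP[/rlt xy]; first by [].
by move=> /le_last; exact: leq_trans.
Qed.

(** [J] is closed under predecessors, so evaluating a node of [J] only reads inputs at nodes of [J].
    The value is thus measurable already for the sigma-algebra of that block. *)
Lemma iter_measurable d (Om : measurableType d) (R : realType)
    (F : Om -> (V -> R) -> V -> R) (J : pred V) :
  (forall z v, e z v -> J v -> J z) ->
  (forall v, J v -> forall x : Om -> V -> R,
     (forall z, e z v -> measurable_fun setT (x ^~ z)) ->
     measurable_fun setT (fun w => F w (x w) v)) ->
  forall v, J v -> measurable_fun setT (fun w => solve (F w) (fun=> 0) v).
Proof.
move=> Jdown Fmeas; rewrite /solve; elim: #|V| => [|k IHk] v Jv.
  exact: measurable_cst.
by apply: Fmeas => // z ezv; exact/IHk/(Jdown z v).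
Qed.

End acyclic_relations.

(** * Hidden paths and the elimination of the hidden nodes *)

Section hidden_path_weights.
Variables (R : realType) (U X : finType) (G : linear_model R U X).
Hypothesis G_adm : admissible G.
Implicit Types (z v : node U X) (i j : option X) (u : U).

Let G_acyclic : acyclic (edge G). Proof. by case: G_adm. Qed.

Lemma weight_ge0 z v : edge G z v -> 0 <= weight G z v.
Proof. by case: G_adm => _ _ _ w01 _ /w01/andP[]. Qed.

(** [weight] is arbitrary off the edges; setting it to 0 there allows sums over all nodes. *)
Definition edge_weight z v : R := if edge G z v then weight G z v else 0.

Lemma edge_weight_ge0 z v : 0 <= edge_weight z v.
Proof. by rewrite /edge_weight; case: ifP => // /weight_ge0. Qed.

(* Total weight of the directed paths from [z] to [j] with exactly [k]
   intermediate nodes, all of them hidden. *)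
Fixpoint hidden_weight (k : nat) (j : option X) z : R :=
  if k is k'.+1 then \sum_u edge_weight z (inl u) * hidden_weight k' j (inl u)
  else edge_weight z (inr j).

Lemma hidden_weight_ge0 k j z : 0 <= hidden_weight k j z.
Proof.
elim: k z => [|k IHk] z /=; first exact: edge_weight_ge0.
by apply: sumr_ge0 => u _; rewrite mulr_ge0 ?edge_weight_ge0.
Qed.

Lemma hidden_weight_path k j z : hidden_weight k j z != 0 ->
  exists2 p : seq U, size p = k & is_path_via_hidden G z p j.
Proof.
elim: k z => [|k IHk] z /=.
  rewrite /edge_weight; case: ifP => [ezj _|]; last by rewrite eqxx.
  by exists [::] => //; rewrite /is_path_via_hidden /= ezj.
move=> sum_neq0; have [u /negP w_neq0] : exists u,
    ~ (edge_weight z (inl u) * hidden_weight k j (inl u) == 0).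
  apply/not_existsP => all0; move/eqP: sum_neq0; apply.
  by apply: big1 => u _; apply/eqP; have := all0 u; move/contrapT.
move: w_neq0; rewrite mulf_eq0 negb_or /edge_weight => /andP[].
case: ifP => [ezu _|]; last by rewrite eqxx.
move=> /IHk[p <- pathp]; exists (u :: p) => //.
by rewrite /is_path_via_hidden /= ezu.
Qed.

Let hidden_ancestors z : nat := #|[pred u | connect (edge G) (inl u) z]|.

Let hidden_ancestors_edge z u : edge G z (inl u) ->
  (hidden_ancestors z < hidden_ancestors (inl u))%N.
Proof.
move=> ezu; apply/proper_card/properP; split.
  by apply/fintype.subsetP => w; rewrite !inE => /connect_trans; apply; exact: connect1.
by exists u; rewrite !inE ?connect0 // acyclicN_connect.
Qed.

(** Each hidden node entered has at least one more hidden ancestor than its predecessor, namely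
    itself. Hence the lengths listed in [hidden_paths] exhaust the hidden paths. *)
Let hidden_path_short z p j : is_path_via_hidden G z p j ->
  (hidden_ancestors z + size p <= #|U|)%N.
Proof.
rewrite /is_path_via_hidden; elim: p z => [|u p IHp] z /=.
  by rewrite addn0 => _; exact: max_card.
by move=> /andP[/hidden_ancestors_edge zu /IHp]; 
  rewrite addnS -addSn; apply: leq_trans; rewrite leq_add2r.
Qed.

(** A hidden start counts among its own hidden ancestors, which leaves room for fewer than [#|U|]
    further hidden nodes. *)
Lemma hidden_weight_eq0 j u : hidden_weight #|U| j (inl u) = 0.
Proof.
apply/eqP/negPn/negP => /hidden_weight_path[p sp /hidden_path_short].
rewrite sp -{2}[#|U|]add0n leq_add2r leqn0 => /eqP/card0_eq/(_ u).
by rewrite !inE connect0.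
Qed.

Lemma sum_tuple_path k j z :
  \sum_(q : k.-tuple U | is_path_via_hidden G z q j)
    path_weight G z (rcons (map inl q) (inr j)) = hidden_weight k j z.
Proof.
pose g z (q : seq U) := if is_path_via_hidden G z q j
  then path_weight G z (rcons (map inl q) (inr j)) else 0.
rewrite big_mkcond -/(\sum_(q : k.-tuple U) g z q).
elim: k z => [|k IHk] z /=.
  rewrite (big_pred1 [tuple]) => [|q]; last by rewrite [q]tuple0 /= eqxx.
  by rewrite /g /is_path_via_hidden /= andbT mulr1.
rewrite (reindex (fun p : U * k.-tuple U => [tuple of p.1 :: p.2])) /=; last first.
  exists (fun q : k.+1.-tuple U => (thead q, [tuple of behead q])) => [[u q] _|q _] /=.
    by congr pair; apply: val_inj.
  by rewrite [RHS]tuple_eta; apply: val_inj.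
rewrite -(pair_big xpredT xpredT (fun u (q : k.-tuple U) => g z (u :: q))) /=.
apply: eq_bigr => u _; rewrite -IHk mulr_sumr; apply: eq_bigr => q _.
rewrite /g /edge_weight /is_path_via_hidden /=; case: (edge G z (inl u)) => /=;
  last by rewrite mul0r.
by case: ifP; rewrite ?mulr0.
Qed.

Definition total_weight (j : option X) z : R :=
  \sum_(k < #|U|.+1) hidden_weight k j z.

Lemma total_weight_ge0 j z : 0 <= total_weight j z.
Proof. by apply: sumr_ge0 => k _; exact: hidden_weight_ge0. Qed.

Lemma hidden_paths_weight i j :
  \sum_(p <- hidden_paths G i j)
    path_weight G (inr i) (rcons (map inl p) (inr j)) = total_weight j (inr i).
Proof.
rewrite /hidden_paths big_filter big_flatten big_map.
rewrite -[iota 0 _]/(index_iota 0 #|U|.+1) big_mkord.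
by apply: eq_bigr => k _; rewrite -sum_tuple_path big_map big_enum_cond.
Qed.

Lemma mem_hidden_paths i j p : (p \in hidden_paths G i j) = is_path_via_hidden G (inr i) p j.
Proof.
rewrite mem_filter; case: (boolP (is_path_via_hidden _ _ _ _)) => // pathp.
have sp : (size p < #|U|.+1)%N.
  by rewrite ltnS; have := hidden_path_short pathp; apply: leq_trans; rewrite leq_addl.
rewrite andTb; apply/flatten_mapP; exists (size p); first by rewrite mem_iota.
by apply/mapP; exists (in_tuple p); rewrite ?mem_enum.
Qed.

Lemma total_weight_path j z : total_weight j z != 0 ->
  exists p, is_path_via_hidden G z p j.
Proof.
apply: contraNP => /forallNP nopath; apply/eqP/big1 => k _.
apply/eqP/negPn/negP => /hidden_weight_path[p _ pathp].
exact: nopath pathp.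
Qed.

Lemma hidden_paths_total_weight i j : total_weight j (inr i) != 0 ->
  hidden_paths G i j != [::].
Proof.
move=> /total_weight_path[p]; rewrite -mem_hidden_paths.
by case: hidden_paths.
Qed.

Lemma is_path_via_hidden_connect z p j : is_path_via_hidden G z p j ->
  connect (edge G) z (inr j).
Proof. by move=> pathp; apply/connectP; exists (rcons (map inl p) (inr j)); rewrite ?last_rcons.
Qed.

Lemma is_path_via_hidden_rank z p j : is_path_via_hidden G z p j ->
  (rank (edge G) z < rank (edge G) (inr j))%N.
Proof.
rewrite /is_path_via_hidden; case: p => [|u p] /=.
  by rewrite andbT; exact: rank_edge.
move=> /andP[/(rank_edge G_acyclic) zu pathp]; apply: leq_trans zu _.
exact/(rank_connect G_acyclic)/(is_path_via_hidden_connect (p := p)).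
Qed.

Lemma hidden_paths_connect i j : hidden_paths G i j != [::] ->
  connect (edge G) (inr i) (inr j) /\
  (rank (edge G) (inr i) < rank (edge G) (inr j))%N.
Proof.
case E : (hidden_paths G i j) => [//|p s] _.
have : p \in hidden_paths G i j by rewrite E mem_head.
rewrite mem_hidden_paths => pathp.
by split; [exact: is_path_via_hidden_connect pathp | exact: is_path_via_hidden_rank pathp].
Qed.

Definition mrank (v : mnode X) : nat :=
  if v is Some i then rank (edge G) (inr i) else 0.

Lemma mrank_edge (u v : mnode X) : transformed_edge G u v -> (mrank u < mrank v)%N.
Proof.
case: v u => [j|] [i|] //=; first by move/hidden_paths_connect => [].
by move=> _; apply/card_gt0P; exists (inr j); rewrite inE connect0.
Qed.

Lemma transformed_acyclic : acyclic (transformed_edge G).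
Proof. exact: acyclic_of_rank mrank_edge. Qed.

(** The path is cut at its first observed node; what precedes is a hidden path, the kind that
    [confounding] speaks of. *)
Lemma first_observed_node z p i : path (edge G) z p -> p != [::] ->
  last z p = inr i -> exists i' q, is_path_via_hidden G z q i' /\
  connect (edge G) (inr i') (inr i).
Proof.
elim: p z => [//|v p IHp] z /= /andP[ezv pathp] _ lastp.
case: v ezv pathp lastp => [u|i'] ezv pathp lastp; last first.
  exists i', [::]; split; first by rewrite /is_path_via_hidden /= ezv.
  by apply/connectP; exists p.
have [p0|pN] := eqVneq p [::]; first by rewrite p0 in lastp.
have [i' [q [pathq ci]]] := IHp _ pathp pN lastp.
by exists i', (u :: q); rewrite /is_path_via_hidden /= ezv.
Qed.

(* The only use of the assumption on hidden confounders. *)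
Lemma hidden_not_ancestor u i j : u != u0 G ->
  total_weight j (inl u) != 0 -> hidden_paths G i j != [::] ->
  ~~ connect (edge G) (inl u) (inr i).
Proof.
move=> u_neq0 /total_weight_path[q pathq] /hidden_paths_connect[cij rij].
apply/negP => /connectP[p pathp lastp].
have pN : p != [::] by case: p pathp lastp.
have [i' [p' [pathp' ci]]] := first_observed_node pathp pN (esym lastp).
case: G_adm => _ _ _ _; apply; exists u, i', j, p', q; split=> //.
(* [i'] is an ancestor of [i], whose rank is strictly below that of [j]. *)
- apply: contraTneq rij => <-; rewrite -leqNgt.
  exact: rank_connect.
- exact: connect_trans cij.
Qed.

(** The hidden parents are replaced by their structural equations again and again. Acyclicity makes
    the remainder vanish, and the observed nodes and the noises keep their total path weights. *)
Lemma structural_expansion (s : intervention R X) (eps : node U X -> R) j :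
  s j = None ->
  value G s eps (inr j) =
    \sum_i total_weight j (inr i) * value G s eps (inr i) +
    (\sum_u total_weight j (inl u) *
       (if u == u0 G then 1 else eps (inl u)) + eps (inr j)).
Proof.
move=> sj; pose x := value G s eps; pose base u := if u == u0 G then 1 else eps (inl u).
have xU u : x (inl u) = base u + \sum_z edge_weight z (inl u) * x z.
  rewrite {1}/x valueE //= /base; case: eqP => [->|_].
    rewrite big1 ?addr0 // => z _; rewrite /edge_weight ifN ?mul0r //.
    by case: G_adm.
  rewrite addrC big_mkcond; congr (_ + _); apply: eq_bigr => z _.
  by rewrite /edge_weight; case: ifP => // _; rewrite mul0r.
(* What is left to expand after [k] substitutions: the nodes that reach [j] through exactly [k]
   hidden nodes. *)
pose tail k := \sum_z hidden_weight k j z * x z.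
have tailS k : \sum_u hidden_weight k j (inl u) * x (inl u) =
    \sum_u hidden_weight k j (inl u) * base u + tail k.+1.
  under eq_bigr => u _ do rewrite xU mulrDr.
  rewrite big_split; congr (_ + _).
  under eq_bigr => u _ do rewrite mulr_sumr.
  rewrite exchange_big; apply: eq_bigr => z _ /=.
  by rewrite mulr_suml; apply: eq_bigr => u _; rewrite mulrCA mulrA.
have tailE k : tail k = \sum_u hidden_weight k j (inl u) * x (inl u) +
    \sum_i hidden_weight k j (inr i) * x (inr i).
  by rewrite /tail big_sumType.
have xE k : x (inr j) = eps (inr j) + \sum_(l < k)
    (\sum_u hidden_weight l j (inl u) * base u +
     \sum_i hidden_weight l j (inr i) * x (inr i)) + tail k.
  elim: k => [|k IHk].
    rewrite big_ord0 addr0 {1}/x valueE //= sj /= addrC; congr (_ + _).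
    rewrite big_mkcond; apply: eq_bigr => z _ /=.
    by rewrite /edge_weight; case: ifP => // _; rewrite mul0r.
  by rewrite IHk big_ord_recr /= tailE tailS; ring.
have tail0 : tail #|U|.+1 = 0.
  have := tailS #|U|; rewrite !big1 ?add0r // => u _;
  by rewrite hidden_weight_eq0 mul0r.
rewrite -/x (xE #|U|.+1) {xE} big_split /= tail0 addr0.
have -> : \sum_(k < #|U|.+1) \sum_u hidden_weight k j (inl u) * base u =
    \sum_u total_weight j (inl u) * base u.
  by rewrite exchange_big; apply: eq_bigr => u _; rewrite mulr_suml.
have -> : \sum_(k < #|U|.+1) \sum_i hidden_weight k j (inr i) * x (inr i) =
    \sum_i total_weight j (inr i) * x (inr i).
  by rewrite exchange_big; apply: eq_bigr => i _; rewrite mulr_suml.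
by rewrite /base; ring.
Qed.

End hidden_path_weights.

(** * Real-valued expectations *)

Section real_expectation.
Context d (T : measurableType d) (R : realType) (P : probability T R).
Implicit Types f g : T -> R.

Lemma integrable_real f : P.-integrable setT (EFin \o f) ->
  (\int[P]_w (f w)%:E)%E = (\int[P]_w f w)%:E.
Proof. by move=> fi; rewrite /Rintegral fineK // integrable_fin_num. Qed.

Lemma integrable_measurable f : P.-integrable setT (EFin \o f) -> measurable_fun setT f.
Proof. by move=> /measurable_int/measurable_EFinP. Qed.

Lemma integrable_addr f g : P.-integrable setT (EFin \o f) ->
  P.-integrable setT (EFin \o g) -> P.-integrable setT (EFin \o (fun w => f w + g w)).
Proof. by move=> fi gi; have := integrableD measurableT fi gi; apply: eq_integrable. Qed.

Lemma integrable_mull (c : R) f : P.-integrable setT (EFin \o f) ->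
  P.-integrable setT (EFin \o (fun w => c * f w)).
Proof. by move=> fi; have := integrableZl measurableT c fi; apply: eq_integrable. Qed.

Lemma integrable_bounded f (c : R) : measurable_fun setT f ->
  {ae P, forall w, `|f w| <= c} -> P.-integrable setT (EFin \o f).
Proof.
move=> mf fc; apply/integrableP; split; first exact/measurable_EFinP.
apply: (@le_lt_trans _ _ (\int[P]_w `|c|%:E)%E); last first.
  by rewrite integral_cst //= probability_setT mule1 ltry.
apply: ae_ge0_le_integral => //.
- apply: measurableT_comp => //; exact/measurable_EFinP.
- by apply: filterS fc => w fw _ /=; rewrite lee_fin (le_trans fw) // ler_norm.
Qed.

Lemma integrable_cstr (c : R) : P.-integrable setT (EFin \o (fun=> c)).
Proof. by apply: (@integrable_bounded _ `|c|); [exact: measurable_cst | exact: aeW]. Qed.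

Lemma integrable_sumr (I : Type) (s : seq I) (Q : pred I) (f : I -> T -> R) :
  (forall i, Q i -> P.-integrable setT (EFin \o f i)) ->
  P.-integrable setT (EFin \o (fun w => \sum_(i <- s | Q i) f i w)).
Proof.
move=> fi; have := @integrable_sum _ _ _ P setT measurableT _ s Q
  (fun i => EFin \o f i) fi.
by apply: eq_integrable => // w _ /=; rewrite sumEFin.
Qed.

Lemma Rintegral_cstr (c : R) : \int[P]_w c = c.
Proof. by rewrite Rintegral_cst //= probability_setT mulr1. Qed.

Lemma Rintegral_sum (I : Type) (s : seq I) (Q : pred I) (f : I -> T -> R) :
  (forall i, Q i -> P.-integrable setT (EFin \o f i)) ->
  \int[P]_w (\sum_(i <- s | Q i) f i w) = \sum_(i <- s | Q i) \int[P]_w f i w.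
Proof.
move=> fi; elim: s => [|i s IHs].
  by under eq_Rintegral do rewrite big_nil; rewrite Rintegral_cstr big_nil.
rewrite big_cons -IHs; under eq_Rintegral do rewrite big_cons.
case: ifP => // Qi; rewrite RintegralD //; first exact: fi.
exact: integrable_sumr.
Qed.

Lemma ae_le_Rintegral f g : P.-integrable setT (EFin \o f) ->
  P.-integrable setT (EFin \o g) -> {ae P, forall w, f w <= g w} ->
  \int[P]_w f w <= \int[P]_w g w.
Proof.
move=> fi gi fg; rewrite -subr_ge0 -RintegralB //.
have mgf : measurable_fun setT (fun w => g w - f w).
  by apply: measurable_funB; exact: integrable_measurable.
have mm : measurable_fun setT (fun w => Num.max (g w - f w) 0).
  exact: measurable_maxr.
suff -> : \int[P]_w (g w - f w) = \int[P]_w (Num.max (g w - f w) 0).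
  by apply: Rintegral_ge0 => w _; rewrite le_max lexx orbT.
congr fine; apply: ae_eq_integral => //; try exact/measurable_EFinP.
by apply: filterS fg => w fgw _ /=; rewrite (max_idPl _) // subr_ge0.
Qed.

Lemma ae_eq_Rintegral f g : measurable_fun setT f -> measurable_fun setT g ->
  {ae P, forall w, f w = g w} -> \int[P]_w f w = \int[P]_w g w.
Proof.
move=> mf mg fg; congr fine; apply: ae_eq_integral => //; try exact/measurable_EFinP.
by apply: filterS fg => w fgw _ /=; rewrite fgw.
Qed.

End real_expectation.

(** * The observed nodes as a linear regression on their parents *)

Section hidden_linear_model.
Variables (R : realType) (U X : finType) (G : linear_model R U X).
Context d (W : measurableType d) (P : probability W R).
Variable eps : node U X -> {RV P >-> R}.
Hypothesis G_adm : admissible G.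
Hypothesis eps_adm : admissible_noise G eps.
Implicit Types (s : intervention R X) (i j : option X) (u : U).

Let G_acyclic : acyclic (edge G). Proof. by case: G_adm. Qed.

Lemma value_measurable d1 (Om : measurableType d1) (ep : node U X -> Om -> R)
    s (J : pred (node U X)) :
  (forall z v, edge G z v -> J v -> J z) ->
  (forall v, J v -> measurable_fun setT (ep v)) ->
  forall v, J v -> measurable_fun setT (fun w => value G s (ep^~ w) v).
Proof.
move=> Jdown mep; apply: iter_measurable Jdown _ => v Jv x mx.
have mnat : measurable_fun setT
    (fun w => \sum_(z | edge G z v) weight G z v * x w z + ep v w).
  apply: measurable_funD; last exact: mep.
  under eq_fun do rewrite -big_filter.
  under eq_fun do rewrite big_seq_cond.
  apply/measurable_EFinP; rewrite [X in measurable_fun _ X](_ : _ = fun w =>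
    (\sum_(z <- [seq z <- index_enum (node U X) | edge G z v])
      (if edge G z v then weight G z v * x w z else 0))%:E)%E.
    apply/measurable_EFinP/measurable_sum => z.
    by case: (boolP (edge G z v)) => [ezv|_]; 
      [apply: measurable_funM => //; exact: mx | exact: measurable_cst].
  apply/funext => w /=; congr EFin; rewrite -big_seq_cond.
  by rewrite !big_filter; apply: eq_bigr => z ->.
rewrite /structural; case: v Jv mnat {mx} => [u|o] _ mnat.
  by case: (u == u0 G) => //; exact: measurable_cst.
by case: (s o) => //= r; exact: measurable_cst.
Qed.

Lemma value_at_measurable s v : measurable_fun setT (value_at G eps s v).
Proof.
by apply: (@value_measurable _ _ (fun z => eps z : W -> R) s xpredT).
Qed.

Definition unit_valued s := forall x r, s x = Some r -> 0 <= r <= 1.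

Lemma value_at_01 s : unit_valued s ->
  {ae P, forall w, forall i, 0 <= value_at G eps s (inr i) w <= 1}.
Proof.
by move=> s01; apply: filter_forall => i; case: eps_adm => _ _; apply.
Qed.

Lemma value_at_integrable s i : unit_valued s ->
  P.-integrable setT (EFin \o value_at G eps s (inr i)).
Proof.
move=> s01; apply: (@integrable_bounded _ _ _ _ _ 1).
  exact: value_at_measurable.
apply: filterS (value_at_01 s01) => w /(_ i)/andP[v0 v1].
by rewrite ger0_norm.
Qed.

Lemma mean_doE s i : mean_do G eps s i = \int[P]_w value_at G eps s (inr i) w.
Proof. by rewrite /mean_do unlock. Qed.

Lemma mean_do_01 s i : unit_valued s -> 0 <= mean_do G eps s i <= 1.
Proof.
move=> s01; rewrite mean_doE; apply/andP; split.
  rewrite -[leLHS](Rintegral_cstr P); apply: ae_le_Rintegral.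
  - exact: integrable_cstr.
  - exact: value_at_integrable.
  - by apply: filterS (value_at_01 s01) => w /(_ i)/andP[].
rewrite -[leRHS](Rintegral_cstr P); apply: ae_le_Rintegral.
- exact: value_at_integrable.
- exact: integrable_cstr.
- by apply: filterS (value_at_01 s01) => w /(_ i)/andP[].
Qed.

Lemma value_at_do s i r w : s i = Some r -> value_at G eps s (inr i) w = r.
Proof. by move=> si; rewrite /value_at valueE //= si. Qed.

Lemma mean_do_Some s i r : s i = Some r -> mean_do G eps s i = r.
Proof.
move=> si; rewrite mean_doE; under eq_Rintegral do rewrite (value_at_do _ si).
exact: Rintegral_cstr.
Qed.

(** The noise of [j] in the transformed model: each hidden noise arrives along its hidden paths to
    [j]. The constant node [u0 G] contributes [baseline] instead. *)
Definition residual j (w : W) : R :=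
  \sum_(u | u != u0 G) total_weight G j (inl u) * eps (inl u) w + eps (inr j) w.

Definition baseline j : R := total_weight G j (inl (u0 G)).

Lemma eps_integrable v : v != inl (u0 G) -> P.-integrable setT (EFin \o eps v).
Proof. by case: eps_adm => _ zm _ /zm[[]]. Qed.

Lemma eps_mean0 v : v != inl (u0 G) -> \int[P]_w eps v w = 0.
Proof.
by case: eps_adm => _ zm _ /zm[[_ Ev] _]; move: Ev; rewrite /Rintegral unlock => ->.
Qed.

Lemma residual_term_integrable j u : u != u0 G ->
  P.-integrable setT (EFin \o (fun w => total_weight G j (inl u) * eps (inl u) w)).
Proof. by move=> u0; apply/integrable_mull/eps_integrable. Qed.

Lemma residual_integrable j : P.-integrable setT (EFin \o residual j).
Proof.
apply: integrable_addr; last exact: eps_integrable.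
by apply: integrable_sumr => u; exact: residual_term_integrable.
Qed.

Lemma residual_mean0 j : \int[P]_w residual j w = 0.
Proof.
have ie := @eps_integrable (inr j) isT.
have it := @residual_term_integrable j.
rewrite /residual RintegralD //; last exact: integrable_sumr.
rewrite eps_mean0 // addr0 Rintegral_sum // big1 // => u u_neq0.
by rewrite RintegralZl ?eps_mean0 ?mulr0 //; exact: eps_integrable.
Qed.

Lemma value_at_decomposition s j w : s j = None ->
  value_at G eps s (inr j) w =
    baseline j + \sum_i total_weight G j (inr i) * value_at G eps s (inr i) w
    + residual j w.
Proof.
move=> sj; rewrite /value_at structural_expansion // (bigD1 (u0 G)) //= eqxx mulr1.
rewrite (eq_bigr (fun u => total_weight G j (inl u) * eps (inl u) w)); last first.
  by move=> u /negbTE ->.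
by rewrite /residual /baseline /value_at; ring.
Qed.

Lemma mean_do_linear s j : unit_valued s -> s j = None ->
  mean_do G eps s j =
    baseline j + \sum_i total_weight G j (inr i) * mean_do G eps s i.
Proof.
move=> s01 sj; rewrite mean_doE.
under eq_Rintegral do rewrite value_at_decomposition //.
have iv i : P.-integrable setT (EFin \o (fun w =>
    total_weight G j (inr i) * value_at G eps s (inr i) w)).
  by apply/integrable_mull/value_at_integrable.
have is_ : P.-integrable setT (EFin \o (fun w =>
    \sum_i total_weight G j (inr i) * value_at G eps s (inr i) w)).
  exact: integrable_sumr.
have ib := integrable_cstr P (baseline j).
rewrite RintegralD //; last 2 first.
- exact: integrable_addr.
- exact: residual_integrable.
rewrite residual_mean0 addr0 RintegralD // Rintegral_cstr Rintegral_sum //.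
congr (_ + _); apply: eq_bigr => i _.
by rewrite RintegralZl -?mean_doE //; exact: value_at_integrable.
Qed.

Lemma total_weight_self j : total_weight G j (inr j) = 0.
Proof.
apply/eqP/negPn/negP => /(hidden_paths_total_weight G_adm)/(hidden_paths_connect G_adm)[_].
by rewrite ltnn.
Qed.

(** Identifies the weight of the edge from X_1, defined as a mean under an intervention, with a
    total path weight: forcing the other observed nodes to 0 leaves only the constant hidden source
    in the mean. *)
Lemma mean_do0_except j : mean_do G eps (do0_except R j) j = baseline j.
Proof.
have dj : do0_except R j j = None by rewrite /do0_except eqxx.
have d01 : unit_valued (do0_except R j).
  by move=> x r; rewrite /do0_except; case: ifP => // _ [<-]; rewrite lexx ler01.
rewrite mean_do_linear // big1 ?addr0 // => i _.
have [->|ij] := eqVneq i j; first by rewrite total_weight_self mul0r.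
by rewrite (@mean_do_Some _ i 0) ?mulr0 // /do0_except (negbTE ij).
Qed.

Local Notation G' := (transformed G eps).

Definition true_params : params G' :=
  fun x => \col_k transformed_weight G eps (enum_val k) (Some x).

Lemma sum_option (F : mnode X -> R) :
  \sum_z F z = F None + \sum_i F (Some i).
Proof.
rewrite (bigD1 None) //=; congr (_ + _).
rewrite (reindex_omap Some id) => [|[] //]; apply: eq_bigl => i.
by rewrite eqxx.
Qed.

Lemma dot_parents x (y t : mnode X -> R) :
  dot (\col_k t (enum_val k)) (parent_values G' y x) = \sum_(z in Pa G' x) t z * y z.
Proof.
by rewrite [RHS]big_enum_val dotE; apply: eq_bigr => k _; rewrite !mxE.
Qed.

Lemma transformed_weightE j z : transformed_weight G eps z (Some j) =
  if z is Some i then total_weight G j (inr i) else baseline j.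
Proof.
case: z => [i|] /=; first exact: hidden_paths_weight.
exact: mean_do0_except.
Qed.

(** The sum may run over all observed nodes, because those without a hidden path to [x] have total
    weight 0. *)
Lemma dot_true_params x (y : mnode X -> R) :
  dot (true_params x) (parent_values G' y x) =
    baseline x * y None + \sum_i total_weight G x (inr i) * y (Some i).
Proof.
rewrite (dot_parents x y (fun z => transformed_weight G eps z (Some x))).
rewrite big_mkcond sum_option /=; congr (_ + _).
  by rewrite inE /= mean_do0_except.
apply: eq_bigr => i _; rewrite inE /= hidden_paths_weight //.
case: ifPn => // /negPn/eqP hp.
suff -> : total_weight G x (inr i) = 0 by rewrite mul0r.
apply/eqP/negPn/negP => /(hidden_paths_total_weight G_adm).
by rewrite hp.
Qed.

Definition parent_vector s x (w : W) : 'cV[R]_#|Pa G' x| :=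
  parent_values G' (fun z => if z is Some i then value_at G eps s (inr i) w else 1) x.

Lemma value_at_regression s x w : s x = None ->
  value_at G eps s (inr x) w = dot (true_params x) (parent_vector s x w) + residual x w.
Proof. by move=> sx; rewrite value_at_decomposition // dot_true_params mulr1. Qed.

Definition mean_parents s x : 'cV[R]_#|Pa G' x| :=
  parent_values G' (fun z => if z is Some i then mean_do G eps s i else 1) x.

Lemma mean_do_regression s x : unit_valued s -> s x = None ->
  mean_do G eps s x = dot (true_params x) (mean_parents s x).
Proof. by move=> s01 sx; rewrite mean_do_linear // dot_true_params mulr1. Qed.

(** This score is the mean of [x] when the other observed nodes are forced to the indicator of [A],
    and such a mean lies in [0,1]. Hence the requirement on the binary noise is in force at the true
    parameters. *)
Lemma true_params_subset x (A : {set mnode X}) : None \in A ->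
  0 <= dot (true_params x) (parent_values G' (fun z => (z \in A)%:R) x) <= 1.
Proof.
move=> NA; pose s : intervention R X := fun i =>
  if i == x then None else Some (Some i \in A)%:R.
have sx : s x = None by rewrite /s eqxx.
have s01 : unit_valued s.
  by move=> i r; rewrite /s; case: ifP => // _ [<-]; case: (_ \in _); rewrite ?lexx ler01.
have := mean_do_01 x s01; rewrite mean_do_linear // dot_true_params NA mulr1.
suff -> : \sum_i total_weight G x (inr i) * mean_do G eps s i =
    \sum_i total_weight G x (inr i) * (Some i \in A)%:R by [].
apply: eq_bigr => i _; have [->|ix] := eqVneq i x.
  by rewrite total_weight_self !mul0r.
by rewrite (@mean_do_Some s i (Some i \in A)%:R) // /s (negbTE ix).
Qed.

Lemma baseline_ge0 x : 0 <= baseline x. Proof. exact: total_weight_ge0. Qed.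

Lemma true_params_ge0 x k : 0 <= true_params x k 0.
Proof.
rewrite mxE transformed_weightE; case: (enum_val k) => [i|].
  exact: total_weight_ge0.
exact: baseline_ge0.
Qed.

(** A single weight is at most the score of the set made of X_1 and that parent. *)
Lemma true_params_cube x : in_cube (true_params x).
Proof.
move=> k; rewrite true_params_ge0 /=.
have := @true_params_subset x [set None; enum_val k]%SET.
rewrite !inE eqxx => /(_ isT)/andP[_]; apply: le_trans.
rewrite dotE (bigD1 k) //= [X in _ * X]mxE !inE eqxx orbT mulr1 lerDl.
by apply: sumr_ge0 => l _; rewrite mulr_ge0 ?true_params_ge0 // mxE.
Qed.

Lemma parent_vector_01 s : unit_valued s -> {ae P, forall w, forall x k,
  0 <= parent_vector s x w k 0 <= 1}.
Proof.
move=> /value_at_01; apply: filterS => w v01 x k; rewrite mxE.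
by case: (enum_val k) => [i|]; [exact: v01 | rewrite lexx ler01].
Qed.

Lemma dot_true_params_01 x (v : 'cV[R]_#|Pa G' x|) :
  (forall k, 0 <= v k 0 <= 1) -> 0 <= dot (true_params x) v <= 1.
Proof.
move=> v01; rewrite dotE; apply/andP; split.
  by apply: sumr_ge0 => k _; rewrite mulr_ge0 ?true_params_ge0 //; have /andP[] := v01 k.
have /andP[_] := @true_params_subset x [set: mnode X]%SET (finset.in_setT _).
apply: le_trans; rewrite dotE; apply: ler_sum => k _.
rewrite ler_wpM2l ?true_params_ge0 // mxE finset.in_setT.
by have /andP[] := v01 k.
Qed.

(** The nodes whose noise can influence a parent of [x]; the parents are functions of this block of
    noises. *)
Definition ancestors_of_parents x : pred (node U X) := fun z =>
  [exists i, (hidden_paths G i x != [::]) && connect (edge G) z (inr i)].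

Lemma parent_vector_measurable_block s x k :
  measurable_fun [set: g_sigma_algebraType
      (block_events (fun v => eps v : W -> R) (ancestors_of_parents x))]
    (fun w => parent_vector s x w k 0).
Proof.
rewrite [X in measurable_fun _ X](_ : _ = fun w : W =>
    if enum_val k is Some i then value_at G eps s (inr i) w else 1); last first.
  by apply/funext => w; rewrite mxE.
case E : (enum_val k) => [i|]; last exact: measurable_cst.
have hp : hidden_paths G i x != [::].
  by have := enum_valP k; rewrite E inE.
pose J := ancestors_of_parents x.
apply: (@value_measurable _ (g_sigma_algebraType
      (block_events (fun v => eps v : W -> R) J)) (fun v => eps v : W -> R) s J).
- move=> z v ezv /existsP[l /andP[hl cl]]; apply/existsP; exists l.
  by rewrite hl /= (connect_trans _ cl) // connect1.
- by move=> v Jv; exact: measurable_block.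
- by apply/existsP; exists i; rewrite hp connect0.
Qed.

(** No noise with nonzero weight in the residual lies in the block: that of [x] by acyclicity, that
    of a hidden node by the exclusion of confounders. Each is centered and independent of the block,
    so the claim holds term by term. *)
Lemma residual_orthogonal x (c : R) (f : W -> R) :
  measurable_fun [set: g_sigma_algebraType
      (block_events (fun v => eps v : W -> R) (ancestors_of_parents x))] f ->
  (forall w, `|f w| <= c) ->
  P.-integrable setT (EFin \o (fun w => f w * residual x w)) /\
  \int[P]_w (f w * residual x w) = 0.
Proof.
move=> mf fc.
pose J := ancestors_of_parents x.
have meps v : measurable_fun setT (eps v : W -> R) by exact: measurable_funP.
have orth v : v != inl (u0 G) -> ~~ J v ->
    P.-integrable setT (EFin \o (fun w => f w * eps v w)) /\
    \int[P]_w (f w * eps v w) = 0.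
  move=> v0 Jv.
  have ind := @independent_block _ _ W R R P _ (fun v => eps v : W -> R) J v meps _ Jv.
  have Ev : (\int[P]_w (eps v w)%:E = 0)%E.
    by rewrite integrable_real ?eps_mean0 //; exact: eps_integrable.
  have [|i0 E0] := @integral_mul_independent_mean0 _ W R P _ (eps v) f c
      (@block_events_measurable _ _ W R _ (fun v => eps v : W -> R) J meps) _ mf fc
      (eps_integrable v0) Ev.
    by move=> A B; apply: ind; case: eps_adm.
  by split => //; rewrite /Rintegral E0.
have [ix Ex] : P.-integrable setT (EFin \o (fun w => f w * eps (inr x) w)) /\
    \int[P]_w (f w * eps (inr x) w) = 0.
  apply: orth => //; apply/existsP => -[i /andP[/(hidden_paths_connect G_adm)[_ rix]]].
  by move/(rank_connect G_acyclic); rewrite leqNgt rix.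
have term u : u != u0 G ->
    P.-integrable setT (EFin \o (fun w => f w * (total_weight G x (inl u) * eps (inl u) w))) /\
    \int[P]_w (f w * (total_weight G x (inl u) * eps (inl u) w)) = 0.
  (* A hidden node of total weight 0 may well lie in the block, but its term vanishes. *)
  move=> u0; have [tw0|tw0] := eqVneq (total_weight G x (inl u)) 0.
    have -> : (fun w => f w * (total_weight G x (inl u) * eps (inl u) w)) = fun=> 0.
      by apply/funext => w; rewrite tw0 mul0r mulr0.
    by split; [exact: integrable_cstr | exact: Rintegral_cstr].
  have [|iu Eu] := orth (inl u) u0.
    apply/existsP => -[i /andP[hp]]; apply/negP.
    exact: hidden_not_ancestor hp.
  have -> : (fun w => f w * (total_weight G x (inl u) * eps (inl u) w)) =
      fun w => total_weight G x (inl u) * (f w * eps (inl u) w).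
    by apply/funext => w; rewrite mulrCA.
  split; first exact: integrable_mull.
  by rewrite RintegralZl // Eu mulr0.
have E : (fun w => f w * residual x w) = fun w =>
    \sum_(u | u != u0 G) f w * (total_weight G x (inl u) * eps (inl u) w)
    + f w * eps (inr x) w.
  by apply/funext => w; rewrite /residual mulrDr mulr_sumr.
have it u : u != u0 G -> P.-integrable setT (EFin \o (fun w =>
    f w * (total_weight G x (inl u) * eps (inl u) w))).
  by case/term.
have is_ := @integrable_sumr _ W R P _ (index_enum U) _ _ it.
rewrite E; split; first exact: integrable_addr.
rewrite RintegralD // Ex addr0 Rintegral_sum // big1 // => u /term[].
by [].
Qed.

End hidden_linear_model.

(** * Clipping to [0,1] and the uniform law *)

Section clipping.
Variable R : realType.

Definition clip (r : R) : R := Num.min (Num.max r 0) 1.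

Lemma clip_01 r : 0 <= clip r <= 1.
Proof. by rewrite /clip le_min le_max lexx orbT ler01 /= ge_min lexx orbT. Qed.

Lemma clip_id r : 0 <= r <= 1 -> clip r = r.
Proof. by move=> /andP[r0 r1]; rewrite /clip (max_idPl r0) (min_idPl r1). Qed.

(** Clipping does not affect the comparison with a threshold in (0,1]. The threshold 0 must be
    excluded, since it is below every clipped level. *)
Lemma le_clip g r : 0 < g <= 1 -> (g <= clip r) = (g <= r).
Proof.
move=> /andP[g0 g1]; rewrite /clip le_min g1 andbT le_max.
by rewrite [g <= 0]leNgt g0 orbF.
Qed.

Lemma measurable_clip : measurable_fun [set: R] clip.
Proof. by apply: measurable_minr => //; exact: measurable_maxr. Qed.

Lemma uniform_prob_le (r : R) : 0 <= r <= 1 ->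
  uniform_prob (@ltr01 R) `]-oo, r] = r%:E.
Proof.
move=> /andP[r0 r1]; rewrite /uniform_prob integral_uniform_pdf.
have -> : `]-oo, r] `&` `[0, 1] = `[0, r]%classic :> set R.
  apply/seteqP; split=> x /=; rewrite !in_itv /=.
    by move=> [xr /andP[-> _]].
  by move=> /andP[-> xr]; rewrite xr (le_trans xr).
rewrite (eq_integral (fun=> 1%:E)) => [|x]; last first.
  rewrite inE /= in_itv /= /uniform_pdf => /andP[-> xr].
  by rewrite (le_trans xr r1) subr0 invr1.
rewrite integral_cst //= mul1e lebesgue_measure_itv /= lte_fin.
case: ltP => [_|r0']; first by rewrite -EFinB subr0.
by congr EFin; apply: le_anti; rewrite r0 r0'.
Qed.

End clipping.

(** * Binary models and their coupling by thinning *)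

Section binary_models.
Variables (R : realType) (X : finType) (G' : markov_model R X).
Hypothesis G'_acyclic : acyclic (medge G').
Implicit Types (v : mnode X) (x : option X).

Definition is_target (S : {set X}) x := if x is Some x' then x' \in S else false.

(** [h] transforms the activation level of each node: the identity gives back [binary_step], and
    [s x * clip r] the model with lowered levels. Running both on the same noise and thresholds is
    the coupling. *)
Definition activation_step (h : option X -> R -> R) (S : {set X})
    (theta : params G') (eps gam : option X -> R) (y : mnode X -> R) v : R :=
  if v is Some x then
    if is_target S x then 1
    else if gam x <= h x (dot (theta x) (parent_values G' y x) + eps x) then 1 else 0
  else 1.

Definition activation h S theta eps gam : mnode X -> R :=
  solve (activation_step h S theta eps gam) (fun=> 0).

Lemma parent_values_ext (y y' : mnode X -> R) x :
  (forall z, medge G' z (Some x) -> y z = y' z) ->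
  parent_values G' y x = parent_values G' y' x.
Proof.
move=> yy'; apply/colP => k; rewrite !mxE; apply: yy'.
by have := enum_valP k; rewrite inE.
Qed.

Lemma activationE h S theta eps gam v :
  activation h S theta eps gam v =
  activation_step h S theta eps gam (activation h S theta eps gam) v.
Proof.
apply: (solveE G'_acyclic) => y y' {}v yy'; rewrite /activation_step.
by case: v yy' => // x yy'; rewrite (parent_values_ext yy').
Qed.

Lemma activation01 h S theta eps gam v :
  activation h S theta eps gam v = 0 \/ activation h S theta eps gam v = 1.
Proof.
rewrite activationE; case: v => [x|] /=; last by right.
by case: ifP => _; [right | case: ifP => _; [right | left]].
Qed.

Lemma activation_unit h S theta eps gam v :
  0 <= activation h S theta eps gam v <= 1.
Proof. by case: (activation01 h S theta eps gam v) => ->; rewrite lexx ler01. Qed.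

Lemma binary_valueE S theta eps gam :
  binary_value S theta eps gam = activation (fun _ r => r) S theta eps gam.
Proof. by []. Qed.

Lemma activation_measurable d1 (Om : measurableType d1)
    (ep gm : option X -> Om -> R) h S theta (J : pred (mnode X)) :
  (forall z v, medge G' z v -> J v -> J z) ->
  (forall x, measurable_fun setT (h x)) ->
  (forall x, J (Some x) -> measurable_fun setT (ep x) /\ measurable_fun setT (gm x)) ->
  forall v, J v ->
    measurable_fun setT (fun w => activation h S theta (ep^~ w) (gm^~ w) v).
Proof.
move=> Jdown mh mJ; apply: iter_measurable Jdown _ => -[x|] Jv y my /=; last first.
  exact: measurable_cst.
case: (is_target S x); first exact: measurable_cst.
have [mep mgm] := mJ x Jv.
apply: measurable_fun_ifT; try exact: measurable_cst.
apply: measurable_fun_ler => //; apply: measurableT_comp; first exact: mh.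
apply: measurable_funD => //.
under eq_fun do rewrite dotE.
apply: measurable_sum => k; apply: measurable_funM; first exact: measurable_cst.
rewrite [X in measurable_fun _ X](_ : _ = y^~ (enum_val k)); last first.
  by apply/funext => w; rewrite mxE.
by apply: my; have := enum_valP k; rewrite inE.
Qed.

Section noise.
Context d (W : measurableType d) (P : probability W R).
Variables (beps : params G' -> option X -> {RV P >-> R})
          (gam : option X -> {RV P >-> R}).
Hypothesis noise_adm : admissible_binary_noise beps gam.
Variables (S : {set X}) (theta : params G').
Hypothesis theta01 : forall x, in_cube (theta x).
Variable s : option X -> R.
Hypothesis s01 : forall x, 0 <= s x <= 1.

Let noise (i : option X + option X) : W -> R :=
  match i with inl x => beps theta x : W -> R | inr x => gam x end.

Let noise_measurable i : measurable_fun setT (noise i).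
Proof. by case: i => x; exact: measurable_funP. Qed.

Let noise_indep : mutually_independent P noise.
Proof. by case: noise_adm => _ ind _ _; exact: ind. Qed.

Definition thin (w : W) : mnode X -> R :=
  activation (fun x r => s x * clip r) S theta (fun x => beps theta x w) (fun x => gam x w).

Definition score x (w : W) : R := dot (theta x) (parent_values G' (thin w) x).

(** The activation probability of [x], before scaling by [s x], given its noise and the thinned
    values of its parents. *)
Definition chance x (w : W) : R := clip (score x w + beps theta x w).

Let J x : pred (mnode X) := fun v => connect (medge G') v (Some x) && (v != Some x).

Let Jnoise x : pred (option X + option X) := fun i =>
  match i with inl x' | inr x' => J x (Some x') end.

Let score_measurable_block x (K : pred (option X + option X)) :
  (forall i, Jnoise x i -> K i) ->
  measurable_fun [set: g_sigma_algebraType (block_events noise K)] (score x).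
Proof.
move=> JK; rewrite /score.
rewrite [X in measurable_fun _ X](_ : _ = fun w : W =>
    \sum_k theta x k 0 * thin w (enum_val k)); last first.
  by apply/funext => w; rewrite dotE; apply: eq_bigr => k _; rewrite mxE.
apply: measurable_sum => k; apply: measurable_funM; first exact: measurable_cst.
apply: (@activation_measurable _ (g_sigma_algebraType (block_events noise K))
  (fun x => noise (inl x)) (fun x => noise (inr x)) _ S theta (J x)).
- move=> z v ezv /andP[cv vx]; apply/andP; split.
    exact: connect_trans (connect1 ezv) cv.
  apply: contraTneq ezv => ->; apply/negP => exv.
  by have := acyclicN_connect G'_acyclic exv; rewrite cv.
- by move=> x'; apply: measurable_funM => //; exact: measurable_clip.
- by move=> x' Jx'; split; apply: measurable_block; exact: JK.
- have : medge G' (enum_val k) (Some x) by have := enum_valP k; rewrite inE.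
  move=> ek; rewrite /J connect1 //=; apply: contraTneq ek => ->; apply/negP => exx.
  by have := acyclicN_connect G'_acyclic exx; rewrite connect0.
Qed.

Let block_down K : block_events noise K `<=` measurable.
Proof. exact: block_events_measurable. Qed.

Let measurable_of_block (K : pred (option X + option X)) (f : W -> R) :
  measurable_fun [set: g_sigma_algebraType (block_events noise K)] f ->
  measurable_fun [set: W] f.
Proof.
move=> mf _ B mB; have := mf measurableT B mB; rewrite !setTI; apply.
by split; [exact: sigma_algebra_measurable | exact: block_down].
Qed.

Lemma thin_measurable v : measurable_fun setT (thin ^~ v).
Proof.
apply: (@activation_measurable _ W (fun x => noise (inl x)) (fun x => noise (inr x))
  _ S theta xpredT) => //.
by move=> x'; apply: measurable_funM => //; exact: measurable_clip.
Qed.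

(** All that determines [chance x]: the noises and thresholds of strict ancestors and the noise of
    [x], but not the threshold of [x], which is therefore independent of this block. *)
Let K1 x : pred (option X + option X) := fun i => (i == inl x) || Jnoise x i.

Let chance_measurable_block x :
  measurable_fun [set: g_sigma_algebraType (block_events noise (K1 x))] (chance x).
Proof.
apply: measurableT_comp; first exact: measurable_clip.
apply: measurable_funD.
  by apply: score_measurable_block => i Ji; rewrite /K1 Ji orbT.
by apply: (@measurable_block _ _ W R _ noise (K1 x) (inl x)); rewrite /K1 eqxx.
Qed.

Lemma score_measurable x : measurable_fun setT (score x).
Proof. exact: measurable_of_block (@score_measurable_block x (Jnoise x) _). Qed.

Lemma chance_measurable x : measurable_fun setT (chance x).
Proof. exact: (@measurable_of_block (K1 x) (chance x) (@chance_measurable_block x)). Qed.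

Lemma chance_01 x w : 0 <= chance x w <= 1. Proof. exact: clip_01. Qed.

Lemma chance_integrable x : P.-integrable setT (EFin \o chance x).
Proof.
apply: (@integrable_bounded _ _ _ _ _ 1); first exact: chance_measurable.
by apply: aeW => w; have /andP[c0 c1] := chance_01 x w; rewrite ger0_norm.
Qed.

Definition below x (c : R) (w : W) : R := if gam x w <= c * chance x w then 1 else 0.

Lemma below_measurable x c : measurable_fun setT (below x c).
Proof.
apply: measurable_fun_ifT; try exact: measurable_cst.
apply: measurable_fun_ler; first exact: measurable_funP.
by apply: measurable_funM; [exact: measurable_cst | exact: chance_measurable].
Qed.

Lemma below_integrable x c : P.-integrable setT (EFin \o below x c).
Proof.
apply: (@integrable_bounded _ _ _ _ _ 1); first exact: below_measurable.
by apply: aeW => w; rewrite /below; case: ifP; rewrite ?normr1 ?normr0.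
Qed.

(** The threshold is uniform and independent of [chance x], so with the block frozen the event has
    probability [c * chance x]. *)
Lemma integral_below x (c : R) : 0 <= c <= 1 ->
  \int[P]_w below x c w = c * \int[P]_w chance x w.
Proof.
move=> /andP[c0 c1]; rewrite -RintegralZl //; last exact: chance_integrable.
congr fine; pose F (z : g_sigma_algebraType (block_events noise (K1 x)) * R) : \bar R :=
  (if z.2 <= c * chance x z.1 then 1 else 0)%:E.
have gamU B : measurable B -> P (gam x @^-1` B) = uniform_prob (@ltr01 R) B.
  by case: noise_adm => gU _ _ _; exact: gU.
have ind : forall A B, <<s block_events noise (K1 x) >> A -> measurable B ->
    (P (A `&` gam x @^-1` B) = P A * distribution P (gam x) B)%E.
  move=> A B sA mB.
  apply: (@independent_block _ _ W R R P _ noise (K1 x) (inr x)) => //.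
  by rewrite /K1 /= /J connect0 eqxx.
have mF : measurable_fun setT F.
  apply/measurable_EFinP; apply: measurable_fun_ifT; try exact: measurable_cst.
  apply: measurable_fun_ler => //.
  apply: measurable_funM; first exact: measurable_cst.
  by apply: (measurableT_comp (@chance_measurable_block x) measurable_fst).
have F0 z : (0 <= F z)%E by rewrite /F; case: ifP; rewrite lee_fin.
have := @independent_fubini _ _ W R R P (distribution P (gam x)) _ (gam x)
  (noise_measurable (inr x)) (@block_down (K1 x)) ind F mF F0.
rewrite /F /= => ->; apply: eq_integral => w _.
have /andP[q0 q1] := chance_01 x w.
rewrite -(@uniform_prob_le R (c * chance x w)); last first.
  by rewrite mulr_ge0 //= mulr_ile1.
rewrite -gamU // -[RHS]/(distribution P (gam x) _) -[X in _ = distribution _ _ X]setIT.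
rewrite -integral_indic //; apply: eq_integral => g _.
by rewrite indicE mem_setE in_itv /=; case: ifP.
Qed.

Lemma thin_integrable v : P.-integrable setT (EFin \o (thin ^~ v)).
Proof.
apply: (@integrable_bounded _ _ _ _ _ 1); first exact: thin_measurable.
by apply: aeW => w; have /andP[c0 c1] :=
    activation_unit (fun x r => s x * clip r) S theta (fun x => beps theta x w) (fun x => gam x w) v;
  rewrite ger0_norm.
Qed.

Definition mean_thin v : R := \int[P]_w thin w v.

Lemma thinE x w : ~~ is_target S x -> thin w (Some x) = below x (s x) w.
Proof. by move=> Sx; rewrite /thin activationE /= (negbTE Sx). Qed.

Lemma mean_thin_chance x : ~~ is_target S x ->
  mean_thin (Some x) = s x * \int[P]_w chance x w.
Proof.
by move=> Sx; rewrite -integral_below //; congr fine; apply: eq_integral => w _; rewrite thinE.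
Qed.

Lemma mean_thin_fixed v : (if v is Some x then is_target S x else true) ->
  mean_thin v = 1.
Proof.
move=> Sv; rewrite -[RHS](Rintegral_cstr P); congr fine; apply: eq_integral => w _.
by rewrite /thin activationE; case: v Sv => //= x ->.
Qed.

Lemma mean_score x : \int[P]_w score x w = dot (theta x) (parent_values G' mean_thin x).
Proof.
rewrite dotE; under eq_Rintegral do rewrite /score dotE.
rewrite Rintegral_sum => [|k _]; last first.
  apply: integrable_mull; apply: eq_integrable (thin_integrable (enum_val k)) => //.
  by move=> w _ /=; rewrite mxE.
apply: eq_bigr => k _; rewrite mxE -RintegralZl //; last exact: thin_integrable.
by congr fine; apply: eq_integral => w _; rewrite mxE.
Qed.

Definition active (w : W) : {set mnode X} := [set v | thin w v == 1]%SET.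

Definition set_score x (A : {set mnode X}) : R :=
  dot (theta x) (parent_values G' (fun z => (z \in A)%:R) x).

Lemma score_active x w : score x w = set_score x (active w).
Proof.
congr dot; apply: parent_values_ext => z _; rewrite inE.
by case: (activation01 (fun x r => s x * clip r) S theta
  (fun x => beps theta x w) (fun x => gam x w) z); rewrite /thin => ->;
  rewrite ?eqxx // eq_sym oner_eq0.
Qed.

Lemma None_active w : None \in active w.
Proof. by rewrite inE /thin activationE. Qed.

(** When the score is at most 1 the noise keeps the level in [0,1], so clipping is invisible and the
    noise averages out. A larger score exceeds every clipped value. *)
Let clip_mean x (A : {set mnode X}) : None \in A ->
  \int[P]_w clip (set_score x A + beps theta x w) <= set_score x A /\
  (set_score x A <= 1 ->
   \int[P]_w clip (set_score x A + beps theta x w) = set_score x A).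
Proof.
move=> NA; case: noise_adm => _ _ zm eps01.
have [[ie Ee] _] := zm theta theta01 x.
have mc : measurable_fun setT (fun w => clip (set_score x A + beps theta x w)).
  apply: measurableT_comp; first exact: measurable_clip.
  by apply: measurable_funD => //; exact: measurable_cst.
have small : set_score x A <= 1 ->
   \int[P]_w clip (set_score x A + beps theta x w) = set_score x A.
  move=> m1; transitivity (\int[P]_w (set_score x A + beps theta x w)).
    apply: ae_eq_Rintegral => //.
      by apply: measurable_funD => //; exact: measurable_cst.
    apply: filterS (eps01 theta theta01 x A NA m1) => w.
    exact: clip_id.
  rewrite RintegralD //; last exact: integrable_cstr.
  rewrite Rintegral_cstr.
  by move: Ee; rewrite unlock /Rintegral => ->; rewrite addr0.
split=> //; have [/small -> //|m1] := leP (set_score x A) 1.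
apply: le_trans (ltW m1); rewrite -[leRHS](Rintegral_cstr P).
apply: le_Rintegral => //.
- apply: (@integrable_bounded _ _ _ _ _ 1) => //.
  by apply: aeW => w; have /andP[c0 c1] :=
    clip_01 (set_score x A + beps theta x w); rewrite ger0_norm.
- exact: integrable_cstr.
- by move=> w _; have /andP[] := clip_01 (set_score x A + beps theta x w).
Qed.

Lemma score_integrable x : P.-integrable setT (EFin \o score x).
Proof.
have -> : EFin \o score x = EFin \o (fun w => \sum_k theta x k 0 * thin w (enum_val k)).
  by apply/funext => w /=; rewrite /score dotE; congr EFin; apply: eq_bigr => k _; rewrite mxE.
by apply: integrable_sumr => k _; apply/integrable_mull/thin_integrable.
Qed.

(** The noise of [x] is independent of the values of its parents and may be integrated with these
    frozen. *)
Let mean_chance_fubini x : (\int[P]_w (chance x w)%:E =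
  \int[P]_w (\int[P]_w' clip (set_score x (active w) + beps theta x w'))%:E)%E.
Proof.
pose F (z : g_sigma_algebraType (block_events noise (Jnoise x)) * R) : \bar R :=
  (clip (score x z.1 + z.2))%:E.
have ind : forall A B, <<s block_events noise (Jnoise x) >> A -> measurable B ->
    (P (A `&` beps theta x @^-1` B) = P A * distribution P (beps theta x) B)%E.
  move=> A B sA mB.
  apply: (@independent_block _ _ W R R P _ noise (Jnoise x) (inl x)) => //.
  by rewrite /= /J connect0 eqxx.
have mF : measurable_fun setT F.
  apply/measurable_EFinP; apply: measurableT_comp; first exact: measurable_clip.
  apply: measurable_funD => //.
  by apply: (measurableT_comp (score_measurable_block _) measurable_fst).
have F0 z : (0 <= F z)%E by rewrite lee_fin; have /andP[] := clip_01 (score x z.1 + z.2).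
have := @independent_fubini _ _ W R R P (distribution P (beps theta x)) _ (beps theta x)
  (noise_measurable (inl x)) (@block_down (Jnoise x)) ind F mF F0.
rewrite /F /= => ->; apply: eq_integral => w _.
rewrite ge0_integral_distribution //=; last 2 first.
- apply/measurable_EFinP; apply: measurableT_comp; first exact: measurable_clip.
  by apply: measurable_funD => //; exact: measurable_cst.
- by move=> y; rewrite lee_fin; have /andP[] := clip_01 (score x w + y).
rewrite -score_active -integrable_real //.
apply: (@integrable_bounded _ _ _ _ _ 1).
  apply: measurableT_comp; first exact: measurable_clip.
  by apply: measurable_funD => //; exact: measurable_cst.
by apply: aeW => w'; have /andP[c0 c1] :=
    clip_01 (score x w + beps theta x w'); rewrite ger0_norm.
Qed.

(** The indicator of [active w = A] is a polynomial in the 0/1 values of the nodes. *)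
Let active_fun_measurable (k : {set mnode X} -> R) :
  measurable_fun setT (fun w => k (active w)).
Proof.
have thin01 w v : thin w v = (v \in active w)%:R.
  rewrite inE; case: (activation01 (fun x r => s x * clip r) S theta
    (fun x => beps theta x w) (fun x => gam x w) v); rewrite /thin => ->.
    by rewrite eq_sym oner_eq0.
  by rewrite eqxx.
rewrite [X in measurable_fun _ X](_ : _ = fun w =>
    \sum_A k A * \prod_v (if v \in A then thin w v else 1 - thin w v)).
  apply: measurable_sum => A; apply: measurable_funM; first exact: measurable_cst.
  apply: measurable_prod => v _; case: (v \in A); first exact: thin_measurable.
  by apply: measurable_funB; [exact: measurable_cst | exact: thin_measurable].
apply/funext => w; rewrite (bigD1 (active w)) //= big1 => [|v _]; last first.
  by rewrite thin01; case: (v \in active w); rewrite ?subr0.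
rewrite mulr1 big1 ?addr0 // => A; rewrite finset.eqEsubset negb_and => AN.
suff [v vA] : exists v, (v \in A) != (v \in active w).
  rewrite (bigD1 v) //= thin01; move: vA.
  by case: (v \in A); case: (v \in active w) => //; rewrite ?subrr mul0r mulr0.
case/orP: AN => /fintype.subsetPn[v v1 v2]; exists v; first by rewrite v1 (negbTE v2).
by rewrite v1 (negbTE v2).
Qed.

Lemma mean_chance_le x : \int[P]_w chance x w <=
  dot (theta x) (parent_values G' mean_thin x).
Proof.
rewrite -mean_score -lee_fin -!integrable_real; last 2 first.
- exact: score_integrable.
- exact: chance_integrable.
rewrite mean_chance_fubini; apply: ge0_le_integral => //.
- by move=> w _; rewrite lee_fin Rintegral_ge0 // => w' _;
  have /andP[] := clip_01 (set_score x (active w) + beps theta x w').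
- apply/measurable_EFinP.
  exact: (active_fun_measurable (fun A => \int[P]_w' clip (set_score x A + beps theta x w'))).
- exact/measurable_EFinP/score_measurable.
- by move=> w _; rewrite lee_fin score_active; have [] := clip_mean x (None_active w).
Qed.

Lemma mean_chance_eq x : (forall A : {set mnode X}, None \in A -> set_score x A <= 1) ->
  \int[P]_w chance x w = dot (theta x) (parent_values G' mean_thin x).
Proof.
move=> m1; rewrite -mean_score; congr fine; rewrite mean_chance_fubini.
apply: eq_integral => w _; congr EFin; rewrite score_active.
by have [_] := clip_mean x (None_active w); apply; exact/m1/None_active.
Qed.

(** Indicates that the threshold of [x] falls between the scaled and the unscaled level, both
    computed from the thinned values of the parents. *)
Definition bad x (w : W) : R := below x 1 w - below x (s x) w.

Lemma integral_bad x : \int[P]_w bad x w = (1 - s x) * \int[P]_w chance x w.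
Proof.
rewrite /bad RintegralB //; try exact: below_integrable.
by rewrite !integral_below ?ler01 ?lexx // mulrBl.
Qed.

Lemma bad_ge0 x w : 0 <= bad x w.
Proof.
have /andP[s0 s1] := s01 x; have /andP[q0 q1] := chance_01 x w.
rewrite /bad /below mul1r subr_ge0; case: ifP => [g|_]; last by case: ifP; rewrite ?ler01 ?lexx.
by rewrite (le_trans g) // ler_piMl.
Qed.

Lemma gam_unit : {ae P, forall w, forall x, 0 < gam x w <= 1}.
Proof.
apply: filter_forall => x; case: noise_adm => gU _ _ _.
have U0 : P (gam x @^-1` `]-oo, 0]) = 0%E by rewrite gU // uniform_prob_le ?lexx ?ler01.
have U1 : P (~` (gam x @^-1` `]-oo, 1])) = 0%E.
  rewrite probability_setC; last by rewrite -[X in measurable X]setTI; exact: measurable_funP.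
  by rewrite gU // uniform_prob_le ?lexx ?ler01 // subee.
have m (B : set R) : measurable B -> measurable (gam x @^-1` B).
  by move=> mB; rewrite -[X in measurable X]setTI; exact: measurable_funP.
have ae0 : {ae P, forall w, ~ (gam x @^-1` `]-oo, 0]) w}.
  by exists (gam x @^-1` `]-oo, 0]); split => // [|w /= /contrapT]; [exact: m|].
have ae1 : {ae P, forall w, (gam x @^-1` `]-oo, 1]) w}.
  by exists (~` (gam x @^-1` `]-oo, 1])); split => //; apply: measurableC; exact: m.
apply: filterS2 ae0 ae1 => w /=; rewrite !in_itv /= => /negP.
by rewrite -ltNge => -> ->.
Qed.

Definition full (w : W) : mnode X -> R :=
  binary_value S theta (fun x => beps theta x w) (fun x => gam x w).

Lemma full_thin w : (forall x, 0 < gam x w <= 1) ->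
  (forall x, ~~ is_target S x -> bad x w = 0) -> full w =1 thin w.
Proof.
move=> g01 nobad v; have [n] := ubnP (rank (medge G') v).
elim: n v => // n IHn v vn; rewrite /full binary_valueE activationE /thin activationE.
case: v vn => [x|] //= vn; case: ifPn => // Sx.
have -> : parent_values G' (activation (fun _ r => r) S theta
    (fun x => beps theta x w) (fun x => gam x w)) x = parent_values G' (thin w) x.
  apply: parent_values_ext => z ezx; apply: IHn.
  by rewrite (leq_trans (rank_edge G'_acyclic ezx)).
rewrite -/(score x w) -/(thin w) -/(score x w) -/(chance x w).
rewrite -le_clip // -/(chance x w) -{1}[chance x w]mul1r.
by apply/eqP; rewrite -subr_eq0; apply/eqP; exact: nobad.
Qed.

(** Either no node is bad and the models coincide, or one bad node already contributes 1, the
    largest value that [full] can take. *)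
Lemma full_le w v : (forall x, 0 < gam x w <= 1) ->
  full w v <= thin w v + \sum_(x | ~~ is_target S x) bad x w.
Proof.
move=> g01; have [nobad|] := pselect (forall x, ~~ is_target S x -> bad x w = 0).
  by rewrite full_thin // lerDl sumr_ge0 // => x _; exact: bad_ge0.
move=> /existsNP[x /not_implyP[Sx bx]].
have b1 : 1 <= bad x w.
  move: bx; have := bad_ge0 x w; rewrite /bad /below.
  by case: ifP => _; case: ifP => _; rewrite ?subrr ?subr0 // sub0r oppr_ge0 ler10.
have t0 : 0 <= thin w v by have /andP[] :=
  activation_unit (fun x r => s x * clip r) S theta (fun x => beps theta x w) (fun x => gam x w) v.
have /andP[_ f1] :=
  activation_unit (fun _ r => r) S theta (fun x => beps theta x w) (fun x => gam x w) v.
apply: le_trans f1 _; rewrite (bigD1 x) //=.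
have : 0 <= \sum_(i | ~~ is_target S i && (i != x)) bad i w.
  by apply: sumr_ge0 => i _; exact: bad_ge0.
by move: b1 t0; lra.
Qed.

Lemma full_integrable v : P.-integrable setT (EFin \o (full ^~ v)).
Proof.
apply: (@integrable_bounded _ _ _ _ _ 1).
  by apply: (@activation_measurable _ W (fun x => noise (inl x)) (fun x => noise (inr x))
    (fun _ r => r) S theta xpredT).
by apply: aeW => w; have /andP[c0 c1] :=
    activation_unit (fun _ r => r) S theta (fun x => beps theta x w) (fun x => gam x w) v;
  rewrite ger0_norm.
Qed.

Lemma sigmaE : sigma beps gam S theta = \int[P]_w full w (Some None).
Proof. by rewrite /sigma unlock. Qed.

Lemma sigma_le_thin : sigma beps gam S theta <= mean_thin (Some None) +
  \sum_(x | ~~ is_target S x) (1 - s x) * dot (theta x) (parent_values G' mean_thin x).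
Proof.
have ib x : P.-integrable setT (EFin \o bad x).
  have := integrable_addr (below_integrable x 1) (integrable_mull (-1) (below_integrable x (s x))).
  by apply: eq_integrable => // w _ /=; rewrite mulN1r.
have is_ := @integrable_sumr _ W R P _ (index_enum _)
  (fun x => ~~ is_target S x) bad (fun x _ => ib x).
have it := thin_integrable (Some None).
rewrite sigmaE; apply: le_trans (_ : \int[P]_w (thin w (Some None) +
    \sum_(x | ~~ is_target S x) bad x w) <= _).
  apply: ae_le_Rintegral; first exact: full_integrable.
    exact: integrable_addr.
  by apply: filterS gam_unit => w; exact: full_le.
rewrite RintegralD // Rintegral_sum // lerD2l; apply: ler_sum => x _.
rewrite integral_bad ler_wpM2l ?mean_chance_le // subr_ge0.
by have /andP[] := s01 x.
Qed.

Lemma sigma_eq_thin : (forall x, s x = 1) ->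
  sigma beps gam S theta = mean_thin (Some None).
Proof.
move=> s1; rewrite sigmaE; apply: ae_eq_Rintegral.
- exact/integrable_measurable/full_integrable.
- exact: thin_measurable.
- apply: filterS gam_unit => w g01; apply: full_thin => // x _.
  by rewrite /bad s1 subrr.
Qed.

End noise.

(** * The mean of the binary model against prescribed means [b] *)

Section comparison.
Context d (W : measurableType d) (P : probability W R).
Variables (beps : params G' -> option X -> {RV P >-> R})
          (gam : option X -> {RV P >-> R}).
Hypothesis noise_adm : admissible_binary_noise beps gam.
Variables (S : {set X}) (theta : params G').
Hypothesis theta01 : forall x, in_cube (theta x).
Variable b : mnode X -> R.
Hypothesis b_None : b None = 1.
Hypothesis b_target : forall x, is_target S x -> b (Some x) = 1.

Lemma dot_parent_values_le x (y y' : mnode X -> R) :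
  (forall z, medge G' z (Some x) -> y z <= y' z) ->
  dot (theta x) (parent_values G' y x) <= dot (theta x) (parent_values G' y' x).
Proof.
move=> yy'; rewrite !dotE; apply: ler_sum => k _; rewrite !mxE.
have /andP[t0 _] := @theta01 x k; rewrite ler_wpM2l // yy' //.
by have := enum_valP k; rewrite inE.
Qed.

(* Where [theta] overestimates the mean [b] of a node, the thresholds are
   scaled down by [s] until the mean is at most [b]; thinning costs exactly the
   overestimate. *)
Lemma sigma_le_overestimate : (forall v, 0 <= b v) ->
  sigma beps gam S theta <= b (Some None) +
    \sum_(x | ~~ is_target S x)
      Num.max 0 (dot (theta x) (parent_values G' b x) - b (Some x)).
Proof.
move=> b0; pose p x := dot (theta x) (parent_values G' b x).
pose s x := if p x <= b (Some x) then 1 else b (Some x) / p x.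
have p_gt0 x : ~~ (p x <= b (Some x)) -> 0 < p x.
  by rewrite -ltNge; exact: le_lt_trans.
have s01 x : 0 <= s x <= 1.
  rewrite /s; case: ifPn => [_|px]; first by rewrite ler01 lexx.
  by rewrite divr_ge0 ?(ltW (p_gt0 x px)) //= ler_pdivrMr ?p_gt0 // mul1r ltW // ltNge.
have sp x : s x * p x <= b (Some x).
  rewrite /s; case: ifPn => [|px]; first by rewrite mul1r.
  by rewrite divfK // gt_eqF // p_gt0.
(* Induction on the rank: nonnegative parameters make the score monotone in the parents, so the mean
   score is at most [p x], and [sp] concludes. *)
have mean_le v : mean_thin beps gam S theta s v <= b v.
  have [n] := ubnP (rank (medge G') v); elim: n v => // n IHn [x|] vn; last first.
    by rewrite mean_thin_fixed // b_None.
  have [Sx|Sx] := boolP (is_target S x); first by rewrite mean_thin_fixed // b_target.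
  have /andP[s0 s1] := s01 x.
  rewrite (mean_thin_chance noise_adm theta01 s01 Sx).
  apply: le_trans (sp x); apply: ler_wpM2l => //.
  apply: le_trans; first by apply: mean_chance_le.
  apply: dot_parent_values_le => z ezx; apply: IHn.
  by rewrite (leq_trans (rank_edge G'_acyclic ezx)).
apply: le_trans; first by apply: (@sigma_le_thin _ W P beps gam noise_adm S theta theta01 s s01).
apply: lerD; first exact: mean_le.
apply: ler_sum => x _; have /andP[s0 s1] := s01 x.
apply: le_trans (_ : (1 - s x) * p x <= _).
  by rewrite ler_wpM2l ?subr_ge0 //; apply: dot_parent_values_le => z _; exact: mean_le.
rewrite /s -/(p x) le_max; case: ifPn => [_|px]; first by rewrite subrr mul0r lexx.
by rewrite mulrBl mul1r divfK ?lexx ?orbT // gt_eqF // p_gt0.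
Qed.

(** With scale 1 nothing is thinned, and scores at most 1 make the mean of a node linear in the
    means of its parents: the recursion that [b] satisfies. *)
Lemma sigma_eq_mean :
  (forall x (A : {set mnode X}), None \in A ->
     dot (theta x) (parent_values G' (fun z => (z \in A)%:R) x) <= 1) ->
  (forall x, ~~ is_target S x -> b (Some x) = dot (theta x) (parent_values G' b x)) ->
  sigma beps gam S theta = b (Some None).
Proof.
move=> m1 b_eq; pose s (_ : option X) : R := 1.
have s01 x : 0 <= s x <= 1 by rewrite /s ler01 lexx.
have -> : sigma beps gam S theta = mean_thin beps gam S theta s (Some None).
  by apply: sigma_eq_thin.
suff mean_eq v : mean_thin beps gam S theta s v = b v by [].
have [n] := ubnP (rank (medge G') v); elim: n v => // n IHn [x|] vn; last first.
  by rewrite mean_thin_fixed // b_None.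
have [Sx|Sx] := boolP (is_target S x); first by rewrite mean_thin_fixed // b_target.
rewrite (mean_thin_chance noise_adm theta01 s01 Sx) /s mul1r.
rewrite b_eq //; transitivity (dot (theta x) (parent_values G' (mean_thin beps gam S theta s) x)).
  by apply: mean_chance_eq => // A NA; exact: m1.
congr dot.
apply: parent_values_ext => z ezx; apply: IHn.
by rewrite (leq_trans (rank_edge G'_acyclic ezx)).
Qed.

End comparison.
End binary_models.

(** * Measurability of matrix-valued functions *)

Section measurable_matrices.
Context d (T : measurableType d) (R : realType).

Definition mxmeasurable m n (M : T -> 'M[R]_(m, n)) : Prop :=
  forall i j, measurable_fun setT (fun w => M w i j).

Lemma mxmeasurable_cst m n (A : 'M[R]_(m, n)) : mxmeasurable (fun=> A).
Proof. by move=> i j; exact: measurable_cst. Qed.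

Lemma mxmeasurableD m n (A B : T -> 'M[R]_(m, n)) :
  mxmeasurable A -> mxmeasurable B -> mxmeasurable (fun w => A w + B w).
Proof.
move=> mA mB i j; under eq_fun do rewrite mxE.
exact: measurable_funD.
Qed.

Lemma mxmeasurableN m n (A : T -> 'M[R]_(m, n)) :
  mxmeasurable A -> mxmeasurable (fun w => - A w).
Proof.
move=> mA i j; under eq_fun do rewrite mxE.
exact: measurable_funN.
Qed.

Lemma mxmeasurableM m n p (A : T -> 'M[R]_(m, n)) (B : T -> 'M[R]_(n, p)) :
  mxmeasurable A -> mxmeasurable B -> mxmeasurable (fun w => A w *m B w).
Proof.
move=> mA mB i j; under eq_fun do rewrite mxE.
by apply: measurable_sum => k; exact: measurable_funM.
Qed.

Lemma mxmeasurable_tr m n (A : T -> 'M[R]_(m, n)) :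
  mxmeasurable A -> mxmeasurable (fun w => (A w)^T).
Proof.
by move=> mA i j; under eq_fun do rewrite mxE; exact: mA.
Qed.

Lemma mxmeasurableZ m n (f : T -> R) (A : T -> 'M[R]_(m, n)) :
  measurable_fun setT f -> mxmeasurable A -> mxmeasurable (fun w => f w *: A w).
Proof.
move=> mf mA i j; under eq_fun do rewrite mxE.
exact: measurable_funM.
Qed.

Lemma measurable_dot n (a b : T -> 'cV[R]_n) :
  mxmeasurable a -> mxmeasurable b -> measurable_fun setT (fun w => dot (a w) (b w)).
Proof.
move=> ma mb; under eq_fun do rewrite dotE.
by apply: measurable_sum => k; exact: measurable_funM.
Qed.

Lemma measurable_det n (A : T -> 'M[R]_n) :
  mxmeasurable A -> measurable_fun setT (fun w => \det (A w)).
Proof.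
move=> mA; rewrite /determinant; apply: measurable_sum => s.
apply: measurable_funM; first exact: measurable_cst.
by apply: measurable_prod => i _; exact: mA.
Qed.

Lemma mxmeasurable_adj n (A : T -> 'M[R]_n) :
  mxmeasurable A -> mxmeasurable (fun w => \adj (A w)).
Proof.
move=> mA i j; under eq_fun do rewrite mxE.
rewrite /cofactor; apply: measurable_funM; first exact: measurable_cst.
apply: measurable_det => k l; under eq_fun do rewrite !mxE.
exact: mA.
Qed.

Lemma measurable_inv_pos (f : T -> R) : (forall w, 0 < f w) ->
  measurable_fun setT f -> measurable_fun setT (fun w => (f w)^-1).
Proof.
move=> f0 mf; rewrite (_ : (fun w => _) = fun w => expR (- ln (f w))); last first.
  by apply/funext => w; rewrite expRN lnK // posrE.
apply: measurableT_comp => //; apply: measurable_funN.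
by apply: measurableT_comp => //; exact: measurable_ln.
Qed.

Lemma measurable_sqrt_comp (f : T -> R) : measurable_fun setT f ->
  measurable_fun setT (fun w => Num.sqrt (f w)).
Proof.
move=> mf; apply: measurableT_comp => //.
by apply: continuous_measurable_fun; exact: sqrt_continuous.
Qed.

Lemma posdef_det_gt0 n (A : 'M[R]_n) : posdef A -> 0 < \det A.
Proof. by move=> /posdef_det/andP[]. Qed.

Lemma mxmeasurable_invmx n (A : T -> 'M[R]_n) : (forall w, posdef (A w)) ->
  mxmeasurable A -> mxmeasurable (fun w => invmx (A w)).
Proof.
move=> pA mA; rewrite (_ : (fun w => _) = fun w => (\det (A w))^-1 *: \adj (A w)).
  apply: mxmeasurableZ; last exact: mxmeasurable_adj.
  apply: measurable_inv_pos; last exact: measurable_det.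
  by move=> w; exact: posdef_det_gt0.
by apply/funext => w; rewrite /invmx posdef_unitmx.
Qed.

Lemma measurable_mixture n (A : T -> 'M[R]_n) (s : T -> 'cV[R]_n) :
  (forall w, posdef (A w)) -> mxmeasurable A -> mxmeasurable s ->
  measurable_fun setT (fun w => mixture (A w) (s w)).
Proof.
move=> pA mA ms; rewrite /mixture; apply: measurable_funM.
  apply: measurableT_comp => //; apply: measurable_funM; last exact: measurable_cst.
  by apply: measurable_dot => //; apply: mxmeasurableM => //; exact: mxmeasurable_invmx.
apply: measurable_inv_pos; first by move=> w; rewrite sqrtr_gt0 posdef_det_gt0.
by apply: measurable_sqrt_comp; exact: measurable_det.
Qed.

(** Lets the random set played in a round be treated as a constant, one case for each value. *)
Lemma measurable_fin_comp (I : finType) (f : T -> I) (F : I -> T -> R) :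
  (forall i, measurable [set w | f w = i]) ->
  (forall i, measurable_fun setT (F i)) ->
  measurable_fun setT (fun w => F (f w) w).
Proof.
move=> mf mF; rewrite (_ : (fun w => _) = fun w => \sum_i (if f w == i then F i w else 0)).
  apply: measurable_sum => i; apply: measurable_fun_ifT => //.
  apply: (measurable_fun_bool true); rewrite setTI.
  by rewrite (_ : _ @^-1` _ = [set w | f w = i]) //; apply/seteqP; split=> w /= /eqP.
apply/funext => w; rewrite (bigD1 (f w)) //= eqxx big1 ?addr0 // => i /negbTE.
by rewrite eq_sym => ->.
Qed.

End measurable_matrices.

(** * One round of the mixture supermartingale *)

Section one_round.
Variables (R : realType) (U X : finType) (G : linear_model R U X).
Context d (W : measurableType d) (P : probability W R).
Variable eps : node U X -> {RV P >-> R}.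
Hypothesis G_adm : admissible G.
Hypothesis eps_adm : admissible_noise G eps.

Local Notation G' := (transformed G eps).
Local Notation theta := (true_params G eps).
Local Notation V := (parent_vector G eps).

Lemma parent_vector_measurable s x : mxmeasurable (V s x).
Proof.
move=> k j; rewrite ord1.
rewrite [X in measurable_fun _ X](_ : _ = fun w : W =>
    if enum_val k is Some i then value_at G eps s (inr i) w else 1); last first.
  by apply/funext => w; rewrite mxE.
by case: (enum_val k) => [i|]; [exact: value_at_measurable | exact: measurable_cst].
Qed.

Lemma residual_measurable x : measurable_fun setT (residual G eps x).
Proof. exact/integrable_measurable/residual_integrable. Qed.

(* The conditional law of the residual given the parents has mean 0 and lives
   on an interval of length 1. *)
Lemma mixture_supermartingale_step s x (M : 'M[R]_#|Pa G' x|) (z : 'cV[R]_#|Pa G' x|) :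
  unit_valued s -> s x = None -> posdef M ->
  (\int[P]_w (mixture (M + V s x w *m (V s x w)^T) (z + residual G eps x w *: V s x w))%:E
    <= (mixture M z)%:E)%E.
Proof.
move=> s01 sx pM; have pI := posdef_invmx pM.
pose u w := dot (V s x w) (invmx M *m z).
pose q w := dot (V s x w) (invmx M *m V s x w).
pose p w := dot (theta x) (V s x w).
pose c := 2 * expR (\sum_k `|(invmx M *m z) k 0| + 1).
pose slope w := tilt_slope (u w) (q w) (p w) / Num.sqrt (1 + q w).
(* The bound [c] on the slope relies on parents in [0,1], which holds only almost surely; clamping
   makes it valid everywhere, as [residual_orthogonal] asks. *)
pose B w := Num.max (Num.min (slope w) c) (- c).
have c0 : 0 <= c by rewrite mulr_ge0 ?expR_ge0.
have q0 w : 0 <= q w by exact: posdef_ge0.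
have q1 w : 0 < 1 + q w by rewrite ltr_pwDl.
have L0 : 0 <= mixture M z by exact: mixture_ge0.
pose Bl := g_sigma_algebraType (block_events (fun v => eps v : W -> R) (ancestors_of_parents G x)).
have mBl : measurable_fun [set: Bl] B.
  have mV : @mxmeasurable _ Bl R _ _ (V s x).
    by move=> k j; rewrite ord1; exact: parent_vector_measurable_block.
  have mu : measurable_fun [set: Bl] u.
    by apply: measurable_dot => //; exact: mxmeasurable_cst.
  have mq : measurable_fun [set: Bl] q.
    by apply: measurable_dot => //; apply: mxmeasurableM => //; exact: mxmeasurable_cst.
  have mp : measurable_fun [set: Bl] p.
    by apply: measurable_dot => //; exact: mxmeasurable_cst.
  have mtilt (f : Bl -> R) : measurable_fun [set: Bl] f ->
      measurable_fun [set: Bl] (fun w => tilt (u w) (q w) (f w)).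
    move=> mf; apply: measurableT_comp => //; apply: measurable_funM.
      apply: measurable_funB; last exact: measurable_funX.
      apply: measurable_funD; apply: measurable_funM => //.
        by apply: measurable_funM => //; exact: measurable_cst.
      exact: measurable_funX.
    apply: measurable_inv_pos => [w|]; first by rewrite mulr_gt0.
    by apply: measurable_funM; [exact: measurable_cst |
      apply: measurable_funD => //; exact: measurable_cst].
  apply: measurable_maxr; last exact: measurable_cst.
  apply: measurable_minr; last exact: measurable_cst.
  apply: measurable_funM.
    apply: measurable_funB; apply: mtilt; last exact: measurable_funN.
    by apply: measurable_funB => //; exact: measurable_cst.
  apply: measurable_inv_pos => [w|]; first by rewrite sqrtr_gt0.
  by apply: measurable_sqrt_comp; apply: measurable_funD => //; exact: measurable_cst.
have Bc w : `|B w| <= c.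
  rewrite ler_norml /B le_max lexx orbT /= ge_max; apply/andP; split.
    by rewrite ge_min lexx orbT.
  by rewrite (le_trans _ c0) // oppr_le0.
have [iBr EBr] := residual_orthogonal G_adm eps_adm mBl Bc.
have i1Br : P.-integrable setT (EFin \o (fun w => 1 + B w * residual G eps x w)).
  by apply: integrable_addr => //; exact: integrable_cstr.
have ratio_le : {ae P, forall w, tilt (u w) (q w) (residual G eps x w) / Num.sqrt (1 + q w)
    <= 1 + B w * residual G eps x w}.
  apply: filterS2 (parent_vector_01 eps_adm s01) (value_at_01 eps_adm s01) => w V01 v01.
  have p01 : 0 <= p w <= 1 by apply: dot_true_params_01 => //; exact: V01.
  have py : 0 <= p w + residual G eps x w <= 1.
    by rewrite -value_at_regression //; exact: v01.
  have r0 : 0 < Num.sqrt (1 + q w) by rewrite sqrtr_gt0.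
  have BE : B w = slope w.
    suff : `|slope w| <= c.
      by rewrite ler_norml /B => /andP[h1 h2]; rewrite (min_idPl h2) (max_idPl h1).
    have uc : `|u w| <= \sum_k `|(invmx M *m z) k 0|.
      rewrite /u dotE; apply: le_trans (ler_norm_sum _ _ _) _.
      apply: ler_sum => k _; have /andP[V0 V1] := V01 x k.
      by rewrite normrM ger0_norm // ler_piMl.
    rewrite /slope normrM normfV (ger0_norm (sqrtr_ge0 _)).
    rewrite ler_pdivrMr //; apply: le_trans (tilt_slope_bound _ (q0 w) p01) _.
    apply: le_trans (_ : c * 1 <= _); last first.
      rewrite ler_wpM2l // -[leLHS]sqrtr1 ler_wsqrtr // lerDl //.
    by rewrite mulr1 ler_wpM2l // ler_expR lerD2r.
  rewrite BE ler_pdivrMr // mulrDl mul1r /slope mulrAC divfK ?gt_eqF //.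
  exact: tilt_le_chord.
have mmix : measurable_fun setT (fun w =>
    mixture (M + V s x w *m (V s x w)^T) (z + residual G eps x w *: V s x w)).
  have mV := @parent_vector_measurable s x.
  apply: measurable_mixture => [w||].
  - exact: posdef_add_outer.
  - apply: mxmeasurableD; first exact: mxmeasurable_cst.
    by apply: mxmeasurableM => //; exact: mxmeasurable_tr.
  - apply: mxmeasurableD; first exact: mxmeasurable_cst.
    by apply: mxmeasurableZ => //; exact: residual_measurable.
have m1Br := integrable_measurable i1Br.
(* The maximum with 0 keeps the integrand nonnegative everywhere. Almost surely it is inactive,
   since the affine bound dominates a nonnegative ratio. *)
have mix_le : {ae P, forall w,
    mixture (M + V s x w *m (V s x w)^T) (z + residual G eps x w *: V s x w)
    <= mixture M z * Num.max 0 (1 + B w * residual G eps x w)}.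
  apply: filterS ratio_le => w h.
  rewrite mixture_update // ler_wpM2l // le_max; apply/orP; right; exact: h.
have mmax : measurable_fun setT (fun w => Num.max 0 (1 + B w * residual G eps x w)).
  by apply: measurable_maxr => //; exact: measurable_cst.
apply: le_trans
  (_ : (\int[P]_w (mixture M z * Num.max 0 (1 + B w * residual G eps x w))%:E <= _)%E).
  apply: ae_ge0_le_integral => //.
  - by move=> w _; rewrite lee_fin mixture_ge0.
  - exact/measurable_EFinP.
  - by move=> w _; rewrite lee_fin mulr_ge0 // le_max lexx.
  - by apply/measurable_EFinP/measurable_funM => //; exact: measurable_cst.
  - by apply: filterS mix_le => w h _; rewrite lee_fin.
under eq_integral do rewrite EFinM.
rewrite ge0_integralZl_EFin //; last 2 first.
- by move=> w _; rewrite lee_fin le_max lexx.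
- exact/measurable_EFinP.
suff -> : (\int[P]_w (Num.max 0 (1 + B w * residual G eps x w))%:E = 1)%E by rewrite mule1.
transitivity (\int[P]_w (1 + B w * residual G eps x w)%:E)%E.
  apply: ae_eq_integral => //; try exact/measurable_EFinP.
  apply: filterS ratio_le => w h _; rewrite (max_idPr _) //.
  by apply: le_trans h; rewrite divr_ge0 ?expR_ge0 ?sqrtr_ge0.
rewrite integrable_real // RintegralD //; last exact: integrable_cstr.
by rewrite EBr addr0 Rintegral_cstr.
Qed.

End one_round.

(** * The past of a round, the noise sums and the mean of the mixture *)

Section rounds.
Variables (R : realType) (U X : finType) (G : linear_model R U X).
Context d (W : measurableType d) (P : probability W R).
Variable eps : node U X -> {RV P >-> R}.
Hypothesis G_adm : admissible G.
Hypothesis eps_adm : admissible_noise G eps.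
Context d' (Om : measurableType d') (Q : probability Om R).
Variables (draw : nat -> {mfun Om >-> W}) (S : nat -> Om -> {set X}) (T : nat).
Hypothesis rounds_indep : independent_rounds P Q T draw.
Hypothesis S_history : forall t, (t < T)%N -> forall A : {set X},
  history G eps draw S t [set om | S t om = A].

Local Notation G' := (transformed G eps).
Local Notation theta := (true_params G eps).
Local Notation V := (parent_vector G eps).
Local Notation gram := (gram G eps draw S G').
Local Notation moment := (moment G eps draw S G').
Local Notation regressor := (regressor G eps draw S G').
Local Notation obs := (obs G eps draw S).

(** Generated by the draws of the first [t] rounds rather than by the observations, because
    independence is a statement about draws; [S_past] recovers the measurability of the choices. *)
Definition past (t : nat) : set (set Om) :=
  block_events (fun s : 'I_T => draw s : Om -> W) (fun s : 'I_T => (s < t)%N).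

Lemma past_measurable t : past t `<=` measurable.
Proof. by apply: block_events_measurable => s; exact: measurable_funP. Qed.

Lemma past_mono s t : (s <= t)%N -> <<s past s >> `<=` <<s past t >>.
Proof.
move=> st; apply: smallest_sub; first exact: smallest_sigma_algebra.
move=> A [i [B [i_s mB ->]]]; apply: sub_sigma_algebra; exists i, B; split=> //.
exact: leq_trans st.
Qed.

Lemma draw_past s t : (s < t)%N -> (s < T)%N ->
  measurable_fun [set: g_sigma_algebraType (past t)] (draw s).
Proof.
move=> st sT _ B mB; rewrite setTI; apply: sub_sigma_algebra.
by exists (Ordinal sT), B.
Qed.

Lemma obs_past_of s t x : (s < t)%N -> (s < T)%N ->
  (forall A, <<s past s >> [set om | S s om = A]) ->
  measurable_fun [set: g_sigma_algebraType (past t)] (obs s x).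
Proof.
move=> st sT Ss; rewrite /Defs.obs.
apply: (@measurable_fin_comp _ (g_sigma_algebraType (past t)) R _ (S s)
  (fun A om => value_at G eps (do1 R A) (inr x) (draw s om))) => A.
  exact: (past_mono (ltnW st)).
apply: measurableT_comp; first exact: value_at_measurable.
exact: draw_past.
Qed.

(** Strong induction on the round: an earlier observation is a function of the draw and of the set
    played then, itself measurable for the earlier past. *)
Lemma S_past t : (t < T)%N -> forall A, <<s past t >> [set om | S t om = A].
Proof.
have [n] := ubnP t; elim: n t => // n IHn t tn tT A.
have : <<s [set A | exists s x B, [/\ (s < t)%N, measurable B
      & A = obs s x @^-1` B]] >> `<=` <<s past t >>.
  apply: smallest_sub; first exact: smallest_sigma_algebra.
  move=> _ [s [x [B [st mB ->]]]].
  have sT := ltn_trans st tT.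
  have := @obs_past_of s t x st sT (IHn s (leq_trans st tn) sT) measurableT B mB.
  by rewrite setTI.
by apply; exact: S_history.
Qed.

Lemma obs_past s t x : (s < t)%N -> (s < T)%N ->
  measurable_fun [set: g_sigma_algebraType (past t)] (obs s x).
Proof. by move=> st sT; apply: obs_past_of => //; exact: S_past. Qed.

Lemma round_fubini t (f : g_sigma_algebraType (past t) * W -> \bar R) : (t < T)%N ->
  measurable_fun setT f -> (forall z, 0 <= f z)%E ->
  (\int[Q]_om f (om, draw t om) = \int[Q]_om \int[P]_w f (om, w))%E.
Proof.
move=> tT mf f0; case: rounds_indep => law ind.
apply: independent_fubini => //; first exact: past_measurable.
move=> A B sA mB.
have := @independent_block _ _ Om W R Q _ (fun s : 'I_T => draw s : Om -> W)
  (fun s : 'I_T => (s < t)%N) (Ordinal tT) _ ind _ A B sA mB.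
by rewrite /= ltnn law //; apply => // i; exact: measurable_funP.
Qed.

Lemma gramS om x t : gram t.+1 om x = if is_target (S t om) x then gram t om x
  else gram t om x + regressor t om x *m (regressor t om x)^T.
Proof. by []. Qed.

Lemma gram_posdef t om x : posdef (gram t om x).
Proof.
exact: (@design_posdef _ _ (fun t => gram t om x) (fun t => regressor t om x)
  (fun t => is_target (S t om) x)).
Qed.

(** Closed form of the sum of residual times regressor over the rounds that leave [x] alone, see
    [noise_sumS]; subtracting [1%:M] removes the regularization from the Gram matrix. *)
Definition noise_sum t om x : 'cV[R]_#|Pa G' x| :=
  moment t om x - (gram t om x - 1%:M) *m theta x.

Lemma do1_unit (A : {set X}) : unit_valued (do1 R A).
Proof.
move=> [x|] r //=; case: ifP => // _ [<-]; by rewrite ler01 lexx.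
Qed.

Lemma do1_None (A : {set X}) x : ~~ is_target A x -> do1 R A x = None.
Proof. by case: x => //= x /negbTE ->. Qed.

Lemma noise_sumS t om x : noise_sum t.+1 om x =
  if is_target (S t om) x then noise_sum t om x
  else noise_sum t om x + residual G eps x (draw t om) *: regressor t om x.
Proof.
rewrite /noise_sum /= -[intervened S t om x]/(is_target (S t om) x); case: ifPn => // Sx.
have -> : obs t x om = dot (theta x) (regressor t om x) + residual G eps x (draw t om).
  by rewrite /Defs.obs value_at_regression // do1_None.
rewrite (addrAC (gram t om x)) mulmxDl outer_mulmx scalerDl (dotC (regressor t om x)).
set a := dot _ _ *: _; set b := residual _ _ _ _ *: _.
by rewrite [a + b]addrC opprD addrACA addrK.
Qed.

Lemma gram_moment_past t0 t x : (t <= t0)%N -> (t0 <= T)%N ->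
  mxmeasurable (fun om : g_sigma_algebraType (past t0) => gram t om x) /\
  mxmeasurable (fun om : g_sigma_algebraType (past t0) => moment t om x).
Proof.
move=> + t0T; elim: t => [|t IHt] tt0; first by split; exact: mxmeasurable_cst.
have [mg mm] := IHt (ltnW tt0).
have tT : (t < T)%N := leq_trans tt0 t0T.
have mS A : measurable ([set om | S t om = A] : set (g_sigma_algebraType (past t0))).
  exact: (past_mono (ltnW tt0)) (S_past tT A).
have mr : mxmeasurable (fun om : g_sigma_algebraType (past t0) => regressor t om x).
  move=> k j; rewrite ord1.
  rewrite [X in measurable_fun _ X](_ : _ = fun om : Om =>
      if enum_val k is Some i then obs t i om else 1); last first.
    by apply/funext => om; rewrite mxE.
  by case: (enum_val k) => [i|]; [exact: obs_past | exact: measurable_cst].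
split=> i j /=.
  apply: (@measurable_fin_comp _ (g_sigma_algebraType (past t0)) R _ (S t)
    (fun A om => (if is_target A x then gram t om x
       else gram t om x + regressor t om x *m (regressor t om x)^T) i j)) => // A.
  case: (is_target A x); first exact: mg.
  by apply: mxmeasurableD => //; apply: mxmeasurableM => //; exact: mxmeasurable_tr.
apply: (@measurable_fin_comp _ (g_sigma_algebraType (past t0)) R _ (S t)
  (fun A om => (if is_target A x then moment t om x
     else moment t om x + obs t x om *: regressor t om x) i j)) => // A.
case: (is_target A x); first exact: mm.
by apply: mxmeasurableD => //; apply: mxmeasurableZ => //; exact: obs_past.
Qed.

Lemma noise_sum_past t0 t x : (t <= t0)%N -> (t0 <= T)%N ->
  mxmeasurable (fun om : g_sigma_algebraType (past t0) => noise_sum t om x).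
Proof.
move=> tt0 t0T; have [mg mm] := gram_moment_past x tt0 t0T.
apply: mxmeasurableD => //; apply: mxmeasurableN.
apply: mxmeasurableM; last exact: mxmeasurable_cst.
by apply: mxmeasurableD => //; exact: mxmeasurable_cst.
Qed.

Definition potential t x (om : Om) : R := mixture (gram t om x) (noise_sum t om x).

Lemma potential_ge0 t x om : 0 <= potential t x om.
Proof. exact: mixture_ge0. Qed.

Lemma measurable_of_past t (f : Om -> R) :
  measurable_fun [set: g_sigma_algebraType (past t)] f -> measurable_fun [set: Om] f.
Proof.
move=> mf _ B mB; have := mf measurableT B mB; rewrite !setTI; apply.
by split; [exact: sigma_algebra_measurable | exact: past_measurable].
Qed.

Lemma potential_past t x : (t <= T)%N ->
  measurable_fun [set: g_sigma_algebraType (past t)] (potential t x).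
Proof.
move=> tT; have [mg _] := gram_moment_past x (leqnn t) tT.
apply: measurable_mixture => //; first by move=> om; exact: gram_posdef.
exact: noise_sum_past.
Qed.

Lemma potential_measurable t x : (t <= T)%N -> measurable_fun setT (potential t x).
Proof. by move=> tT; exact: measurable_of_past (@potential_past t x tT). Qed.

Lemma mxmeasurable_fst t m n (A : Om -> 'M[R]_(m, n)) :
  @mxmeasurable _ (g_sigma_algebraType (past t)) R _ _ A ->
  @mxmeasurable _ (g_sigma_algebraType (past t) * W)%type R _ _ (fun z => A z.1).
Proof.
move=> mA i j; exact: (measurableT_comp (mA i j) measurable_fst).
Qed.

Lemma mxmeasurable_snd t m n (A : W -> 'M[R]_(m, n)) : mxmeasurable A ->
  @mxmeasurable _ (g_sigma_algebraType (past t) * W)%type R _ _ (fun z => A z.2).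
Proof.
move=> mA i j; exact: (measurableT_comp (mA i j) measurable_snd).
Qed.

Lemma S_fst_measurable t : (t < T)%N -> forall A,
  measurable [set z : g_sigma_algebraType (past t) * W | S t z.1 = A].
Proof.
move=> tT A.
have := @measurable_fst _ _ (g_sigma_algebraType (past t)) W measurableT
  [set om | S t om = A] (S_past tT A).
by rewrite setTI.
Qed.

(** Freezing the past fixes the set played, the Gram matrix and the noise sum. Integrating the fresh
    draw is then [mixture_supermartingale_step], and nothing changes if [x] is intervened on. *)
Lemma potential_step t x : (t < T)%N ->
  (\int[Q]_om (potential t.+1 x om)%:E <= \int[Q]_om (potential t x om)%:E)%E.
Proof.
move=> tT; have tT' := ltnW tT.
have [mg _] := gram_moment_past x (leqnn t) tT'.
have mn := @noise_sum_past t t x (leqnn t) tT'.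
pose F A (z : g_sigma_algebraType (past t) * W) : R :=
  if is_target A x then potential t x z.1
  else mixture (gram t z.1 x + V (do1 R A) x z.2 *m (V (do1 R A) x z.2)^T)
         (noise_sum t z.1 x + residual G eps x z.2 *: V (do1 R A) x z.2).
pose f (z : g_sigma_algebraType (past t) * W) : \bar R := (F (S t z.1) z)%:E.
have mF A : measurable_fun setT (F A).
  rewrite /F; case: (is_target A x).
    exact: (measurableT_comp (@potential_past t x tT') measurable_fst).
  have mV := @mxmeasurable_snd t _ _ _ (@parent_vector_measurable _ _ _ G _ W P eps (do1 R A) x).
  apply: measurable_mixture => [z||].
  - exact/posdef_add_outer/gram_posdef.
  - apply: mxmeasurableD; first exact: (mxmeasurable_fst mg).
    by apply: mxmeasurableM => //; exact: mxmeasurable_tr.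
  - apply: mxmeasurableD; first exact: (mxmeasurable_fst mn).
    apply: mxmeasurableZ => //.
    have mres : measurable_fun setT (residual G eps x) by exact: residual_measurable.
    exact: (measurableT_comp mres measurable_snd).
have mf : measurable_fun setT f.
  apply/measurable_EFinP; apply: (measurable_fin_comp (S_fst_measurable tT) mF).
have F0 A z : 0 <= F A z.
  by rewrite /F; case: ifP => _; exact: mixture_ge0.
have f0 z : (0 <= f z)%E by rewrite lee_fin F0.
have -> : (\int[Q]_om (potential t.+1 x om)%:E = \int[Q]_om f (om, draw t om))%E.
  apply: eq_integral => om _; congr EFin; rewrite /F /potential gramS noise_sumS /=.
  by case: ifP.
rewrite round_fubini //; apply: ge0_le_integral => //.
- by move=> om _; apply: integral_ge0.
- move=> _ B mB.
  have mI : measurable_fun [set: g_sigma_algebraType (past t)]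
      (fun om => (\int[P]_w f (om, w))%E) by exact: measurable_fun_fubini_tonelli_F.
  have := mI measurableT B mB; rewrite !setTI; apply.
  by split; [exact: sigma_algebra_measurable | exact: past_measurable].
- exact/measurable_EFinP/potential_measurable.
- move=> om _; rewrite /f /F /=; case: (boolP (is_target (S t om) x)) => Sx.
    by rewrite integral_cst //= probability_setT mule1.
  apply: mixture_supermartingale_step => //.
  + exact: do1_unit.
  + exact: do1_None.
  + exact: gram_posdef.
Qed.

Lemma mean_potential_le1 t x : (t <= T)%N ->
  (\int[Q]_om (potential t x om)%:E <= 1)%E.
Proof.
elim: t => [_|t IHt tT]; last first.
  exact: le_trans (potential_step x tT) (IHt (ltnW tT)).
have -> : (fun om => (potential 0 x om)%:E) = (fun=> 1%:E) :> (Om -> \bar R).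
  apply/funext => om; congr EFin; rewrite /potential /mixture /noise_sum /=.
  by rewrite subrr mul0mx subr0 mulmx0 dot0r mul0r expR0 det1 sqrtr1 divr1.
by rewrite integral_cst //= probability_setT mule1.
Qed.

End rounds.

(** * Comparison of integrals without a sign condition on the smaller function *)

Section integral_le.
Context d (T : measurableType d) (R : realType) (mu : {measure set T -> \bar R}).

(** Meant for the regret, whose sign is not known pointwise: the negative part of [f] only lowers
    its integral, and the positive part is still at most [h]. *)
Lemma integral_le_ae (f h : T -> \bar R) : measurable_fun setT f -> measurable_fun setT h ->
  (forall x, 0 <= h x)%E -> {ae mu, forall x, (f x <= h x)%E} ->
  (\int[mu]_x f x <= \int[mu]_x h x)%E.
Proof.
move=> mf mh h0 fh; rewrite integralE.
apply: le_trans (_ : (\int[mu]_x (f^\+ x) <= _)%E).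
  by rewrite geeDl // leeNl oppe0; apply: integral_ge0 => x _; exact: funeneg_ge0.
apply: ae_ge0_le_integral => //; first exact: measurable_funepos.
by apply: filterS fh => x fhx _; rewrite funeposE ge_max fhx h0.
Qed.

End integral_le.

(** * The regret of the algorithm *)

Section regret_bound.
Variables (R : realType) (U X : finType) (G : linear_model R U X).
Context d (W : measurableType d) (P : probability W R).
Variable eps : node U X -> {RV P >-> R}.
Hypothesis G_adm : admissible G.
Hypothesis eps_adm : admissible_noise G eps.
Context db (Wb : measurableType db) (Pb : probability Wb R).
Variables (beps : params (transformed G eps) -> option X -> {RV Pb >-> R})
          (gam : option X -> {RV Pb >-> R}).
Hypothesis binary_adm : admissible_binary_noise beps gam.
Context d' (Om : measurableType d') (Q : probability Om R).
Variables (draw : nat -> {mfun Om >-> W}) (S : nat -> Om -> {set X}) (K T : nat).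
Variables (theta : nat -> Om -> params (transformed G eps)) (Sopt : {set X}).
Hypothesis rounds_indep : independent_rounds P Q T draw.
Hypothesis run : is_BLM_LR_run G eps draw S K T beps gam theta.
Hypothesis Sopt_optimal : is_optimal G eps K Sopt.
Hypothesis T_ge2 : (2 <= T)%N.

Local Notation G' := (transformed G eps).
Local Notation theta0 := (true_params G eps).
Local Notation V := (parent_vector G eps).
Local Notation gram := (gram G eps draw S G').
Local Notation moment := (moment G eps draw S G').
Local Notation regressor := (regressor G eps draw S G').
Local Notation estimate := (estimate G eps draw S G').
Local Notation L := (potential G eps draw S).
Local Notation confident := (@confident R U X G d W P eps d' Om draw S T G').
Local Notation reward := (reward G eps).
Local Notation n := (nnodes X).
Local Notation delta := (delta R X T).
Local Notation radius := (Defs.radius R X T).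

Let S_history t : (t < T)%N -> forall A : {set X},
  history G eps draw S t [set om | S t om = A].
Proof. by case: run => h _ _; exact: h. Qed.

Let T_gt0 : 0 < T%:R :> R. Proof. by rewrite ltr0n (leq_trans _ T_ge2). Qed.

Lemma nnodes_gt0 : (0 < n)%N.
Proof. by apply/card_gt0P; exists None. Qed.

Let n_ge1 : 1 <= n%:R :> R. Proof. by rewrite ler1n nnodes_gt0. Qed.

Let sqrtT_ge1 : 1 <= Num.sqrt T%:R :> R.
Proof. by rewrite -[leLHS]sqrtr1 ler_wsqrtr // ler1n (leq_trans _ T_ge2). Qed.

Lemma inv_delta : 1 / delta = n%:R * Num.sqrt T%:R.
Proof. by rewrite /Defs.delta !div1r invrK. Qed.

Lemma delta_gt0 : 0 < delta.
Proof. by rewrite divr_gt0 // mulr_gt0 ?sqrtr_gt0 // (lt_le_trans ltr01). Qed.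

Lemma card_Pa_le x : (#|Pa G' x| <= n)%N.
Proof. exact: max_card. Qed.

Lemma card_Pa_gt0 x : (0 < #|Pa G' x|)%N.
Proof. by apply/card_gt0P; exists None; rewrite inE. Qed.

Definition regressors_unit (om : Om) : Prop := forall t x k, (t < T)%N ->
  0 <= regressor t om x k 0 <= 1.

(** The set played is random, so null sets are collected over all rounds and all possible sets,
    which are finitely many. *)
Lemma regressors_unit_ae : {ae Q, forall om, regressors_unit om}.
Proof.
pose bad A := [set w : W | ~ forall x k, 0 <= V (do1 R A) x w k 0 <= 1].
have /= h : {ae Q, forall om, forall (t : 'I_T) (A : {set X}) x k,
    0 <= V (do1 R A) x (draw t om) k 0 <= 1}.
  apply: filter_forall => t; apply: filter_forall => A.
  have [N [mN PN subN]] := parent_vector_01 eps_adm (@do1_unit R X A).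
  exists (draw t @^-1` N); split.
  - by rewrite -[X in measurable X]setTI; exact: measurable_funP.
  - by case: rounds_indep => law _; rewrite law.
  - by move=> om /= hom; apply: subN => /= hw; exact: hom.
by apply: filterS h => om hom t x k tT; exact: (hom (Ordinal tT)).
Qed.

(** The error splits into the bias [M^-1 theta0], of norm at most [sqrt n], and [M^-1 s], of squared
    norm [q]. The hypothesis on the mixture reads [q < 2 ln (1 / delta) + ln (det M)], and [det M]
    is at most [(1 + t)^n]. *)
Lemma confident_true t om : (t <= T)%N -> regressors_unit om ->
  (forall x, L t x om < 1 / delta) -> confident t om theta0.
Proof.
move=> tT reg01 Lsmall x; split; first exact: true_params_cube.
have pM : posdef (gram t om x) by exact: gram_posdef.
have uM := posdef_unitmx pM.
pose s := noise_sum G eps draw S t om x.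
have E : theta0 x - estimate t om x =
    invmx (gram t om x) *m theta0 x - invmx (gram t om x) *m s.
  rewrite -mulmxBr; apply: (canRL (mulKmx uM)).
  rewrite mulmxBr mulKVmx // /s /noise_sum mulmxBl mul1mx.
  by rewrite opprB addrA [theta0 x + _]addrC subrK.
rewrite E; apply: le_trans (mnorm_leB _ _ pM) _.
rewrite /Defs.radius addrC; apply: lerD; last first.
  apply: le_trans (mnorm_invmx_le _ pM _) _.
    move=> y; exact: (@design_ge1 _ _ (fun t => gram t om x) (fun t => regressor t om x)
      (fun t => is_target (S t om) x)).
  rewrite ler_wsqrtr // dotE; apply: le_trans (_ : \sum_(i < #|Pa G' x|) 1 <= _).
    apply: ler_sum => k _; have /andP[t0 t1] := true_params_cube G_adm eps_adm k.
    by rewrite mulr_ile1.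
  by rewrite sumr_const card_ord ler_nat card_Pa_le.
rewrite /mnorm ler_wsqrtr // mulKVmx // dotC.
set q := dot s _.
have d1 : 0 < \det (gram t om x) by exact: posdef_det_gt0.
have d2 : \det (gram t om x) <= (1 + t%:R) ^+ #|Pa G' x|.
  apply: (@design_det_le _ _ (fun t => gram t om x) (fun t => regressor t om x)
      (fun t => is_target (S t om) x)) => // i k it _.
  by apply: reg01; exact: leq_trans it tT.
have := Lsmall x; rewrite /potential /mixture -/s -/q.
rewrite ltr_pdivrMr ?sqrtr_gt0 // => h.
have id0 : 0 < 1 / delta by rewrite divr_gt0 ?delta_gt0.
have {}h : q / 2 <= ln (1 / delta) + ln (\det (gram t om x)) / 2.
  have -> : ln (\det (gram t om x)) / 2 = ln (Num.sqrt (\det (gram t om x))).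
    rewrite -{1}[\det (gram t om x)]sqr_sqrtr ?(ltW d1) // lnXn ?sqrtr_gt0 //.
    by rewrite -[ln _ *+ 2]mulr_natr mulfK.
  rewrite -lnM ?posrE ?sqrtr_gt0 // -[q / 2]expRK ler_ln ?posrE ?expR_gt0 //.
    exact: ltW.
  by rewrite mulr_gt0 ?sqrtr_gt0.
have {}h2 : ln (\det (gram t om x)) <= n%:R * ln (1 + (t * n)%:R).
  have t1 : 0 < 1 + t%:R :> R by rewrite ltr_pwDl.
  apply: le_trans (_ : ln ((1 + t%:R) ^+ #|Pa G' x|) <= _).
    by rewrite ler_ln ?posrE // exprn_gt0.
  rewrite lnXn // -[ln _ *+ _]mulr_natl; apply: ler_pM => //.
  - by rewrite ln_ge0 // lerDl.
  - by rewrite ler_nat card_Pa_le.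
  - rewrite ler_ln ?posrE ?ltr_pwDl // lerD2l ler_nat.
    by rewrite leq_pmulr // nnodes_gt0.
by move: h h2; lra.
Qed.

Lemma radius_ge0 t : 0 <= radius t.
Proof. by rewrite addr_ge0 // sqrtr_ge0. Qed.

Definition width (t : nat) (om : Om) x (v : 'cV[R]_#|Pa G' x|) : R :=
  Num.sqrt (dot v (invmx (gram t om x) *m v)).

Lemma width_V_integrable t om A x :
  P.-integrable setT (EFin \o (fun w => width t om (V (do1 R A) x w))).
Proof.
have pM : posdef (gram t om x) by exact: gram_posdef.
have mV := @parent_vector_measurable _ _ _ G _ W P eps (do1 R A) x.
apply: (@integrable_bounded _ _ _ _ _ (Num.sqrt #|Pa G' x|%:R)).
  apply: measurable_sqrt_comp; apply: measurable_dot => //.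
  by apply: mxmeasurableM => //; exact: mxmeasurable_cst.
apply: filterS (parent_vector_01 eps_adm (@do1_unit R X A)) => w /(_ x) V01.
rewrite ger0_norm ?sqrtr_ge0 // ler_wsqrtr //.
apply: le_trans (@design_inv_le _ _ (fun t => gram t om x) (fun t => regressor t om x)
      (fun t => is_target (S t om) x) _ _ t _) _ => //.
rewrite dotE; apply: le_trans (_ : \sum_(i < #|Pa G' x|) 1 <= _).
  by apply: ler_sum => k _; have /andP[v0 v1] := V01 k; rewrite mulr_ile1.
by rewrite sumr_const card_ord.
Qed.

Lemma parent_vector_mean A x (a : 'cV[R]_#|Pa G' x|) :
  P.-integrable setT (EFin \o (fun w => dot a (V (do1 R A) x w))) /\
  \int[P]_w dot a (V (do1 R A) x w) = dot a (mean_parents G eps (do1 R A) x).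
Proof.
have iV k : P.-integrable setT (EFin \o (fun w => V (do1 R A) x w k 0)).
  apply: (@integrable_bounded _ _ _ _ _ 1).
    exact: parent_vector_measurable.
  apply: filterS (parent_vector_01 eps_adm (@do1_unit R X A)) => w /(_ x k)/andP[v0 v1].
  by rewrite ger0_norm.
have E : (fun w => dot a (V (do1 R A) x w)) =
    fun w => \sum_k a k 0 * V (do1 R A) x w k 0 by apply/funext => w; rewrite dotE.
rewrite E; split; first by apply: integrable_sumr => k _; exact: integrable_mull.
rewrite Rintegral_sum => [|k _]; last exact: integrable_mull.
rewrite dotE; apply: eq_bigr => k _; rewrite RintegralZl //; congr (_ * _).
rewrite mxE; case Ek : (enum_val k) => [i|].
  rewrite mean_doE; congr fine; apply: eq_integral => w _.
  by rewrite mxE Ek.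
rewrite -[RHS](Rintegral_cstr P); congr fine; apply: eq_integral => w _.
by rewrite mxE Ek.
Qed.

Definition mean_values A (v : mnode X) : R :=
  if v is Some i then mean_do G eps (do1 R A) i else 1.

Lemma mean_values_target A x : is_target A x -> mean_values A (Some x) = 1.
Proof.
move=> Ax; apply: mean_do_Some => //.
by case: x Ax => //= x ->.
Qed.

Lemma mean_values_regression A x : ~~ is_target A x ->
  mean_values A (Some x) = dot (theta0 x) (mean_parents G eps (do1 R A) x).
Proof. by move=> Ax; apply: mean_do_regression => //; [exact: do1_unit | exact: do1_None]. Qed.

(** Both models obey the same linear recursion on the means, because no score of the true parameters
    exceeds 1. *)
Lemma sigma_true A : sigma beps gam A theta0 = reward A.
Proof.
transitivity (mean_values A (Some None)) => //.
have th := true_params_cube G_adm eps_adm.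
have h := @sigma_eq_mean _ _ G' (transformed_acyclic G_adm) _ Wb Pb beps gam
  binary_adm A theta0 th (mean_values A) erefl (@mean_values_target A).
apply: h.
- by move=> x B NB; have /andP[] := true_params_subset G_adm eps_adm x NB.
- exact: mean_values_regression.
Qed.

Lemma sigma_le_widths t om (th : params G') : confident t om th -> confident t om theta0 ->
  sigma beps gam (S t om) th <= reward (S t om) +
    \sum_(x | ~~ is_target (S t om) x)
      2 * radius t * \int[P]_w width t om (V (do1 R (S t om)) x w).
Proof.
move=> cth cth0; set A := S t om.
have th01 x : in_cube (th x) by case: (cth x).
have h := @sigma_le_overestimate _ _ G' (transformed_acyclic G_adm) _ Wb Pb beps gam
  binary_adm A th th01 (mean_values A) erefl (@mean_values_target A) _.
apply: le_trans (h _) _.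
  move=> [i|] //=; have /andP[] := mean_do_01 eps_adm i (@do1_unit R X A).
  by [].
rewrite lerD2l; apply: ler_sum => x Ax; rewrite ge_max.
have I0 : 0 <= \int[P]_w width t om (V (do1 R A) x w).
  by apply: Rintegral_ge0 => w _; exact: sqrtr_ge0.
apply/andP; split; first by rewrite !mulr_ge0 ?radius_ge0.
rewrite mean_values_regression // -dotBl.
(* The pairing with the mean parents is the mean of the pairings, so Cauchy-Schwarz can be applied
   before averaging. *)
have [iV <-] := parent_vector_mean A (th x - theta0 x).
rewrite -RintegralZl //; last exact: width_V_integrable.
apply: le_Rintegral => //; first exact/integrable_mull/width_V_integrable.
move=> w _; apply: le_trans (ler_norm _) _.
have pM : posdef (gram t om x) by exact: gram_posdef.
apply: le_trans (mnorm_cauchy_schwarz _ _ pM) _.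
rewrite ler_wpM2r ?sqrtr_ge0 //.
(* Both parameters lie within [radius t] of the estimate, whence the factor 2. *)
have -> : th x - theta0 x = (th x - estimate t om x) - (theta0 x - estimate t om x).
  by rewrite opprB addrA subrK.
apply: le_trans (mnorm_leB _ _ pM) _.
have [_ c1] := cth x; have [_ c2] := cth0 x.
by rewrite mulrDl mul1r lerD.
Qed.

Lemma round_regret t om : (t < T)%N -> regressors_unit om ->
  reward Sopt - reward (S t om) <= \sum_x delta * L t x om +
    \sum_(x | ~~ is_target (S t om) x)
      2 * radius t * \int[P]_w width t om (V (do1 R (S t om)) x w).
Proof.
move=> tT reg01.
have W0 x : 0 <= 2 * radius t * \int[P]_w width t om (V (do1 R (S t om)) x w).
  rewrite !mulr_ge0 ?radius_ge0 //.
  by apply: Rintegral_ge0 => w _; exact: sqrtr_ge0.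
have dL x : 0 <= delta * L t x om by rewrite mulr_ge0 ?potential_ge0 // ltW ?delta_gt0.
have rew01 A : 0 <= reward A <= 1 by exact/mean_do_01/do1_unit.
have [Lsmall|] := pselect (forall x, L t x om < 1 / delta); last first.
  move=> /existsNP[x /negP]; rewrite -leNgt => Lx.
  have dL1 : 1 <= delta * L t x om by rewrite -ler_pdivrMl ?delta_gt0 // mulr1 -div1r.
  have /andP[_ r1] := rew01 Sopt; have /andP[r2 _] := rew01 (S t om).
  have s1 : 1 <= \sum_x delta * L t x om.
    by rewrite (bigD1 x) //= -[leLHS]addr0 lerD // sumr_ge0.
  have s2 : 0 <= \sum_(x | ~~ is_target (S t om) x)
      2 * radius t * \int[P]_w width t om (V (do1 R (S t om)) x w) by exact: sumr_ge0.
  by move: s1 s2 r1 r2; lra.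
have c0 := confident_true (ltnW tT) reg01 Lsmall.
have s1 : 0 <= \sum_x delta * L t x om by exact: sumr_ge0.
have [cth opt] : confident t om (theta t om) /\
    forall (A : {set X}) (th : params G'), (#|A| <= K)%N -> confident t om th ->
      sigma beps gam A th <= sigma beps gam (S t om) (theta t om).
  by case: run => _ _ h; apply: h => //; exists theta0.
have K_Sopt : (#|Sopt| <= K)%N by case: Sopt_optimal => ->.
have := opt Sopt theta0 K_Sopt c0; rewrite sigma_true.
have := sigma_le_widths cth c0.
by move: s1; lra.
Qed.


(** [z.1] fixes the past, hence the set played and the Gram matrix; [z.2] is the draw of the round,
    kept apart so that it can be integrated alone. *)
Definition round_width t x (z : Om * W) : R :=
  if is_target (S t z.1) x then 0 else width t z.1 (V (do1 R (S t z.1)) x z.2).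

Lemma round_width_ge0 t x z : 0 <= round_width t x z.
Proof. by rewrite /round_width; case: ifP => _ //; exact: sqrtr_ge0. Qed.

Lemma round_width_measurable t x : (t < T)%N ->
  measurable_fun [set: g_sigma_algebraType (past draw T t) * W] (round_width t x).
Proof.
move=> tT; have [mg _] := gram_moment_past S_history x (leqnn t) (ltnW tT).
apply: (@measurable_fin_comp _ (g_sigma_algebraType (past draw T t) * W)%type R _
  (fun z => S t z.1) (fun A z => if is_target A x then 0
     else width t z.1 (V (do1 R A) x z.2)) (S_fst_measurable S_history tT)) => A.
case: (is_target A x); first exact: measurable_cst.
have mV := @mxmeasurable_snd _ _ W _ _ draw T t _ _ _
  (@parent_vector_measurable _ _ _ G _ W P eps (do1 R A) x).
apply: measurable_sqrt_comp; apply: measurable_dot => //.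
apply: mxmeasurableM => //; apply: mxmeasurable_invmx => [z|]; first exact: gram_posdef.
exact: (mxmeasurable_fst mg).
Qed.

Definition expected_width t x (om : Om) : \bar R := (\int[P]_w (round_width t x (om, w))%:E)%E.

Lemma expected_width_ge0 t x om : (0 <= expected_width t x om)%E.
Proof. by apply: integral_ge0 => w _; rewrite lee_fin round_width_ge0. Qed.

Lemma expected_width_measurable t x : (t < T)%N ->
  measurable_fun setT (expected_width t x).
Proof.
move=> tT _ B mB.
have mI : measurable_fun [set: g_sigma_algebraType (past draw T t)] (expected_width t x).
  apply: (@measurable_fun_fubini_tonelli_F _ _ (g_sigma_algebraType (past draw T t)) W R P
    (fun z => (round_width t x z)%:E)) => [|z]; last exact: round_width_ge0.
  by apply/measurable_EFinP; exact: round_width_measurable.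
have := mI measurableT B mB; rewrite !setTI; apply.
by split; [exact: sigma_algebra_measurable | exact: past_measurable].
Qed.

Lemma expected_width_integral t x : (t < T)%N ->
  (\int[Q]_om expected_width t x om = \int[Q]_om (round_width t x (om, draw t om))%:E)%E.
Proof.
move=> tT; apply/esym.
apply: (@round_fubini _ _ _ _ _ _ Q draw T rounds_indep t (fun z => (round_width t x z)%:E)) => //.
  by apply/measurable_EFinP; exact: round_width_measurable.
by move=> z; rewrite lee_fin round_width_ge0.
Qed.

Lemma round_width_draw_measurable t x : (t < T)%N ->
  measurable_fun setT (fun om => round_width t x (om, draw t om)).
Proof.
move=> tT; have md : measurable_fun [set: Om]
    (fun om => (om, draw t om) : g_sigma_algebraType (past draw T t) * W).
  apply: measurable_fun_pair => // _ B mB; rewrite setTI.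
  by apply: mB; split; [exact: sigma_algebra_measurable | exact: past_measurable].
exact: (measurableT_comp (@round_width_measurable t x tT) md).
Qed.

Let lnT_ge : 2^-1 <= ln T%:R :> R.
Proof.
rewrite -[leLHS]expRK ler_ln ?posrE ?expR_gt0 //.
apply: le_trans (_ : 2 <= _); last by rewrite ler_nat.
by apply: le_trans (expR_le_1D2x _) _; lra.
Qed.

(** For [n <= T] both logarithms are at most [2 * ln T], so with [y = n * ln T] the first root is at
    most [sqrt (6 y) <= 5/2 * sqrt y]. As [n <= 2 y], the second is at most [3/2 * sqrt y]. *)
Lemma radius_le t : (n <= T)%N -> (t < T)%N -> radius t <= 4 * Num.sqrt (n%:R * ln T%:R).
Proof.
move=> nT tT; set y := n%:R * _.
have n0 : 0 < n%:R :> R by exact: lt_le_trans n_ge1.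
have y0 : 0 <= y by rewrite mulr_ge0 // (le_trans _ lnT_ge).
have ln_sq a : 0 < a -> a <= T%:R ^+ 2 -> ln a <= 2 * ln (T%:R : R).
  by move=> a0 aT; rewrite mulrC mulr_natr -lnXn // ler_ln ?posrE // exprn_gt0.
have l1 : ln (1 + (t * n)%:R) <= 2 * ln (T%:R : R).
  apply: ln_sq; first by rewrite ltr_pwDl.
  rewrite -natrX -[1]/(1%:R) -natrD ler_nat -mulnn.
  apply: leq_trans (_ : t.+1 * T <= _)%N; last by rewrite leq_mul2r tT orbT.
  by rewrite mulSn leq_add ?leq_mul2l ?nT ?orbT // (leq_trans _ T_ge2).
have l2 : ln (1 / delta) <= 2 * ln (T%:R : R).
  rewrite inv_delta; apply: ln_sq; first by rewrite mulr_gt0 // (lt_le_trans ltr01).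
  rewrite expr2 ler_pM // ?ler_nat //.
  by rewrite -[leRHS]sqr_sqrtr ?(ltW T_gt0) // expr2 ler_peMl.
have sq6 : Num.sqrt (n%:R * ln (1 + (t * n)%:R) + 2 * ln (1 / delta)) <= 5/2 * Num.sqrt y.
  have -> : 5/2 * Num.sqrt y = Num.sqrt ((5/2) ^+ 2 * y).
    by rewrite [RHS]sqrtrM ?sqr_ge0 // sqrtr_sqr ger0_norm //; lra.
  rewrite ler_wsqrtr //.
  have : n%:R * ln (1 + (t * n)%:R) <= 2 * y by rewrite /y mulrCA ler_pM2l.
  have : ln T%:R <= y by rewrite /y ler_peMl // (le_trans _ lnT_ge).
  by move: l2 y0; lra.
have sq2 : Num.sqrt n%:R <= 3/2 * Num.sqrt y.
  have -> : 3/2 * Num.sqrt y = Num.sqrt ((3/2) ^+ 2 * y).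
    by rewrite [RHS]sqrtrM ?sqr_ge0 // sqrtr_sqr ger0_norm //; lra.
  rewrite ler_wsqrtr // /y; have := ler_wpM2l (ltW n0) lnT_ge; lra.
by rewrite /Defs.radius; move: sq6 sq2; lra.
Qed.

Lemma sum_round_width om x : regressors_unit om ->
  \sum_(t < T) round_width t x (om, draw t om) <=
  Num.sqrt (4 * n%:R * (max_indegree G')%:R * ln T%:R * T%:R).
Proof.
move=> reg01; set D := (max_indegree G')%:R; set B := 4 * n%:R * D * ln T%:R.
have kD : (#|Pa G' x|)%:R <= D by rewrite ler_nat (leq_bigmax x).
have k1 : 1 <= (#|Pa G' x|)%:R :> R by rewrite ler1n card_Pa_gt0.
have kn : (#|Pa G' x|)%:R <= n%:R :> R by rewrite ler_nat card_Pa_le.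
have l0 : 0 < ln T%:R :> R by apply: lt_le_trans lnT_ge; rewrite invr_gt0.
have B0 : 0 < B.
  by rewrite !mulr_gt0 // ?(lt_le_trans ltr01 n_ge1) // (lt_le_trans _ kD) // (lt_le_trans ltr01).
have ell := @elliptical_potential _ _ (fun t => gram t om x) (fun t => regressor t om x)
      (fun t => is_target (S t om) x).
have {}ell : \sum_(t < T | ~~ is_target (S t om) x)
    dot (regressor t om x) (invmx (gram t om x) *m regressor t om x) <= B.
  apply: le_trans (ell erefl (fun=> erefl) T _) _.
    by move=> t i tT _; exact: reg01.
  have l2 : ln (1 + T%:R) <= 2 * ln T%:R :> R.
    rewrite mulrC mulr_natr -lnXn // ler_ln ?posrE ?exprn_gt0 ?ltr_pwDl //.
    rewrite expr2; have : 2 <= T%:R :> R by rewrite ler_nat.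
    by nra.
  have l3 : 0 <= ln (1 + T%:R) :> R by rewrite ln_ge0 // lerDl.
  (* Of the factors [1 + k] and [k], the first is bounded by [2 * n] and the second by [D]. *)
  rewrite mulrA /B; have -> : 4 * n%:R * D * ln T%:R = (2 * n%:R * D) * (2 * ln T%:R) by ring.
  rewrite ler_pM // ?mulr_ge0 ?addr_ge0 // ler_pM ?addr_ge0 //; lra.
rewrite -/B; clearbody B; set q := Num.sqrt _.
have q0 : 0 < q by rewrite sqrtr_gt0 mulr_gt0.
have q2 : q ^+ 2 = B * T%:R by rewrite sqr_sqrtr // ltW // mulr_gt0.
(* The arithmetic-geometric inequality with equality at [w = B / T]; summed over the rounds, each of
   the two terms gives at most [q / 2]. *)
have amgm w : 0 <= w -> Num.sqrt w <= q / (2 * B) * w + B / (2 * q).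
  move=> w0; have := sqr_ge0 (q * Num.sqrt w - B).
  move: (Num.sqrt w) (sqr_sqrtr w0) => s <- h.
  rewrite -(@ler_pM2l _ (2 * B * q)) ?mulr_gt0 //.
  have -> : 2 * B * q * (q / (2 * B) * s ^+ 2 + B / (2 * q)) = q ^+ 2 * s ^+ 2 + B ^+ 2.
    by field; rewrite ?gt_eqF.
  by move: h; rewrite sqrrB exprMn; lra.
apply: le_trans (_ : \sum_(t < T | ~~ is_target (S t om) x)
   (q / (2 * B) * dot (regressor t om x) (invmx (gram t om x) *m regressor t om x)
     + B / (2 * q)) <= _).
  rewrite [leRHS]big_mkcond; apply: ler_sum => t _; rewrite /round_width /=.
  case: ifP => // _; apply: amgm; apply: posdef_ge0.
  exact/posdef_invmx/gram_posdef.
rewrite big_split /= -mulr_sumr.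
apply: le_trans (_ : q / (2 * B) * B + T%:R * (B / (2 * q)) <= _).
  apply: lerD.
    by rewrite ler_wpM2l // divr_ge0 // ltW // mulr_gt0.
  apply: le_trans (_ : \sum_(t < T) B / (2 * q) <= _).
    rewrite [leLHS]big_mkcond; apply: ler_sum => t _; case: ifP => // _.
    by rewrite divr_ge0 // ltW // mulr_gt0.
  by rewrite sumr_const card_ord -[_ *+ T]mulr_natl.
have -> : T%:R * (B / (2 * q)) = q / 2.
  apply: (mulIf (x := 2 * q)); first by rewrite gt_eqF // mulr_gt0.
  by rewrite -mulrA divfK ?gt_eqF ?mulr_gt0 // mulrC -q2; field.
have -> : q / (2 * B) * B = q / 2 by field; rewrite gt_eqF.
by lra.
Qed.


Let regret_integrand om : R := \sum_(t < T) (reward Sopt - reward (S t om)).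

Let regret_integrand_measurable : measurable_fun setT regret_integrand.
Proof.
apply: measurable_sum => t.
apply: (@measurable_fin_comp _ Om R _ (S t) (fun A _ => reward Sopt - reward A)) => A //.
have := S_past S_history (ltn_ord t) A; apply.
by split; [exact: sigma_algebra_measurable | exact: past_measurable].
Qed.

Lemma regretE : regret G eps Q T Sopt S = (\int[Q]_om (regret_integrand om)%:E)%E.
Proof. by rewrite /regret unlock. Qed.

Lemma regret_le_horizon : (regret G eps Q T Sopt S <= T%:R%:E)%E.
Proof.
rewrite regretE; apply: le_trans (_ : (\int[Q]_om (T%:R)%:E <= _)%E); last first.
  by rewrite integral_cst //= probability_setT mule1.
apply: integral_le_ae => //; first exact/measurable_EFinP.
apply: aeW => om; rewrite lee_fin.
apply: le_trans (_ : \sum_(t < T) 1 <= _); last by rewrite sumr_const card_ord.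
apply: ler_sum => t _.
have rew01 A : 0 <= reward A <= 1 by exact/mean_do_01/do1_unit.
have /andP[_ r1] := rew01 Sopt; have /andP[r2 _] := rew01 (S t om).
by move: r1 r2; lra.
Qed.

(** The first summand pays for large mixtures: at most [n] observed nodes in each of [T] rounds,
    with mean at most [delta] each. The second sums the widths node by node, after the fresh draws
    are traded for the actual ones. *)
Lemma regret_le_widths : (n <= T)%N ->
  (regret G eps Q T Sopt S <= (T%:R * n%:R * delta + n%:R * (2 * (4 * Num.sqrt (n%:R * ln T%:R)) *
    Num.sqrt (4 * n%:R * (max_indegree G')%:R * ln T%:R * T%:R)))%:E)%E.
Proof.
move=> nT; rewrite regretE; set rho := 2 * _; set q := Num.sqrt _.
have rho0 : 0 <= rho by rewrite /rho !mulr_ge0 ?sqrtr_ge0.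
pose h om := (\sum_(t < T) \sum_(x : option X)
  (delta%:E * (L t x om)%:E + rho%:E * expected_width t x om))%E.
have mL (t : 'I_T) x : measurable_fun setT (fun om => delta%:E * (L t x om)%:E)%E.
  apply: emeasurable_funM => //; apply/measurable_EFinP.
  exact: (potential_measurable S_history x (ltnW (ltn_ord t))).
have mE (t : 'I_T) x : measurable_fun setT (fun om => rho%:E * expected_width t x om)%E.
  by apply: emeasurable_funM => //; exact: expected_width_measurable.
have L0 t x om : (0 <= delta%:E * (L t x om)%:E)%E.
  by rewrite mule_ge0 // lee_fin ?potential_ge0 // ltW ?delta_gt0.
have E0 t x om : (0 <= rho%:E * expected_width t x om)%E.
  by rewrite mule_ge0 ?expected_width_ge0 // lee_fin.
have mh : measurable_fun setT h.
  apply: emeasurable_sum => t; apply: emeasurable_sum => x.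
  exact: emeasurable_funD.
have h0 om : (0 <= h om)%E.
  by apply: sume_ge0 => t _; apply: sume_ge0 => x _; exact: adde_ge0.
apply: le_trans (_ : (\int[Q]_om h om <= _)%E).
  apply: integral_le_ae => //; first exact/measurable_EFinP.
  apply: filterS regressors_unit_ae => om reg01.
  rewrite /h -sumEFin; apply: lee_sum => t _.
  apply: le_trans (_ : ((\sum_x delta * L t x om +
    \sum_(x | ~~ is_target (S t om) x)
      2 * radius t * \int[P]_w width t om (V (do1 R (S t om)) x w))%:E <= _)%E).
    by rewrite lee_fin round_regret.
  rewrite EFinD big_split /= -!sumEFin; apply: leeD => //.
  rewrite big_mkcond; apply: lee_sum => x _; case: ifPn => [Sx|_]; last exact: E0.
  rewrite EFinM; apply: lee_pmul.
  - by rewrite lee_fin mulr_ge0 ?radius_ge0.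
  - by rewrite lee_fin; apply: Rintegral_ge0 => w _; exact: sqrtr_ge0.
  - by rewrite lee_fin /rho ler_wpM2l // radius_le.
  rewrite /expected_width /round_width /= (negbTE Sx) /Rintegral fineK //.
  exact/integrable_fin_num/width_V_integrable.
have intL (t : 'I_T) x : (\int[Q]_om (delta%:E * (L t x om)%:E) <= delta%:E)%E.
  rewrite ge0_integralZl //; last by rewrite lee_fin ltW ?delta_gt0.
  - rewrite -[leRHS]mule1 lee_wpmul2l ?lee_fin ?(ltW delta_gt0) //.
    exact: (mean_potential_le1 G_adm eps_adm rounds_indep S_history x (ltnW (ltn_ord t))).
  - by apply/measurable_EFinP; exact: (potential_measurable S_history x (ltnW (ltn_ord t))).
  - by move=> om _; rewrite lee_fin potential_ge0.
have intE x : (\sum_(t < T) \int[Q]_om (rho%:E * expected_width t x om) <= (rho * q)%:E)%E.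
  have E (t : 'I_T) : true -> (\int[Q]_om (rho%:E * expected_width t x om) =
      rho%:E * \int[Q]_om (round_width t x (om, draw t om))%:E)%E.
    rewrite -expected_width_integral // ge0_integralZl //.
      exact: expected_width_measurable.
    by move=> om _; exact: expected_width_ge0.
  rewrite (eq_bigr _ E).
  rewrite -ge0_sume_distrr; last first.
    by move=> t _; apply: integral_ge0 => om _; rewrite lee_fin round_width_ge0.
  rewrite [(rho * q)%:E]EFinM; apply: lee_wpmul2l; first by rewrite lee_fin.
  rewrite -ge0_integral_sum //; last first.
  - by move=> t om _; rewrite lee_fin round_width_ge0.
  - by move=> t; apply/measurable_EFinP; exact: round_width_draw_measurable.
  apply: le_trans (_ : (\int[Q]_om q%:E <= _)%E); last first.
    by rewrite integral_cst //= probability_setT mule1.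
  apply: ae_ge0_le_integral => //.
  - by move=> om _; apply: sume_ge0 => t _; rewrite lee_fin round_width_ge0.
  - apply: emeasurable_sum => t; apply/measurable_EFinP.
    exact: round_width_draw_measurable.
  - by move=> om _; rewrite lee_fin sqrtr_ge0.
  apply: filterS regressors_unit_ae => om reg01 _.
  by rewrite sumEFin lee_fin sum_round_width.
rewrite /h ge0_integral_sum //; last first.
- by move=> t om _; apply: sume_ge0 => x _; exact: adde_ge0.
- by move=> t; apply: emeasurable_sum => x; exact: emeasurable_funD.
under eq_bigr => t _.
  rewrite ge0_integral_sum //; last first.
  - by move=> x om _; exact: adde_ge0.
  - by move=> x; exact: emeasurable_funD.
  under eq_bigr => x _ do rewrite ge0_integralD //.
  rewrite big_split /=; over.
rewrite big_split /= EFinD; have card_n : (#|{: option X}| <= n)%N.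
  by rewrite [leqRHS]card_option.
have d0 := ltW delta_gt0.
apply: leeD.
  apply: le_trans (_ : (\sum_(t < T) \sum_(x : option X) delta%:E <= _)%E).
    by apply: lee_sum => t _; apply: lee_sum => x _; exact: intL.
  under eq_bigr do rewrite sumEFin; rewrite sumEFin lee_fin.
  rewrite !sumr_const card_ord -mulrnA -[_ *+ _]mulr_natl natrM.
  by rewrite ler_wpM2r // mulrC ler_wpM2l // ler_nat.
rewrite exchange_big /=; apply: le_trans (_ : (\sum_(x : option X) (rho * q)%:E <= _)%E).
  by apply: lee_sum => x _; exact: intE.
rewrite sumEFin lee_fin sumr_const -[_ *+ _]mulr_natl ler_wpM2r ?ler_nat //.
by rewrite mulr_ge0 // sqrtr_ge0.
Qed.

(** The width term gives [2 * 4 * sqrt 4 = 16]. The remaining [sqrt T] is at most twice the target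
    expression, because [ln T >= 1/2]; together 18. *)
Lemma regret_bound : (regret G eps Q T Sopt S <=
  (18 * n%:R ^+ 2 * Num.sqrt (max_indegree G' * T)%:R * ln T%:R)%:E)%E.
Proof.
have D1 : 1 <= (max_indegree G')%:R :> R.
  by rewrite ler1n (leq_trans (card_Pa_gt0 None)) // (leq_bigmax (None : option X)).
set D := (max_indegree G')%:R in D1 *.
have sT := sqr_sqrtr (ltW T_gt0).
rewrite natrM -/D; set r := Num.sqrt (D * T%:R).
have D0 : 0 < D by exact: lt_le_trans D1.
have r_ge : Num.sqrt T%:R <= r by rewrite ler_wsqrtr // ler_peMl // ltW.
have r1 := le_trans sqrtT_ge1 r_ge.
have n2 : 1 <= n%:R ^+ 2 :> R by rewrite exprn_ege1.
have l0 := lnT_ge; have n1 := n_ge1.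
have nrl : Num.sqrt T%:R <= 2 * (n%:R ^+ 2 * r * ln T%:R).
  have a0 : 0 <= n%:R ^+ 2 * r by rewrite mulr_ge0 // (le_trans _ r1).
  have := ler_wpM2l a0 l0; have : r <= n%:R ^+ 2 * r by rewrite ler_peMl // (le_trans _ r1).
  by move: r_ge; lra.
(* [radius_le] requires [n <= T]. When [T < n] the trivial bound [T] suffices, since [sqrt T <= n^2]
   and [sqrt T <= r]. *)
case: (leqP n T) => nT; last first.
  apply: le_trans regret_le_horizon _; rewrite lee_fin.
  have a0 : 0 <= n%:R ^+ 2 * r by rewrite mulr_ge0 // (le_trans _ r1).
  have := ler_wpM2l a0 l0.
  have Tn : Num.sqrt T%:R <= n%:R ^+ 2 :> R.
    apply: (@le_trans _ _ T%:R) => //; first by rewrite -[leRHS]sT expr2 ler_peMl.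
    by apply: (@le_trans _ _ n%:R); [rewrite ler_nat ltnW | rewrite expr2 ler_peMl // ltW].
  have : T%:R <= n%:R ^+ 2 * r by rewrite -[leLHS]sT expr2 ler_pM ?sqrtr_ge0.
  by move: a0; lra.
apply: le_trans (regret_le_widths nT) _; rewrite lee_fin.
have -> : T%:R * n%:R * delta = Num.sqrt T%:R.
  rewrite -{1}sT /Defs.delta; field.
  by rewrite !gt_eqF // (lt_le_trans ltr01).
rewrite -/D; have -> : n%:R * (2 * (4 * Num.sqrt (n%:R * ln T%:R)) *
    Num.sqrt (4 * n%:R * D * ln T%:R * T%:R)) = 16 * (n%:R ^+ 2 * r * ln T%:R).
  have -> : 4 * n%:R * D * ln T%:R * T%:R = 2 ^+ 2 * (n%:R * ln T%:R) * (D * T%:R) by ring.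
  have y0 : 0 <= n%:R * ln T%:R :> R by rewrite mulr_ge0 // (le_trans _ l0).
  set y := n%:R * _ in y0 *.
  have -> : Num.sqrt (2 ^+ 2 * y * (D * T%:R)) = 2 * Num.sqrt y * r.
    by rewrite [LHS]sqrtrM ?[X in X * _]sqrtrM ?sqrtr_sqr ?ger0_norm // mulr_ge0 ?exprn_ge0.
  have -> : 16 * (n%:R ^+ 2 * r * ln T%:R) = 16 * n%:R * r * y by rewrite /y; ring.
  rewrite -{3}(sqr_sqrtr y0); ring.
by move: nrl; lra.
Qed.

End regret_bound.

(** [C] is chosen before all other data, so the bound is uniform in the graph, the noise, the budget
    and the horizon; [2 <= T] keeps [ln T] positive. *)
Theorem theorem4 (R : realType) :
  exists2 C : R, 0 < C &
  forall (U X : finType) (G : linear_model R U X)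
    (d : measure_display) (W : measurableType d) (P : probability W R)
    (eps : node U X -> {RV P >-> R})
    (db : measure_display) (Wb : measurableType db) (Pb : probability Wb R)
    (beps : params (transformed G eps) -> option X -> {RV Pb >-> R})
    (gam : option X -> {RV Pb >-> R})
    (K T : nat)
    (d' : measure_display) (Om : measurableType d') (Q : probability Om R)
    (draw : nat -> {mfun Om >-> W}) (S : nat -> Om -> {set X})
    (theta : nat -> Om -> params (transformed G eps)) (Sopt : {set X}),
  admissible G ->
  admissible_noise G eps ->
  admissible_binary_noise beps gam ->
  independent_rounds P Q T draw ->
  is_BLM_LR_run G eps draw S K T beps gam theta ->
  is_optimal G eps K Sopt ->
  (2 <= T)%N ->
  let n := nnodes X in
  let D := max_indegree (transformed G eps) in
  (regret G eps Q T Sopt S <=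
     (C * n%:R ^+ 2 * Num.sqrt (D * T)%:R * ln T%:R)%:E)%E.
Proof.
exists 18 => // U X G d W P eps db Wb Pb beps gam K T d' Om Q draw S theta Sopt.
move=> G_adm eps_adm binary_adm rounds_indep run Sopt_optimal T_ge2.
exact: (regret_bound G_adm eps_adm binary_adm rounds_indep run Sopt_optimal T_ge2).
Qed.
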